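(* Let $d\ge3$, let $V$ be the stationary mean-zero random potential described in the context, and assume that $V$ is uniformly bounded and has finite range of dependence (as defined in the context). Let $f\in\mathcal C_b(\mathbb R^d)$ be real-valued. For $\varepsilon>0$ let $u_\varepsilon$ solve $$\partial_t u_\varepsilon(t,x)=\tfrac12\Delta u_\varepsilon(t,x)+i\frac{1}{\sqrt\varepsilon}V\Big(\frac t\varepsilon,x\Big)u_\varepsilon(t,x),\qquad u_\varepsilon(0,x)=f(x),$$ and let $u_0$ be the solution (in the Stratonovich sense, as defined in the context) of $$\partial_t u_0(t,x)=\tfrac12\Delta u_0(t,x)+i\dot W(t,x)\circ u_0(t,x),\qquad u_0(0,x)=f(x),$$ where $\dot W$ is a Gaussian noise with covariance structure $\mathbb E\{\dot W(t,x)\dot W(s,y)\}=\delta(t-s)\int_{\mathbb R}R(r,x-y)\,dr$. Then for every fixed $t>0$ and $x\in\mathbb R^d$, $u_\varepsilon(t,x)\Rightarrow u_0(t,x)$ in distribution as $\varepsilon\to0$.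
   Context: Random medium: $(\Omega,\mathcal F,\mathbb P)$ is a probability space equipped with a group $\{\tau_{(t,x)}: t\in\mathbb R,\ x\in\mathbb R^d\}$ of measure-preserving transformations acting ergodically. $\mathbb V\in L^2(\Omega)$ is real-valued with $\int_\Omega \mathbb V\,d\mathbb P=0$, and $V(t,x)=V(t,x,\omega)=\mathbb V(\tau_{(t,x)}\omega)$. The operators $T_{(t,x)}g(\omega)=g(\tau_{(t,x)}\omega)$ form a strongly continuous group on $L^2(\Omega)$. $\mathbb E$ denotes expectation under $\mathbb P$ (and also with respect to the noise $W$), and $R(t,x)=\mathbb E\{V(t,x)V(0,0)\}$. Finite range of dependence: for $S\subseteq\mathbb R^{d+1}$ let $\mathcal F_S=\sigma(V(s,x):(s,x)\in S)$; there exists $M>0$ such that $\mathcal F_{S_1}$ and $\mathcal F_{S_2}$ are independent whenever $\mathrm{dist}(S_1,S_2)\ge M$ (Euclidean distance). $B$ is a standard $d$-dimensional Brownian motion started at $0$, independent of the medium and of the noise; $\mathbb E_B$ is expectation with respect to $B$. $\mathcal C_b(\mathbb R^d)$ is the space of bounded continuous functions. The solution $u_\varepsilon$ is given by the Feynman-Kac formula $$u_\varepsilon(t,x)=\mathbb E_B\Big\{f(x+B_t)\exp\Big(\frac{i}{\sqrt\varepsilon}\int_0^tV\big(\tfrac{t-s}{\varepsilon},x+B_s\big)ds\Big)\Big\}.$$ Definition of $u_0$: let $\mathcal R(x)=\int_{\mathbb R}R(t,x)dt$ and let $W(dt,dx)$ be the centered Gaussian noise on $\mathbb R\times\mathbb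 R^d$ with $\mathbb E\{W(g)W(h)\}=\int_{\mathbb R}\int_{\mathbb R^{2d}}g(r,y)h(r,z)\mathcal R(y-z)\,dy\,dz\,dr$, where $W(g)=\int g\,dW$. Put $\phi_\varepsilon(t)=\frac1\varepsilon 1_{[-\varepsilon,0]}(t)$, let $q_\varepsilon$ be the density of $N(0,\varepsilon I_d)$, and $W_\varepsilon(t,x)=\int_{\mathbb R^{d+1}}\phi_\varepsilon(t-s)q_\varepsilon(x-y)W(ds,dy)$. For almost every realization of $B$, $\int_0^t\dot W(t-s,x+B_s)ds$ denotes the $L^2$ limit (with respect to the noise) of $\int_0^tW_\varepsilon(t-s,x+B_s)ds$ as $\varepsilon\to0$. The solution of the SPDE in the Stratonovich sense is defined by $$u_0(t,x)=\mathbb E_B\Big\{f(x+B_t)\exp\Big(i\int_0^t\dot W(t-s,x+B_s)ds\Big)\Big\}.$$ *)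

(* Defs.v *)
From HB Require Import structures.
From mathcomp Require Import all_boot all_order all_algebra complex.
From mathcomp Require Import all_classical all_reals all_analysis.

Set Implicit Arguments.
Unset Strict Implicit.
Unset Printing Implicit Defensive.

Import Order.TTheory GRing.Theory Num.Theory.
Import numFieldNormedType.Exports.

Local Open Scope classical_set_scope.
Local Open Scope ring_scope.

(* R^n is 'rV[R]_n, with the library's topology, the sigma-algebra generated
   by the coordinates, and Lebesgue measure. *)

Definition rV_display : Type -> nat -> measure_display.
Proof. exact. Qed.

Section measurable_rV.
Context (R : realType) (n : nat).

Definition rV_cylinders : set (set 'rV[R]_n) :=
  [set C | exists i : 'I_n, exists2 A : set R,
    measurable A & C = [set x : 'rV[R]_n | A (x 0 i)]].

Let rV_set0 : <<s rV_cylinders >> set0.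
Proof. exact: sigma_algebra0. Qed.

Let rV_setC A : <<s rV_cylinders >> A -> <<s rV_cylinders >> (~` A).
Proof. exact: sigma_algebraC. Qed.

Let rV_bigcup (F : (set 'rV[R]_n)^nat) :
  (forall i, <<s rV_cylinders >> (F i)) ->
  <<s rV_cylinders >> (\bigcup_i (F i)).
Proof. exact: sigma_algebra_bigcup. Qed.

HB.instance Definition _ := @isMeasurable.Build (rV_display R n)
  'rV[R]_n <<s rV_cylinders >> rV_set0 rV_setC rV_bigcup.

Lemma measurable_rV_coord (i : 'I_n) :
  measurable_fun setT (fun x : 'rV[R]_n => x 0 i).
Proof.
move=> _ A mA; rewrite setTI.
by apply: sub_sigma_algebra; exists i; exists A.
Qed.

Lemma measurable_fun_rVP d (T : measurableType d) (f : T -> 'rV[R]_n) :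
  (forall i, measurable_fun setT (fun t => f t 0 i)) -> measurable_fun setT f.
Proof.
move=> mf; apply: (@measurability _ _ T _ setT f rV_cylinders) => //.
by move=> _ [_ [i [A mA ->]] <-]; exact: mf.
Qed.

End measurable_rV.

Section rV_cons.
Context (R : realType) (n : nat).

Definition rV_cons (p : R * 'rV[R]_n) : 'rV[R]_n.+1 :=
  \row_i oapp (p.2 0) p.1 (unlift ord0 i).

Definition rV_uncons (v : 'rV[R]_n.+1) : R * 'rV[R]_n :=
  (v 0 ord0, \row_j v 0 (lift ord0 j)).

Lemma rV_consK : cancel rV_cons rV_uncons.
Proof.
move=> [x v]; congr pair; first by rewrite mxE unlift_none.
by apply/rowP => j; rewrite !mxE liftK.
Qed.

Lemma measurable_rV_cons : measurable_fun setT rV_cons.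
Proof.
apply: measurable_fun_rVP => i.
case: (unliftP ord0 i) => [j|] ->.
  rewrite (_ : (fun _ => _) = (fun x : 'rV[R]_n => x 0 j) \o snd).
    exact: (measurableT_comp (measurable_rV_coord j) measurable_snd).
  by apply/funext => p; rewrite mxE liftK.
rewrite (_ : (fun _ => _) = fst) //.
by apply/funext => p; rewrite mxE unlift_none.
Qed.

Lemma measurable_rV_uncons : measurable_fun setT rV_uncons.
Proof.
apply/measurable_fun_pairP; split; first exact: measurable_rV_coord.
apply: measurable_fun_rVP => i.
rewrite (_ : (fun _ => _) = (fun v : 'rV[R]_n.+1 => v 0 (lift ord0 i))).
  exact: measurable_rV_coord.
by apply/funext => v /=; rewrite mxE.
Qed.

Variable m : {sigma_finite_measure set 'rV[R]_n -> \bar R}.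

Definition rV_lift_measure : set 'rV[R]_n.+1 -> \bar R :=
  pushforward (@lebesgue_measure R \x m)%E rV_cons.

HB.instance Definition _ := Measure.copy rV_lift_measure
  (measure_function_pushforward__canonical__measure_function_Measure
    (@lebesgue_measure R \x m)%E measurable_rV_cons).

Let rV_lift_sigma_finite : sigma_finite setT rV_lift_measure.
Proof.
have /sigma_finiteP[F [FT ndF Foo]] := sigma_finiteT (@lebesgue_measure R).
have /sigma_finiteP[G [GT ndG Goo]] := sigma_finiteT m.
exists (fun k => rV_uncons @^-1` (F k `*` G k)).
  apply/seteqP; split=> // v _.
  have [i _ Fi] : (\bigcup_k F k) (rV_uncons v).1 by rewrite -FT.
  have [j _ Gj] : (\bigcup_k G k) (rV_uncons v).2 by rewrite -GT.
  exists (maxn i j) => //; split.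
    by move: Fi; exact/subsetPset/ndF/leq_maxl.
  by move: Gj; exact/subsetPset/ndG/leq_maxr.
move=> k; have [mF Fk] := Foo k; have [mG Gk] := Goo k; split.
  rewrite -[X in measurable X]setTI.
  by apply: measurable_rV_uncons => //; exact: measurableX.
rewrite /rV_lift_measure /pushforward -comp_preimage.
rewrite (_ : rV_uncons \o rV_cons = id); last by apply/funext; exact: rV_consK.
by rewrite preimage_id product_measure1E// lte_mul_pinfty// ge0_fin_numE.
Qed.

HB.instance Definition _ :=
  Measure_isSigmaFinite.Build _ _ _ rV_lift_measure rV_lift_sigma_finite.

End rV_cons.

(* R^(n+1) = R x R^n, and R^0 is a point of mass 1 *)
Fixpoint lebesgue_rV (R : realType) (n : nat) :
    {sigma_finite_measure set 'rV[R]_n -> \bar R} :=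
  match n with
  | 0%N => dirac (0 : 'rV[R]_0)
  | n'.+1 => rV_lift_measure (lebesgue_rV R n')
  end.

Section random_medium.
Context (R : realType) (d : nat) (dO : measure_display) (Om : measurableType dO)
  (P : probability Om R).
Implicit Types (tau : R * 'rV[R]_d -> Om -> Om) (VV : Om -> R).

Record ergodic_action tau : Prop := ErgodicAction {
  action0 : forall w, tau 0 w = w ;
  actionD : forall z z' w, tau (z + z') w = tau z (tau z' w) ;
  action_measurable : forall z, measurable_fun setT (tau z) ;
  action_preserving : forall z A, measurable A -> P (tau z @^-1` A) = P A ;
  action_ergodic : forall A, measurable A ->
    (forall z, tau z @^-1` A = A) -> P A = 0%E \/ P A = 1%E }.

(* The maps g |-> g \o tau z form a strongly continuous group on L^2(P). *)
Definition strongly_continuous tau : Prop :=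
  forall g : Om -> R, g \in Lfun P 2%:E -> forall z0 : R * 'rV[R]_d,
  'N[P]_2%:E[(fun w => (g (tau z w) - g (tau z0 w))%:E)]%E @[z --> z0] --> 0%E.

Definition random_field tau VV (t : R) (x : 'rV[R]_d) (w : Om) : R := VV (tau (t, x) w).

(* Joint measurability of the field makes its integrals along paths meaningful;
   strong continuity alone only gives a jointly measurable modification. *)
Record stationary_medium tau VV : Prop := StationaryMedium {
  medium_ergodic : ergodic_action tau ;
  medium_continuous : strongly_continuous tau ;
  medium_L2 : VV \in Lfun P 2%:E ;
  medium_centered : ('E_P[VV] = 0)%E ;
  medium_measurable : measurable_fun setT
    (fun p : (R * 'rV[R]_d) * Om => random_field tau VV p.1.1 p.1.2 p.2) }.

Definition uniformly_bounded VV : Prop :=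
  exists C : R, {ae P, forall w, `|VV w| <= C}.

Definition field_sigma_algebra tau VV (S : set (R * 'rV[R]_d)) : set (set Om) :=
  <<s \bigcup_(z in S) g_sigma_algebra_preimage (random_field tau VV z.1 z.2) >>.

Definition independent_families (F G : set (set Om)) : Prop :=
  forall A B, F A -> G B -> P (A `&` B) = (P A * P B)%E.

Definition euclidean_dist (z z' : R * 'rV[R]_d) : R :=
  Num.sqrt ((z.1 - z'.1) ^+ 2 + \sum_(i < d) (z.2 0 i - z'.2 0 i) ^+ 2).

Definition set_dist (S S' : set (R * 'rV[R]_d)) : \bar R :=
  ereal_inf [set (euclidean_dist z z')%:E | z in S & z' in S']%classic.

Definition finite_range tau VV : Prop :=
  exists2 M : R, 0 < M & forall S S' : set (R * 'rV[R]_d),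
    (M%:E <= set_dist S S')%E ->
    independent_families (field_sigma_algebra tau VV S)
                         (field_sigma_algebra tau VV S').

Definition covariance_fun tau VV (t : R) (x : 'rV[R]_d) : R :=
  fine 'E_P[(fun w => random_field tau VV t x w * random_field tau VV 0%R 0%R w)%R]%E.

Definition space_covariance tau VV (x : 'rV[R]_d) : R :=
  \int[lebesgue_measure]_t covariance_fun tau VV t x.

End random_medium.

Section brownian_motion.
Context (R : realType) (dB : measure_display) (OB : measurableType dB)
  (PB : probability OB R).

Definition mutually_independent (I : finType) (X : I -> OB -> R) : Prop :=
  forall A : I -> set R, (forall i, measurable (A i)) ->
  PB (\bigcap_(i in setT) (X i @^-1` A i)) =
  (\prod_(i : I) PB (X i @^-1` A i))%E.

(* Independence of the increments over successive time intervals and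
   independence of the coordinates are stated together: all the coordinates of
   all the increments form one mutually independent family. *)
Record standard_brownian (d : nat) (B : R -> OB -> 'rV[R]_d) : Prop :=
  StandardBrownian {
  brownian_measurable : forall s, 0 <= s -> measurable_fun setT (B s) ;
  brownian0 : forall b, B 0 b = 0 ;
  brownian_continuous : forall b,
    {within `[0, +oo[, continuous (fun s => B s b)} ;
  brownian_normal : forall (s t : R) (i : 'I_d) (A : set R),
    0 <= s -> s < t -> measurable A ->
    PB [set b | A (B t b 0 i - B s b 0 i)] = normal_prob 0 (Num.sqrt (t - s)) A ;
  brownian_independent : forall (n : nat) (s : nat -> R),
    0 <= s 0%N -> (forall k, s k < s k.+1) ->
    mutually_independent (fun (ki : 'I_n * 'I_d) (b : OB) =>
      B (s ki.1.+1) b 0 ki.2 - B (s ki.1) b 0 ki.2) }.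

Definition expectationC (Z : OB -> R[i]) : R[i] :=
  Complex (\int[PB]_b complex.Re (Z b)) (\int[PB]_b complex.Im (Z b)).

End brownian_motion.

Definition expi (R : realType) (theta : R) : R[i] :=
  Complex (cos theta) (sin theta).

Definition feynman_kac (R : realType) (d : nat)
  (dO : measure_display) (Om : measurableType dO)
  (dB : measure_display) (OB : measurableType dB) (PB : probability OB R)
  (B : R -> OB -> 'rV[R]_d) (V : R -> 'rV[R]_d -> Om -> R) (f : 'rV[R]_d -> R)
  (eps t : R) (x : 'rV[R]_d) (w : Om) : R[i] :=
  expectationC PB (fun b => (f (x + B t b))%:C%C *
    expi ((Num.sqrt eps)^-1 *
      \int[lebesgue_measure]_(s in `[0, t]) V ((t - s) / eps) (x + B s b) w)).

Section gaussian_noise.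
Context (R : realType) (d : nat) (dW : measure_display) (OW : measurableType dW)
  (Q : probability OW R).
Implicit Types (K : 'rV[R]_d -> R) (g h : R * 'rV[R]_d -> R).

(* normal_prob 0 0 is not a Dirac mass in the library, so the degenerate case is
   separate. *)
Definition centered_gaussian (X : OW -> R) : Prop :=
  {ae Q, forall w, X w = 0} \/
  exists2 s : R, 0 < s &
    forall A : set R, measurable A -> Q (X @^-1` A) = normal_prob 0 s A.

(* L^2 in time with values in L^1 in space: for bounded K the covariance
   integral of two such functions converges absolutely. *)
Definition noise_test g : Prop :=
  measurable_fun setT g /\
  (\int[lebesgue_measure]_r
     (\int[lebesgue_rV R d]_y `|g (r, y)|%:E) ^+ 2 < +oo)%E.

Definition noise_covariance K g h : R :=
  \int[lebesgue_measure]_r \int[(lebesgue_rV R d \x lebesgue_rV R d)%E]_yz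
    (g (r, yz.1) * h (r, yz.2) * K (yz.1 - yz.2)).

Record gaussian_noise K (W : (R * 'rV[R]_d -> R) -> {RV Q >-> R}) : Prop :=
  GaussianNoise {
  noise_gaussian : forall (n : nat) (g : 'I_n -> R * 'rV[R]_d -> R)
    (a : 'I_n -> R), (forall k, noise_test (g k)) ->
    centered_gaussian (fun w => \sum_(k < n) a k * W (g k) w) ;
  noise_cov : forall g h, noise_test g -> noise_test h ->
    'E_Q[(fun w => W g w * W h w)%R]%E = (noise_covariance K g h)%:E }.

Definition time_mollifier (eps t : R) : R :=
  eps^-1 * \1_(`[- eps, 0]%classic : set R) t.

(* density of N(0, eps I_d) *)
Definition space_mollifier (eps : R) (x : 'rV[R]_d) : R :=
  \prod_(i < d) normal_pdf 0 (Num.sqrt eps) (x 0 i).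

(* Weps is a jointly measurable version of the random field
   (t, x) |-> int phi_eps(t - s) q_eps(x - y) W(ds, dy), whose values are
   otherwise determined only almost surely for each (t, x). *)
Definition mollified_noise (W : (R * 'rV[R]_d -> R) -> {RV Q >-> R})
    (Weps : R -> R -> 'rV[R]_d -> OW -> R) : Prop :=
  forall eps : R, 0 < eps ->
  measurable_fun setT
    (fun p : (R * 'rV[R]_d) * OW => Weps eps p.1.1 p.1.2 p.2) /\
  forall (t : R) (x : 'rV[R]_d), {ae Q, forall w, Weps eps t x w =
    W (fun z => time_mollifier eps (t - z.1) * space_mollifier eps (x - z.2)) w}.

Context (dB : measure_display) (OB : measurableType dB) (PB : probability OB R).
Variable B : R -> OB -> 'rV[R]_d.

(* X b is the integral of the noise along the reversed path b: for almost every
   path, the limit in L^2(Q) of the integrals of the mollified noise. *)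
Definition noise_integral (Weps : R -> R -> 'rV[R]_d -> OW -> R)
    (t : R) (x : 'rV[R]_d) (X : OB -> OW -> R) : Prop :=
  measurable_fun setT (fun p : OB * OW => X p.1 p.2) /\
  {ae PB, forall b,
    'N[Q]_2%:E[(fun w =>
      ((\int[lebesgue_measure]_(s in `[0%R, t]) Weps eps (t - s) (x + B s b) w)
        - X b w)%:E)]%E @[eps --> 0^'+] --> 0%E}.

Definition stratonovich_solution (W : (R * 'rV[R]_d -> R) -> {RV Q >-> R})
    (f : 'rV[R]_d -> R) (u : R -> 'rV[R]_d -> OW -> R[i]) : Prop :=
  exists2 Weps, mollified_noise W Weps &
  forall (t : R) (x : 'rV[R]_d), 0 < t ->
  exists2 X, noise_integral Weps t x X &
  forall w, u t x w =
    expectationC PB (fun b => (f (x + B t b))%:C%C * expi (X b w)).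

End gaussian_noise.

Section convergence_in_distribution.
Context (R : realType).

(* the complex plane with the topology of its norm *)
Definition complex_plane : normedModType R[i] := ((R[i] : numFieldType)^o).

Definition complex_RV d (T : measurableType d) (Z : T -> R[i]) : Prop :=
  measurable_fun setT (fun w => complex.Re (Z w)) /\
  measurable_fun setT (fun w => complex.Im (Z w)).

Definition cvg_in_distribution d (T : measurableType d) (P : probability T R)
    d' (T' : measurableType d') (Q : probability T' R)
    (u : R -> T -> R[i]) (u0 : T' -> R[i]) : Prop :=
  [/\ forall eps, 0 < eps -> complex_RV (u eps),
      complex_RV u0 &
      forall g : complex_plane -> R, continuous g -> bounded_fun g ->
        'E_P[(fun w => g (u eps w))]%E @[eps --> 0^'+] --> 'E_Q[(fun w => g (u0 w))]%E].

End convergence_in_distribution.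

(* Main.v *)
(* Write E_B for the expectation over the path. A product of factors
   U_q = E_B[f(x + B_t) cos(Y_eps(B) + q)], where Y_eps(b) is the phase
   accumulated along b, is by Fubini an average, over independent paths
   b_1, .., b_k, of cosines of sums +- Y_eps(b_1) +- .. +- Y_eps(b_k); so joint
   moments of (Re u_eps, Im u_eps), which are bounded, converge as soon as for
   fixed paths the linear combinations of phases converge in law, and Bernstein
   polynomials pass from moments to continuous test functions.

   For fixed paths the combination is eps^(-1/2) times a time integral of a
   centered bounded field of dependence range M eps in time. By Stein's method
   its characteristic function is within O(eps^(1/2)) of the Gaussian one with
   the same variance, and the variance tends to
   \int_0^t \sum a_j a_k \mathcal R(b_j(s) - b_k(s)) ds. The same variance is
   obtained for the noise, as the limit of the covariances of the mollified
   noise integrals. *)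
Require Import Defs.
From HB Require Import structures.
From mathcomp Require Import all_boot all_order all_algebra complex.
From mathcomp Require Import all_classical all_reals all_analysis.
From mathcomp Require Import measurable_realfun ring lra.

Set Implicit Arguments.
Unset Strict Implicit.
Unset Printing Implicit Defensive.

Import Order.TTheory GRing.Theory Num.Theory.
Import numFieldNormedType.Exports.

Local Open Scope classical_set_scope.
Local Open Scope ring_scope.

(** * Bounded integrands and Fubini theorems *)

(** The two sides live on different probability spaces and are matched only through the numbers
    [expR (- (v / 2)) * cos q], with the same [v] for the medium and for the noise; the shift [q]
    lets one formula serve cosines and sines. Three obstacles shape the proof. Integrals of the
    field along a path are measurable for the full sigma-algebra, but nothing makes them measurable
    for the sigma-algebra that the field generates on a set of points; so independence is used for
    finite products of field values and carried over to functions of integrals by Fubini and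
    polynomial approximation. The noise [W] is given through Gaussian laws and covariances, so
    exchanging it with a time integral is an identity to be proved in [L^2]. Finally, many
    statements hold outside a null set that depends on the point, the time or the path: the field is
    clamped to its essential bound, paths are restricted to those along which the noise integral
    exists, and Fubini exchanges the exceptional sets. *)

Definition clamp (R : realType) (D x : R) : R := Num.max (- D) (Num.min D x).

Section clamp.
Context (R : realType).
Implicit Types D x : R.

Lemma norm_clamp_le D x : 0 <= D -> `|clamp D x| <= D.
Proof.
move=> D0; rewrite ler_norml /clamp !(le_max, ge_max, ge_min, lexx)//= andbT.
by rewrite -subr_ge0 opprK addr_ge0.
Qed.

Lemma clamp_id D x : `|x| <= D -> clamp D x = x.
Proof.
by rewrite ler_norml /clamp => /andP[h1 h2]; rewrite (min_idPr h2) (max_idPr h1).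
Qed.

Lemma measurable_clamp D : measurable_fun setT (clamp D).
Proof. by apply: measurable_maxr => //; exact: measurable_minr. Qed.

End clamp.

Section bounded_integrals.
Context d (T : measurableType d) (R : realType).
Variable mu : {finite_measure set T -> \bar R}.
Implicit Types f g : T -> R.

Lemma integrable_bounded f (C : R) : measurable_fun setT f ->
  (forall x, `|f x| <= C) -> mu.-integrable setT (EFin \o f).
Proof.
move=> mf fC; apply: measurable_bounded_integrable => //.
  by rewrite -ge0_fin_numE ?measure_ge0//; exact: fin_num_measure.
exists C; split; first exact: num_real.
by move=> M CM x _ /=; rewrite (le_trans (fC x))// ltW.
Qed.

Lemma eq_Rintegral_ae f g : measurable_fun setT f -> measurable_fun setT g ->
  {ae mu, forall x, f x = g x} -> \int[mu]_x f x = \int[mu]_x g x.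
Proof.
move=> mf mg fg; congr fine; apply: ae_eq_integral => //.
- exact/measurable_EFinP.
- exact/measurable_EFinP.
- by apply: filterS fg => x -> _.
Qed.

Lemma Rintegral_bound f (C : R) : measurable_fun setT f ->
  (forall x, `|f x| <= C) -> `|\int[mu]_x f x| <= C * fine (mu setT).
Proof.
move=> mf fC; have If := integrable_bounded mf fC.
apply: (le_trans (le_normr_Rintegral measurableT If)).
rewrite -Rintegral_cst//; apply: le_Rintegral => //.
- apply: (@integrable_bounded _ C) => [|x]; first exact: measurableT_comp.
  by rewrite normr_id.
- by apply: (@integrable_bounded _ `|C|) => // x.
Qed.

Lemma Rintegral_dominated (f_ : (T -> R)^nat) f (C : R) :
  (forall n, measurable_fun setT (f_ n)) -> measurable_fun setT f ->
  (forall n x, `|f_ n x| <= C) ->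
  {ae mu, forall x, f_ n x @[n --> \oo] --> f x} ->
  \int[mu]_x f_ n x @[n --> \oo] --> \int[mu]_x f x.
Proof.
move=> mf_ mf fC cf.
have mE n : measurable_fun setT (EFin \o f_ n) by exact/measurable_EFinP.
have mE' : measurable_fun setT (EFin \o f) by exact/measurable_EFinP.
have cE : {ae mu, forall x, setT x ->
    (EFin \o f_ n) x @[n --> \oo] --> (EFin \o f) x}.
  apply: filterS cf => x h _ /=.
  by apply: cvg_EFin; [exact: nearW|exact: h].
have IC : mu.-integrable setT (EFin \o cst C).
  by apply: (@integrable_bounded _ `|C|) => // x.
have [If _ h] := dominated_convergence measurableT mE mE' cE IC
    (aeW _ (fun x n _ => fC n x)).
apply: fine_cvg; rewrite fineK; last exact: integrable_fin_num.
exact: h.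
Qed.

End bounded_integrals.

Lemma Rintegral_probability_bound d (T : measurableType d) (R : realType)
    (P : probability T R) (f : T -> R) (C : R) : measurable_fun setT f ->
  (forall x, `|f x| <= C) -> `|\int[P]_x f x| <= C.
Proof.
move=> mf fC; have := Rintegral_bound P mf fC.
by rewrite (_ : fine _ = 1) ?mulr1//= probability_setT.
Qed.

Section fubini_Rintegral.
Context d1 d2 (T1 : measurableType d1) (T2 : measurableType d2) (R : realType).
Implicit Types f : T1 * T2 -> R.

(** Tonelli makes the integrals of the positive and negative parts measurable even where they are
    infinite, and [fine] is measurable. *)
Lemma measurable_Rintegral_snd (m2 : {sigma_finite_measure set T2 -> \bar R}) f :
  measurable_fun setT f ->
  measurable_fun setT (fun x => \int[m2]_y f (x, y)).
Proof.
move=> mf; have mfE : measurable_fun setT (EFin \o f) by exact/measurable_EFinP.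
apply: (measurableT_comp (fine_measurable measurableT)) => //.
rewrite (_ : (fun _ => _) = (fun x => fubini_F m2 (EFin \o f)^\+ x
    - fubini_F m2 (EFin \o f)^\- x)%E); last first.
    apply/funext => x; rewrite integralE.
  rewrite /fubini_F /fubini_G.
  congr (_ - _)%E; apply: eq_integral => y _;
    by rewrite !(funeposE, funenegE).
apply: emeasurable_funB.
- by apply: measurable_fun_fubini_tonelli_F => //; exact: measurable_funepos.
- by apply: measurable_fun_fubini_tonelli_F => //; exact: measurable_funeneg.
Qed.

Lemma measurable_Rintegral_fst (m1 : {sigma_finite_measure set T1 -> \bar R}) f :
  measurable_fun setT f ->
  measurable_fun setT (fun y => \int[m1]_x f (x, y)).
Proof.
move=> mf; have mfE : measurable_fun setT (EFin \o f) by exact/measurable_EFinP.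
apply: (measurableT_comp (fine_measurable measurableT)) => //.
rewrite (_ : (fun _ => _) = (fun y => fubini_G m1 (EFin \o f)^\+ y
    - fubini_G m1 (EFin \o f)^\- y)%E); last first.
    apply/funext => x; rewrite integralE.
  rewrite /fubini_F /fubini_G.
  congr (_ - _)%E; apply: eq_integral => y _;
    by rewrite !(funeposE, funenegE).
apply: emeasurable_funB.
- by apply: measurable_fun_fubini_tonelli_G => //; exact: measurable_funepos.
- by apply: measurable_fun_fubini_tonelli_G => //; exact: measurable_funeneg.
Qed.

Section fubini.
Variables (m1 : {sigma_finite_measure set T1 -> \bar R}).
Variables (m2 : {sigma_finite_measure set T2 -> \bar R}).

(** The inner [fine] is harmless because almost every section of an integrable function is
    integrable. *)
Lemma Rintegral12_prod f : (m1 \x m2)%E.-integrable setT (EFin \o f) ->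
  \int[m1]_x \int[m2]_y f (x, y) = \int[(m1 \x m2)%E]_z f z.
Proof.
move=> If; rewrite [RHS]/Rintegral -integral12_prod_meas1//; congr fine.
have mf : measurable_fun setT f.
  by have /integrableP[/measurable_EFinP] := If.
apply: ae_eq_integral => //.
- exact/measurable_EFinP/measurable_Rintegral_snd.
- exact: measurable_fubini_F If.
- have := ae_integrable1 If; apply: filterS => x Ix _.
  rewrite /Rintegral fineK//; exact: integrable_fin_num Ix.
Qed.

Lemma Rintegral21_prod f : (m1 \x m2)%E.-integrable setT (EFin \o f) ->
  \int[m2]_y \int[m1]_x f (x, y) = \int[(m1 \x m2)%E]_z f z.
Proof.
move=> If; rewrite [RHS]/Rintegral -integral21_prod_meas1//; congr fine.
have mf : measurable_fun setT f.
  by have /integrableP[/measurable_EFinP] := If.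
apply: ae_eq_integral => //.
- exact/measurable_EFinP/measurable_Rintegral_fst.
- exact: measurable_fubini_G If.
- have := ae_integrable2 If; apply: filterS => x Ix _.
  rewrite /Rintegral fineK//; exact: integrable_fin_num Ix.
Qed.

Lemma Rintegral_Fubini f : (m1 \x m2)%E.-integrable setT (EFin \o f) ->
  \int[m1]_x \int[m2]_y f (x, y) = \int[m2]_y \int[m1]_x f (x, y).
Proof. by move=> If; rewrite Rintegral12_prod// Rintegral21_prod. Qed.

End fubini.

Section finite.
Variables (m1 : {finite_measure set T1 -> \bar R}).
Variables (m2 : {finite_measure set T2 -> \bar R}).

Lemma integrable_prod_bounded f (C : R) : measurable_fun setT f ->
  (forall z, `|f z| <= C) -> (m1 \x m2)%E.-integrable setT (EFin \o f).
Proof.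
move=> mf fC; apply: measurable_bounded_integrable => //.
  have /= h := @product_measure1E _ _ T1 T2 R m1 m2 _ _ measurableT measurableT.
  apply: (@le_lt_trans _ _ (m1 setT * m2 setT)%E); first by rewrite -h setXTT.
  by rewrite -ge0_fin_numE ?mule_ge0// fin_numM// fin_num_measure.
exists C; split; first exact: num_real.
by move=> M CM x _ /=; rewrite (le_trans (fC x))// ltW.
Qed.

Lemma Rintegral_Fubini_bounded f (C : R) : measurable_fun setT f ->
  (forall z, `|f z| <= C) ->
  \int[m1]_x \int[m2]_y f (x, y) = \int[m2]_y \int[m1]_x f (x, y).
Proof.
by move=> mf fC; apply: Rintegral_Fubini; exact: integrable_prod_bounded fC.
Qed.

End finite.
End fubini_Rintegral.

(** * Change of variables along a measurable map *)

Section image_measure.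
Context d1 d2 (X : measurableType d1) (Y : measurableType d2) (R : realType).
Variables (mu : {measure set X -> \bar R}) (nu : {measure set Y -> \bar R}).
Variables (phi : X -> Y) (mphi : measurable_fun setT phi).
Hypothesis nuE : forall A, measurable A -> nu A = mu (phi @^-1` A).

(** [nuE] asks for equality on measurable sets rather than for a pushforward, so that the same lemma
    serves laws of random variables, measure-preserving maps and Lebesgue measure on row vectors. *)
Lemma ge0_integral_image (f : Y -> \bar R) : measurable_fun setT f ->
  (forall y, 0 <= f y)%E -> (\int[nu]_y f y = \int[mu]_x f (phi x))%E.
Proof.
move=> mf f0.
rewrite (eq_measure_integral
  (measure_function_pushforward__canonical__measure_function_Measure mu mphi)).
  by rewrite (ge0_integral_pushforward mphi)//= preimage_setT.
by move=> A mA _; rewrite nuE.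
Qed.

Lemma Rintegral_image (f : Y -> R) : measurable_fun setT f ->
  \int[nu]_y f y = \int[mu]_x f (phi x).
Proof.
move=> mf; have mfE : measurable_fun setT (EFin \o f) by exact/measurable_EFinP.
congr fine; rewrite integralE [RHS]integralE.
congr (_ - _)%E.
- have := @ge0_integral_image (EFin \o f)^\+%E (measurable_funepos mfE).
  move=> /(_ (fun=> funepos_ge0 _ _)) ->.
  by apply: eq_integral => x _; rewrite !funeposE.
- have := @ge0_integral_image (EFin \o f)^\-%E (measurable_funeneg mfE).
  move=> /(_ (fun=> funeneg_ge0 _ _)) ->.
  by apply: eq_integral => x _; rewrite !funenegE.
Qed.

Lemma integrable_image (f : Y -> R) : measurable_fun setT f ->
  nu.-integrable setT (EFin \o f) <-> mu.-integrable setT (EFin \o (f \o phi)).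
Proof.
move=> mf; have mfE : measurable_fun setT (EFin \o f) by exact/measurable_EFinP.
have e : (\int[nu]_y `|(f y)%:E| = \int[mu]_x `|(f (phi x))%:E|)%E.
  apply: (ge0_integral_image (f := fun y => `|(f y)%:E|%E)) => //.
  exact: measurableT_comp.
split=> /integrableP[_ h]; apply/integrableP; split.
- by apply/measurable_EFinP; exact: measurableT_comp.
- by rewrite /= -e.
- exact/measurable_EFinP.
- by rewrite /= e.
Qed.

End image_measure.

(* Lebesgue measure of the library lives on a copy of R with another display. *)
Definition leb (R : realType) (A : set R) : \bar R := @lebesgue_measure R A.

HB.instance Definition _ (R : realType) :=
  isMeasure.Build default_measure_display R R (@leb R)
    (measure0 (@lebesgue_measure R))
    (fun A => @measure_ge0 _ _ _ (@lebesgue_measure R) A)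
    (@measure_semi_sigma_additive _ _ _ (@lebesgue_measure R)).

HB.instance Definition _ (R : realType) :=
  Measure_isSigmaFinite.Build _ _ _ (@leb R)
    (sigma_finiteT (@lebesgue_measure R)).

Lemma Rintegral_leb (R : realType) (f : R -> R) : measurable_fun setT f ->
  \int[@leb R]_x f x = \int[lebesgue_measure]_x f x.
Proof.
exact: (@Rintegral_image _ _ (measurableTypeR R) R R (@lebesgue_measure R)
  (@leb R) id).
Qed.

(** * Finite measures on time intervals *)

Section restricted_measure.
Context d (T : measurableType d) (R : realType).
Variables (mu : {measure set T -> \bar R}) (D : set T).
Variables (mD : measurable D) (Doo : (mu D < +oo)%E).

Definition restricted_measure : {finite_measure set T -> \bar R} :=
  mfrestr mD Doo.

Lemma Rintegral_restricted_measure (f : T -> R) : measurable_fun setT f ->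
  \int[restricted_measure]_s f s = \int[mu]_(s in D) f s.
Proof.
move=> mf; have mfE : measurable_fun setT (EFin \o f) by exact/measurable_EFinP.
congr fine.
transitivity (\int[restricted_measure]_s ((EFin \o f) \_ D) s)%E.
  apply: ae_eq_integral => //.
    by apply/measurable_restrict => //; exact: measurable_funTS.
  exists (~` D); split; first exact: measurableC.
    by rewrite /= /mfrestr /mrestr setICl measure0.
  move=> x /= h Dx; apply: h => _.
  by rewrite patchE mem_set.
rewrite -integral_mkcond; apply: eq_measure_integral => A mA AD.
by rewrite /= /mfrestr /mrestr setIidl.
Qed.

End restricted_measure.

Section interval_measure.
Context (R : realType).
Variables a b : R.

Lemma lebesgue_itv_lty : (@leb R `[a, b] < +oo)%E.
Proof.
by rewrite /= /leb lebesgue_measure_itv/=; case: ifPn => // _; rewrite ltry.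
Qed.

(** A finite measure on the whole line instead of an integral over a domain: bounded functions are
    then integrable over [setT], and the bounded Fubini theorem applies directly. *)
Definition itv_measure : {finite_measure set R -> \bar R} :=
  @restricted_measure _ _ R (@leb R) _ (measurable_itv `[a, b])
    lebesgue_itv_lty.

Lemma Rintegral_itv_measure (f : R -> R) : measurable_fun setT f ->
  \int[itv_measure]_s f s = \int[lebesgue_measure]_(s in `[a, b]) f s.
Proof.
move=> mf; rewrite Rintegral_restricted_measure//.
rewrite Rintegral_mkcond Rintegral_leb -?Rintegral_mkcond//.
by apply/measurable_restrict => //; exact: measurable_funTS.
Qed.

Lemma Rintegral_itv_bound (f : R -> R) (C : R) : a <= b -> measurable_fun setT f ->
  (forall x, `|f x| <= C) -> `|\int[itv_measure]_s f s| <= C * (b - a).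
Proof.
move=> ab mf fC; have := Rintegral_bound itv_measure mf fC.
rewrite (_ : fine _ = b - a)//= /mfrestr /mrestr setTI /= /leb.
rewrite lebesgue_measure_itv/= lte_fin.
by case: ltgtP ab => // -> _; rewrite subrr.
Qed.

(** A window of radius [r] has length at most [2 * r]. This is what makes the times within the
    dependence range contribute little to a time integral. *)
Lemma Rintegral_itv_near_bound (f : R -> R) (C x r : R) : 0 <= C -> 0 <= r ->
  measurable_fun setT f -> (forall x, `|f x| <= C) ->
  `|\int[itv_measure]_s (\1_[set s | `|s - x| < r] s * f s)| <= C * (2 * r).
Proof.
move=> C0 r0 mf fC; pose D := [set s : R | `|s - x| < r].
have DE : D = `]x - r, x + r[%classic.
  by apply/seteqP; split=> s; rewrite /D/= in_itv/= ltr_distl.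
have mD : measurable D by rewrite DE; exact: measurable_itv.
have m1 : measurable_fun setT (\1_D : R -> R) by exact: measurable_indic.
have mDf : measurable_fun setT (fun s => \1_D s * f s) by exact: measurable_funM.
have ind_ge0 s : 0 <= \1_D s :> R by rewrite indicE.
have I1 : itv_measure.-integrable setT (EFin \o (fun s => C * \1_D s)).
  apply: (@integrable_bounded _ _ _ _ _ (C * 1)) => [|s]; first exact: measurable_funM.
  rewrite normrM (ger0_norm C0) ler_wpM2l// indicE.
  by case: (_ \in _); rewrite ?normr1 ?normr0.
have I2 : itv_measure.-integrable setT (EFin \o (fun s => \1_D s * f s)).
  apply: le_integrable I1 => //; first exact/measurable_EFinP.
  move=> s _ /=; rewrite lee_fin normrM [leRHS]normrM mulrC.
  by rewrite ler_wpM2r// (le_trans (fC s))// ler_norm.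
rewrite (le_trans (le_normr_Rintegral _ I2))//.
apply: (@le_trans _ _ (\int[itv_measure]_s (C * \1_D s))).
  apply: le_Rintegral => //; first exact: integrable_norm I2.
  by move=> s _; rewrite normrM (ger0_norm (ind_ge0 s)) mulrC ler_wpM2r.
have I3 : itv_measure.-integrable setT (EFin \o (\1_D : R -> R)).
  apply: (@integrable_bounded _ _ _ _ _ 1) => // s.
  by rewrite indicE; case: (_ \in _); rewrite ?normr1 ?normr0.
rewrite RintegralZl// ler_wpM2l// /Rintegral integral_indic// setIT.
have h : (itv_measure D <= (2 * r)%:E)%E.
  rewrite /= /mfrestr /mrestr; apply: (@le_trans _ _ (leb D)).
    by rewrite le_measure ?inE//; exact: measurableI.
  rewrite /leb DE lebesgue_measure_itv/=; case: ifPn => _.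
    by rewrite -EFinB lee_fin; lra.
  by rewrite lee_fin mulr_ge0.
have fn : itv_measure D \is a fin_num by exact: fin_num_measure.
by rewrite -lee_fin fineK.
Qed.

End interval_measure.

(** * Moments and Bernstein polynomials *)

Section trigonometric_bounds.
Context (R : realType).
Implicit Types a x y : R.

Lemma sin_shift x : sin x = cos (x - pi / 2).
Proof. by rewrite cosB cos_pihalf sin_pihalf mulr0 add0r mulr1. Qed.

Let mvt_bound (f df : R -> R) x y : (forall z : R, is_derive z 1 f (df z)) ->
  exists2 c, `|c - x| <= `|y - x| & f y - f x = df c * (y - x).
Proof.
move=> fP; have cf a b : {within `[a, b], continuous f}.
  by apply: derivable_within_continuous => z _; have [] := fP z.
case: (leP x y) => [xy|/ltW yx].
  have [c cxy ->] := MVT_segment xy (fun z _ => fP z) (cf _ _).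
  exists c => //; move: cxy; rewrite in_itv/= => /andP[xc cy].
  by rewrite !ger0_norm ?subr_ge0// lerD2r.
have [c cxy e] := MVT_segment yx (fun z _ => fP z) (cf _ _).
exists c; last by rewrite -opprB e -mulrN opprB.
move: cxy; rewrite in_itv/= => /andP[xc cy].
by rewrite distrC (distrC y) !ger0_norm ?subr_ge0// lerD2l lerN2.
Qed.

Lemma norm_cosB x y : `|cos x - cos y| <= `|x - y|.
Proof.
have [c _ ->] := mvt_bound y x (fun z => is_derive_cos z).
by rewrite normrM normrN ler_piMl// ler_norml sin_geN1 sin_le1.
Qed.

(** The mean value theorem gives [x * cos c] with [c] within [|x|] of [a], and cosine is
    1-Lipschitz. *)
Lemma sin_taylor1 a x : `|sin (a + x) - sin a - x * cos a| <= x ^+ 2.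
Proof.
have [c ca ->] := mvt_bound a (a + x) (fun z => is_derive_sin z).
rewrite addrAC subrr add0r in ca *.
rewrite mulrC -mulrBr normrM -(real_normK (num_real x)) expr2 ler_wpM2l//.
exact: le_trans (norm_cosB _ _) ca.
Qed.

Lemma measurable_cos : measurable_fun setT (@cos R).
Proof. exact: (continuous_measurable_fun (@continuous_cos R)). Qed.

Lemma measurable_sin : measurable_fun setT (@sin R).
Proof. exact: (continuous_measurable_fun (@continuous_sin R)). Qed.

End trigonometric_bounds.

(** * Bernstein polynomials in one and two variables *)

Section weierstrass.
Context (R : realType).
Implicit Types (F G : nat -> R) (x y : R).

(* Expectation of F (s + S_k) for a random walk S with Bernoulli(x) steps; for
   F s = h (s / n) and k = n this is the Bernstein polynomial of h. *)
Fixpoint bernoulli_walk F k s x : R :=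
  if k is k'.+1 then
    x * bernoulli_walk F k' s.+1 x + (1 - x) * bernoulli_walk F k' s x
  else F s.

Lemma le_bernoulli_walk F G k s x : 0 <= x <= 1 -> (forall i, F i <= G i) ->
  bernoulli_walk F k s x <= bernoulli_walk G k s x.
Proof.
move=> /andP[x0 x1] FG; elim: k s => //= k IH s.
by rewrite lerD// ler_wpM2l// subr_ge0.
Qed.

(** Squared bias plus variance: after [k] steps from [s] the walk has mean [s + k x] and variance
    [k x (1 - x)]. Quadratics are the only functions whose expectation under the walk has to be
    computed. *)
Lemma bernoulli_walk_quadratic (a c m : R) (n k s : nat) x : 
  bernoulli_walk (fun i => a + c * (i%:R / n%:R - m) ^+ 2) k s x =
  a + c * ((s%:R / n%:R + k%:R * x / n%:R - m) ^+ 2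
           + k%:R * x * (1 - x) / n%:R ^+ 2).
Proof.
elim: k s => [|k IH] s /=; first by rewrite !mul0r !addr0.
rewrite !IH -(natr1 s) -(natr1 k) !mulrDl !mul1r -exprVn.
set i := n%:R^-1; ring.
Qed.

(** [F] is squeezed between two quadratics, whose expectations are known; centered at the mean [x]
    the bias vanishes, and the variance [x * (1 - x) / n] is at most [1 / n]. *)
Lemma bernoulli_walk_dist F (a c v x : R) (n : nat) : (0 < n)%N -> 0 <= x <= 1 -> 0 <= c ->
  (forall i, `|F i - v| <= a + c * (i%:R / n%:R - x) ^+ 2) ->
  `|bernoulli_walk F n 0 x - v| <= a + c / n%:R.
Proof.
move=> n0 x01 c0 Fv; have n0' : n%:R != 0 :> R by rewrite pnatr_eq0 -lt0n.
have b : x * (1 - x) / n%:R <= n%:R^-1.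
  rewrite -[leRHS]mul1r ler_wpM2r ?invr_ge0//.
  by case/andP: x01 => ? ?; nra.
have e : 0%:R / n%:R + n%:R * x / n%:R - x = 0.
  by rewrite mul0r add0r mulrAC divff// mul1r subrr.
have e2 : n%:R * x * (1 - x) / n%:R ^+ 2 = x * (1 - x) / n%:R by field.
rewrite ler_distl; apply/andP; split.
- apply: (@le_trans _ _ (bernoulli_walk
    (fun i => (v - a) + (- c) * (i%:R / n%:R - x) ^+ 2) n 0 x)).
    rewrite bernoulli_walk_quadratic e e2 expr0n add0r mulNr -addrA lerD2l opprD lerD2l.
    by rewrite lerN2 ler_wpM2l.
  apply: le_bernoulli_walk => // i; have := Fv i.
  by rewrite ler_distl => /andP[h _]; rewrite mulNr -addrA -opprD.
- apply: (@le_trans _ _ (bernoulli_walk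
    (fun i => (v + a) + c * (i%:R / n%:R - x) ^+ 2) n 0 x)).
    apply: le_bernoulli_walk => // i; have := Fv i.
    by rewrite ler_distl => /andP[_ h]; rewrite -addrA.
  rewrite bernoulli_walk_quadratic e e2 expr0n add0r -addrA lerD2l lerD2l.
  by rewrite ler_wpM2l.
Qed.

(** Generated by multiplication with one variable at a time, because each such step adds exactly one
    factor to a moment; inductions on this predicate are inductions on moments. *)
Inductive polynomial2 : (R -> R -> R) -> Prop :=
| polynomial2_cst c : polynomial2 (fun _ _ => c)
| polynomial2_add p q : polynomial2 p -> polynomial2 q ->
    polynomial2 (fun x y => p x y + q x y)
| polynomial2_scale c p : polynomial2 p -> polynomial2 (fun x y => c * p x y)
| polynomial2_mulx p : polynomial2 p -> polynomial2 (fun x y => x * p x y)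
| polynomial2_muly p : polynomial2 p -> polynomial2 (fun x y => y * p x y).

Lemma polynomial2_eq p q : polynomial2 p -> (forall x y, p x y = q x y) ->
  polynomial2 q.
Proof.
move=> pp pq; rewrite (_ : q = p)//.
by apply/funext => x; apply/funext => y; rewrite pq.
Qed.

Definition unit_coord (C u : R) : R := (u / C + 1) / 2.

Lemma polynomial2_bernoulli_walkx (C : R) (F : nat -> R -> R -> R) k s :
  (forall i, polynomial2 (F i)) ->
  polynomial2 (fun x y => bernoulli_walk (fun i => F i x y) k s (unit_coord C x)).
Proof.
move=> pF; elim: k s => [|k IH] s //=.
pose p i x y := bernoulli_walk (fun j => F j x y) k i (unit_coord C x).
apply: (@polynomial2_eq (fun x y => ((C^-1 / 2) * (x * p s.+1 x y)
  + 1 / 2 * p s.+1 x y) + (- (C^-1 / 2) * (x * p s x y) + 1 / 2 * p s x y))).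
  apply: polynomial2_add; apply: polynomial2_add.
  - exact/polynomial2_scale/polynomial2_mulx/IH.
  - exact/polynomial2_scale/IH.
  - exact/polynomial2_scale/polynomial2_mulx/IH.
  - exact/polynomial2_scale/IH.
by move=> x y; rewrite /p /unit_coord/=; set c := C^-1; field.
Qed.

Lemma polynomial2_bernoulli_walky (C : R) (F : nat -> R -> R -> R) k s :
  (forall i, polynomial2 (F i)) ->
  polynomial2 (fun x y => bernoulli_walk (fun i => F i x y) k s (unit_coord C y)).
Proof.
move=> pF; elim: k s => [|k IH] s //=.
pose p i x y := bernoulli_walk (fun j => F j x y) k i (unit_coord C y).
apply: (@polynomial2_eq (fun x y => ((C^-1 / 2) * (y * p s.+1 x y)
  + 1 / 2 * p s.+1 x y) + (- (C^-1 / 2) * (y * p s x y) + 1 / 2 * p s x y))).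
  apply: polynomial2_add; apply: polynomial2_add.
  - exact/polynomial2_scale/polynomial2_muly/IH.
  - exact/polynomial2_scale/IH.
  - exact/polynomial2_scale/polynomial2_muly/IH.
  - exact/polynomial2_scale/IH.
by move=> x y; rewrite /p /unit_coord/=; set c := C^-1; field.
Qed.

(** The second point [q] may lie outside [K]: the bound required by [bernoulli_walk_dist] ranges
    over all indices, and those above [n] give nodes outside the square. *)
Lemma compact_unif_continuous (h : R * R -> R) (K : set (R * R)) :
  continuous h -> compact K -> forall eta : R, 0 < eta ->
  exists2 delta, 0 < delta & forall p q, K p ->
    `|p.1 - q.1| < delta -> `|p.2 - q.2| < delta -> `|h p - h q| < eta.
Proof.
move=> ch /compact_near_coveringP cK eta eta0.
pose Q (delta : R) (p : R * R) := forall q, `|p.1 - q.1| < delta ->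
  `|p.2 - q.2| < delta -> `|h p - h q| < eta.
have : \forall delta \near 0^'+, K `<=` Q delta.
  apply: cK => p Kp.
  have /cvgrPdist_lt /(_ (eta / 2)) := ch p.
  rewrite divr_gt0// => /(_ isT); rewrite near_nbhs => /nbhs_ballP[r /= r0 rP].
  exists (ball p (r / 2), [set d | d < r / 2]) => /=.
    split; first by apply: nbhsx_ballx; rewrite divr_gt0.
    by apply: nbhs_right_lt; rewrite divr_gt0.
  move=> [p' delta] /= [[pp1 pp2] dr] q q1 q2.
  rewrite /= in pp1 pp2.
  have bp' : ball p r p'.
    by split; [apply: le_ball pp1|apply: le_ball pp2]; lra.
  have bq : ball p r q.
    split; rewrite /ball/= (splitr r).
      rewrite (le_lt_trans (ler_distD p'.1 _ _))// ltrD//.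
      exact: lt_trans dr.
    rewrite (le_lt_trans (ler_distD p'.2 _ _))// ltrD//.
    exact: lt_trans dr.
  rewrite (le_lt_trans (ler_distD (h p) _ _))// (splitr eta) ltrD//.
    by rewrite distrC; exact: rP.
  exact: rP.
move=> H; have : \forall delta \near (0:R)^'+, 0 < delta /\ K `<=` Q delta.
  by near=> delta; split; near: delta => //; exact: nbhs_right_gt.
by move=> /filter_ex[delta [d0 dQ]]; exists delta => // p q Kp; exact: dQ.
Unshelve. all: by end_near. Qed.

Lemma weierstrass2 (h : R -> R -> R) (M C : R) : 0 < C ->
  continuous (fun p : R * R => h p.1 p.2) -> (forall x y, `|h x y| <= M) ->
  forall eta : R, 0 < eta -> exists2 p, polynomial2 p &
    forall x y, `|x| <= C -> `|y| <= C -> `|p x y - h x y| <= eta.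
Proof.
move=> C0 ch hM eta eta0.
have M0 : 0 <= M by rewrite (le_trans _ (hM 0 0)).
have cK : compact (`[- C, C] `*` `[- C, C] : set (R * R)).
  by apply: compact_setX; exact: segment_compact.
have eta20 : 0 < eta / 2 by rewrite divr_gt0.
have [delta d0 hd] := compact_unif_continuous ch cK eta20.
(* The deviation [z - C * (2 * w - 1)] is, up to sign, [2 * C] times the deviation
   [w - unit_coord C z]. So once it reaches [delta], the total oscillation [2 * M] of [h] is at most
   [c] times the squared deviation in unit coordinates. *)
pose c := 2 * M * (2 * C / delta) ^+ 2.
have c0 : 0 <= c by rewrite mulr_ge0 ?sqr_ge0// mulr_ge0.
have close (u v x y : R) : `|x| <= C -> `|y| <= C ->
    `|h (C * (2 * u - 1)) (C * (2 * v - 1)) - h x y| <=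
    eta / 2 + c * (u - unit_coord C x) ^+ 2 + c * (v - unit_coord C y) ^+ 2.
  move=> xC yC.
  have q0 (z : R) : 0 <= c * z ^+ 2 by rewrite mulr_ge0// sqr_ge0.
  have far (z w : R) : delta <= `|z - C * (2 * w - 1)| ->
      2 * M <= c * (w - unit_coord C z) ^+ 2.
    move=> dz; rewrite /c -[X in _ <= X]mulrA -exprMn -[leLHS]mulr1.
    rewrite ler_wpM2l ?mulr_ge0// -[leLHS](expr1n _ 2%N) -[leRHS]real_normK ?num_real//.
    rewrite lerXn2r ?nnegrE//.
    have -> : 2 * C / delta * (w - unit_coord C z) =
        - ((z - C * (2 * w - 1)) / delta).
      by rewrite /unit_coord; field; rewrite !gt_eqF.
    by rewrite normrN normrM normfV (gtr0_norm d0) ler_pdivlMr// mul1r.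
  have hM2 : `|h (C * (2 * u - 1)) (C * (2 * v - 1)) - h x y| <= 2 * M.
    rewrite (le_trans (ler_normB _ _))//.
    by have := hM x y; have := hM (C * (2 * u - 1)) (C * (2 * v - 1)); lra.
  have [xd|xd] := ltP `|x - C * (2 * u - 1)| delta; last first.
    have := far _ _ xd; have := q0 (v - unit_coord C y); lra.
  have [yd|yd] := ltP `|y - C * (2 * v - 1)| delta; last first.
    have := far _ _ yd; have := q0 (u - unit_coord C x); lra.
  have Kxy : (`[- C, C] `*` `[- C, C]) (x, y).
    by split; rewrite /= in_itv/= -ler_norml.
  have := hd (x, y) (C * (2 * u - 1), C * (2 * v - 1)) Kxy xd yd.
  rewrite distrC /= => /ltW.
  have := q0 (u - unit_coord C x); have := q0 (v - unit_coord C y); lra.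
(* Each of the two variables costs [c / n], and together they may use the second half of [eta]. *)
have [n n0 nc] : exists2 n, (0 < n)%N & 2 * c / n%:R <= eta / 2.
  have h0 : 0 <= 2 * c / (eta / 2).
    by apply: divr_ge0; [exact: mulr_ge0|exact: ltW].
  exists (Num.bound (2 * c / (eta / 2))).+1 => //.
  rewrite ler_pdivrMr ?ltr0n// [leRHS]mulrC -ler_pdivrMr//.
  by rewrite (le_trans (ltW (archi_boundP h0)))// ler_nat.
pose F i x y := bernoulli_walk (fun j : nat =>
  h (C * (2 * (i%:R / n%:R) - 1)) (C * (2 * (j%:R / n%:R) - 1))) n 0
  (unit_coord C y).
exists (fun x y => bernoulli_walk (fun i => F i x y) n 0 (unit_coord C x)).
  apply: polynomial2_bernoulli_walkx => i.
  apply: (@polynomial2_bernoulli_walky C (fun j _ _ =>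
    h (C * (2 * (i%:R / n%:R) - 1)) (C * (2 * (j%:R / n%:R) - 1)))) => j.
  exact: polynomial2_cst.
move=> x y xC yC.
have unit01 z : `|z| <= C -> 0 <= unit_coord C z <= 1.
  rewrite ler_norml => /andP[z1 z2]; rewrite /unit_coord.
  have h1 : -1 <= z / C by rewrite ler_pdivlMr// mulN1r.
  have h2 : z / C <= 1 by rewrite ler_pdivrMr// mul1r.
  by apply/andP; split; lra.
(* One application of [bernoulli_walk_dist] per variable: the inner walk, in [y], adds its [c / n]
   to the constant term of the outer one. *)
have /le_trans : `|bernoulli_walk (F^~ x ^~ y) n 0 (unit_coord C x) - h x y| <=
    (eta / 2 + c / n%:R) + c / n%:R.
  apply: bernoulli_walk_dist => //; first exact: unit01.
  move=> i; have -> : eta / 2 + c / n%:R + c * (i%:R / n%:R - unit_coord C x) ^+ 2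
    = eta / 2 + c * (i%:R / n%:R - unit_coord C x) ^+ 2 + c / n%:R by ring.
  apply: bernoulli_walk_dist => //; first exact: unit01.
  by move=> j; exact: close.
by apply; move: nc; rewrite mulrDl mul1r mulrDl; lra.
Qed.

End weierstrass.

(** * From characteristic functions of phases to joint moments *)

Section mixed_moments.
Context (R : realType) (dB : measure_display) (OB : measurableType dB)
  (PB : probability OB R).
Variables (phi : OB -> R) (M : R).
Hypothesis mphi : measurable_fun setT phi.
Hypothesis phiM : forall b, `|phi b| <= M.

Section model.
Context (dT : measure_display) (T : measurableType dT) (mu : probability T R).
Variable Y : OB -> T -> R.
Hypothesis mY : measurable_fun setT (fun p : OB * T => Y p.1 p.2).

Definition lincomb (L : seq (R * OB)) (w : T) : R :=
  \sum_(ab <- L) ab.1 * Y ab.2 w.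

(** For [q = 0] and [q = - (pi / 2)] these are the real and the imaginary part of the Feynman-Kac
    expectation. *)
Definition wave (q : R) (w : T) : R := \int[PB]_b (phi b * cos (Y b w + q)).

Definition waves (qs : seq R) (w : T) : R := \prod_(q <- qs) wave q w.

(** Interpolates between a moment of waves ([L] empty) and a cosine moment of a combination of
    phases ([qs] empty). Converting one factor at a time keeps the induction on [qs] simple. *)
Definition mixed_moment (qs : seq R) (L : seq (R * OB)) (q : R) : R :=
  \int[mu]_w (waves qs w * cos (lincomb L w + q)).

Lemma measurable_field_section b : measurable_fun setT (Y b).
Proof. exact: (measurableT_comp mY (measurable_pair1 b)). Qed.

Lemma measurable_lincomb L : measurable_fun setT (lincomb L).
Proof.
apply: measurable_sum => i.
by apply: measurable_funM => //; exact: measurable_field_section.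
Qed.

Lemma measurable_cosD (d' : measure_display) (T' : measurableType d')
    (g : T' -> R) q :
  measurable_fun setT g -> measurable_fun setT (fun w => cos (g w + q)).
Proof.
move=> mg; apply: (measurableT_comp (continuous_measurable_fun (@continuous_cos R))).
exact: measurable_funD.
Qed.

Let mwave_integrand q :
  measurable_fun setT (fun p : OB * T => phi p.1 * cos (Y p.1 p.2 + q)).
Proof.
apply: measurable_funM; last exact: measurable_cosD.
exact: (measurableT_comp mphi measurable_fst).
Qed.

Lemma measurable_wave q : measurable_fun setT (wave q).
Proof. exact: (measurable_Rintegral_fst PB (mwave_integrand q)). Qed.

Let M0 : 0 <= M. Proof. exact: le_trans (normr_ge0 _) (phiM point). Qed.

Lemma wave_le q w : `|wave q w| <= M.
Proof.
apply: Rintegral_probability_bound => [|b].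
  exact: (measurableT_comp (mwave_integrand q) (measurable_pair2 w)).
by rewrite normrM -[leRHS]mulr1 ler_pM// cos_max.
Qed.

Lemma measurable_waves qs : measurable_fun setT (waves qs).
Proof. by apply: measurable_prod => i _; exact: measurable_wave. Qed.

Lemma waves_le qs w : `|waves qs w| <= M ^+ size qs.
Proof.
elim: qs => [|q qs IH]; first by rewrite /waves big_nil expr0 normr1.
rewrite /waves big_cons normrM exprS ler_pM// ?wave_le//.
Qed.

Lemma waves_cons q qs w : waves (q :: qs) w = wave q w * waves qs w.
Proof. by rewrite /waves big_cons. Qed.

Lemma lincomb_cons a b L w : lincomb ((a, b) :: L) w = a * Y b w + lincomb L w.
Proof. by rewrite /lincomb big_cons. Qed.

Let mmixed qs L q :
  measurable_fun setT (fun w => waves qs w * cos (lincomb L w + q)).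
Proof.
apply: measurable_funM; first exact: measurable_waves.
by apply: measurable_cosD; exact: measurable_lincomb.
Qed.

Let mixed_le qs L q w : `|waves qs w * cos (lincomb L w + q)| <= M ^+ size qs.
Proof. by rewrite normrM -[leRHS]mulr1 ler_pM// ?waves_le// cos_max. Qed.

Lemma mixed_moment_le qs L q : `|mixed_moment qs L q| <= M ^+ size qs.
Proof.
exact: Rintegral_probability_bound (mmixed qs L q) (@mixed_le qs L q).
Qed.

Lemma measurable_mixed_moment_cons qs a L q :
  measurable_fun setT (fun b => mixed_moment qs ((a, b) :: L) q).
Proof.
apply: (measurable_Rintegral_snd mu (f := fun p : OB * T =>
  waves qs p.2 * cos (lincomb ((a, p.1) :: L) p.2 + q))).
apply: measurable_funM.
  exact: (measurableT_comp (measurable_waves qs) measurable_snd).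
apply: measurable_cosD; under eq_fun do rewrite lincomb_cons.
apply: measurable_funD; first exact: measurable_funM.
exact: (measurableT_comp (measurable_lincomb L) measurable_snd).
Qed.

(* [2 cos a cos b = cos (b + a) + cos (b - a)] trades a wave for one more path. *)
Lemma mixed_moment_cons q qs L q' : mixed_moment (q :: qs) L q' =
  \int[PB]_b (phi b * ((mixed_moment qs ((1, b) :: L) (q' + q) +
                        mixed_moment qs ((-1, b) :: L) (q' - q)) / 2)).
Proof.
pose h (p : OB * T) := phi p.1 * cos (Y p.1 p.2 + q) *
  (waves qs p.2 * cos (lincomb L p.2 + q')).
have mh : measurable_fun setT h.
  apply: measurable_funM; first exact: mwave_integrand.
  exact: (measurableT_comp (mmixed qs L q') measurable_snd).
have hM p : `|h p| <= M * M ^+ size qs.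
  rewrite normrM ler_pM// ?mixed_le// normrM -[leRHS]mulr1 ler_pM//.
  exact: cos_max.
transitivity (\int[mu]_w \int[PB]_b h (b, w)).
  apply: eq_Rintegral => w _; rewrite waves_cons -mulrA -RintegralZr//.
  apply: (@integrable_bounded _ _ _ _ _ M) => [|b].
    exact: (measurableT_comp (mwave_integrand q) (measurable_pair2 w)).
  by rewrite normrM -[leRHS]mulr1 ler_pM// cos_max.
rewrite -(Rintegral_Fubini_bounded _ _ mh hM).
apply: eq_Rintegral => b _; rewrite /h /=.
have I1 a c : mu.-integrable setT
    (EFin \o (fun w => waves qs w * cos (lincomb ((a, b) :: L) w + c))).
  by apply: integrable_bounded (mmixed qs _ c) (@mixed_le qs _ c).
have I2 := integrableD measurableT (I1 1 (q' + q)) (I1 (-1) (q' - q)).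
rewrite -RintegralD// -RintegralZr// -RintegralZl//; last first.
  exact: (integrableZr measurableT _ I2).
apply: eq_Rintegral => w _; rewrite !lincomb_cons mul1r mulN1r.
have -> : Y b w + lincomb L w + (q' + q) = (Y b w + q) + (lincomb L w + q') by ring.
have -> : - Y b w + lincomb L w + (q' - q) = (lincomb L w + q') - (Y b w + q) by ring.
by rewrite cosB !cosD; field.
Qed.

End model.

Section convergence.
Context (dT : measure_display) (T : measurableType dT) (mu : probability T R).
Context (dU : measure_display) (U : measurableType dU) (nu : probability U R).
Variables (Y : nat -> OB -> T -> R) (X : OB -> U -> R) (good : set OB).
Hypothesis mY : forall n, measurable_fun setT (fun p : OB * T => Y n p.1 p.2).
Hypothesis mX : measurable_fun setT (fun p : OB * U => X p.1 p.2).
Hypothesis ae_good : {ae PB, forall b, good b}.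
Hypothesis cvg_lincomb : forall L q, (forall ab, ab \in L -> good ab.2) ->
  \int[mu]_w cos (lincomb (Y n) L w + q) @[n --> \oo] -->
  \int[nu]_w cos (lincomb X L w + q).

(** The path added by an induction step is integrated against [PB], so it lies in [good] almost
    surely; the bound by powers of [M] allows dominated convergence over it. *)
Lemma cvg_mixed_moment qs L q : (forall ab, ab \in L -> good ab.2) ->
  mixed_moment mu (Y n) qs L q @[n --> \oo] --> mixed_moment nu X qs L q.
Proof.
elim: qs L q => [|q qs IH] L q' gL.
  rewrite /mixed_moment; under eq_Rintegral do rewrite /waves big_nil mul1r.
  rewrite (_ : (fun n => _) = fun n => \int[mu]_w cos (lincomb (Y n) L w + q')).
    exact: cvg_lincomb.
  apply/funext => n; apply: eq_Rintegral => w _.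
  by rewrite /waves big_nil mul1r.
rewrite (mixed_moment_cons nu mX).
under eq_fun do rewrite (mixed_moment_cons mu (mY _)).
have mm d' (V : measurableType d') (m : probability V R) (Z : OB -> V -> R) :
    measurable_fun setT (fun p : OB * V => Z p.1 p.2) ->
    measurable_fun setT (fun b => phi b *
      ((mixed_moment m Z qs ((1, b) :: L) (q' + q) +
        mixed_moment m Z qs ((-1, b) :: L) (q' - q)) / 2)).
  move=> mZ; apply: measurable_funM => //; apply: measurable_funM => //.
  by apply: measurable_funD; exact: measurable_mixed_moment_cons.
apply: (@Rintegral_dominated _ _ _ _ _ _ (M * M ^+ size qs)).
- by move=> n; exact: mm.
- exact: mm.
- move=> n b; rewrite normrM ler_pM//.
  rewrite normrM (ger0_norm (_ : 0 <= 2^-1)) ?invr_ge0// ler_pdivrMr//.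
  rewrite (le_trans (ler_normD _ _))// mulr_natr mulr2n lerD//; exact: mixed_moment_le.
- apply: filterS ae_good => b gb; apply: cvgM; first exact: cvg_cst.
  apply: cvgM; last exact: cvg_cst.
  apply: cvgD; apply: IH => -[a c]; rewrite inE => /orP[/eqP[_ ->]//|];
    exact: gL.
Qed.

Let pol d' (V : measurableType d') (Z : OB -> V -> R) (p : R -> R -> R) w :=
  p (wave Z 0 w) (wave Z (- (pi / 2)) w).

Lemma measurable_polynomial2 d' (V : measurableType d') (g1 g2 : V -> R) p :
  polynomial2 p -> measurable_fun setT g1 -> measurable_fun setT g2 ->
  measurable_fun setT (fun w => p (g1 w) (g2 w)).
Proof.
move=> pp m1 m2; elim: pp => //= *.
- exact: measurable_funD.
- exact: measurable_funM.
- exact: measurable_funM.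
- exact: measurable_funM.
Qed.

Lemma polynomial2_bounded (C : R) p : polynomial2 p ->
  exists D : R, forall x y, `|x| <= C -> `|y| <= C -> `|p x y| <= D.
Proof.
elim=> [c|{}p q _ [D HD] _ [E HE]|c {}p _ [D HD]|{}p _ [D HD]|{}p _ [D HD]].
- by exists `|c|.
- by exists (D + E) => x y hx hy; rewrite (le_trans (ler_normD _ _))// lerD// (HD, HE).
- by exists (`|c| * D) => x y hx hy; rewrite normrM ler_wpM2l// HD.
- by exists (C * D) => x y hx hy; rewrite normrM ler_pM// HD.
- by exists (C * D) => x y hx hy; rewrite normrM ler_pM// HD.
Qed.

(** The extra product [waves qs] absorbs the variables: multiplying the polynomial by [x] or [y]
    becomes one more factor [wave 0] or [wave (- (pi / 2))], and constants reduce to a mixed moment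
    with an empty combination. *)
Lemma cvg_polynomial2_waves p qs : polynomial2 p ->
  \int[mu]_w (waves (Y n) qs w * pol (Y n) p w) @[n --> \oo] -->
  \int[nu]_w (waves X qs w * pol X p w).
Proof.
have I d' (V : measurableType d') (m : probability V R) (Z : OB -> V -> R) r l :
    measurable_fun setT (fun p : OB * V => Z p.1 p.2) -> polynomial2 r ->
    m.-integrable setT (EFin \o (fun w => waves Z l w * pol Z r w)).
  move=> mZ pr; have [D HD] := polynomial2_bounded M pr.
  apply: (@integrable_bounded _ _ _ _ _ (M ^+ size l * D)).
    apply: measurable_funM; first exact: measurable_waves.
    by apply: measurable_polynomial2 => //; exact: measurable_wave.
  move=> w; rewrite normrM ler_pM// ?waves_le//.
  by apply: HD; exact: wave_le.
move=> pp; elim: pp qs => [c|{}p q pp IHp pq IHq|c {}p pp IHp|{}p pp IHp|{}p pp IHp] qs.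
- have H := @cvg_mixed_moment qs [::] 0 (fun _ => ltac:(by [])).
  (* The identity is stated for an arbitrary model, since it is needed both for [Y n] and for the
     limit [X]. *)
  suff E d' (V : measurableType d') (m : probability V R) (Z : OB -> V -> R) :
     measurable_fun setT (fun p : OB * V => Z p.1 p.2) ->
     c * mixed_moment m Z qs [::] 0 = \int[m]_w (waves Z qs w * pol Z (fun _ _ => c) w).
    rewrite -(E _ _ nu X)//.
    apply: cvg_trans (cvgM (@cvg_cst _ c _ _ _) H).
    by apply: near_eq_cvg; apply: nearW => n; rewrite -(E _ _ mu (Y n) (mY n)).
  move=> mZ; have J := I _ _ m _ (fun _ _ => 1) qs mZ (polynomial2_cst 1).
  rewrite /mixed_moment -RintegralZl//; last first.
    apply: eq_integrable J => //= w _.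
    by rewrite /lincomb big_nil addr0 cos0.
  by apply: eq_Rintegral => w _; rewrite /lincomb big_nil addr0 cos0 mulr1 mulrC.
- suff E d' (V : measurableType d') (m : probability V R) (Z : OB -> V -> R) :
     measurable_fun setT (fun p : OB * V => Z p.1 p.2) ->
     \int[m]_w (waves Z qs w * pol Z p w) + \int[m]_w (waves Z qs w * pol Z q w) =
     \int[m]_w (waves Z qs w * pol Z (fun x y => p x y + q x y) w).
    rewrite -(E _ _ nu X)//.
    apply: cvg_trans (cvgD (IHp qs) (IHq qs)).
    by apply: near_eq_cvg; apply: nearW => n; rewrite -(E _ _ mu (Y n) (mY n)).
  move=> mZ; rewrite -RintegralD//; [|exact: I|exact: I].
  by apply: eq_Rintegral => w _; rewrite -mulrDr.
- suff E d' (V : measurableType d') (m : probability V R) (Z : OB -> V -> R) :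
     measurable_fun setT (fun p : OB * V => Z p.1 p.2) ->
     c * \int[m]_w (waves Z qs w * pol Z p w) =
     \int[m]_w (waves Z qs w * pol Z (fun x y => c * p x y) w).
    rewrite -(E _ _ nu X)//.
    apply: cvg_trans (cvgM (@cvg_cst _ c _ _ _) (IHp qs)).
    by apply: near_eq_cvg; apply: nearW => n; rewrite -(E _ _ mu (Y n) (mY n)).
  move=> mZ; rewrite -RintegralZl//; last exact: I.
  by apply: eq_Rintegral => w _; rewrite /pol mulrCA.
- suff E d' (V : measurableType d') (m : probability V R) (Z : OB -> V -> R) :
     \int[m]_w (waves Z (0 :: qs) w * pol Z p w) =
     \int[m]_w (waves Z qs w * pol Z (fun x y => x * p x y) w).
    rewrite -(E _ _ nu X)//.
    apply: cvg_trans (IHp (0 :: qs)).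
    by apply: near_eq_cvg; apply: nearW => n; rewrite -(E _ _ mu (Y n)).
  by apply: eq_Rintegral => w _; rewrite waves_cons /pol mulrA (mulrC (wave _ _ _)).
- suff E d' (V : measurableType d') (m : probability V R) (Z : OB -> V -> R) :
     \int[m]_w (waves Z (- (pi / 2) :: qs) w * pol Z p w) =
     \int[m]_w (waves Z qs w * pol Z (fun x y => y * p x y) w).
    rewrite -(E _ _ nu X)//.
    apply: cvg_trans (IHp (- (pi / 2) :: qs)).
    by apply: near_eq_cvg; apply: nearW => n; rewrite -(E _ _ mu (Y n)).
  by apply: eq_Rintegral => w _; rewrite waves_cons /pol mulrA (mulrC (wave _ _ _)).
Qed.

(** Joint continuity is turned into measurability by writing [h] as a pointwise limit of polynomials
    on the square that contains the values of [g1] and [g2]. *)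
Lemma measurable_weierstrass d' (V : measurableType d') (g1 g2 : V -> R)
    (h : R -> R -> R) (C D : R) : 0 < C ->
  continuous (fun p : R * R => h p.1 p.2) -> (forall x y, `|h x y| <= D) ->
  measurable_fun setT g1 -> measurable_fun setT g2 ->
  (forall w, `|g1 w| <= C) -> (forall w, `|g2 w| <= C) ->
  measurable_fun setT (fun w => h (g1 w) (g2 w)).
Proof.
move=> C0 ch hD m1 m2 g1C g2C.
have inv0 n : 0 < n.+1%:R^-1 :> R by rewrite invr_gt0.
have P n := cid2 (weierstrass2 C0 ch hD (inv0 n)).
apply: (@measurable_fun_cvg _ _ _ setT (fun n w => s2val (P n) (g1 w) (g2 w))) => //.
  move=> n; apply: measurable_polynomial2 => //; exact: s2valP.
move=> w _; apply/cvgrPdist_le => e e0.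
near=> n; rewrite distrC (le_trans (s2valP' (P n) _ _ _ _))// ltW//.
near: n; exact: (near_infty_natSinv_lt (PosNum e0)).
Unshelve. all: by end_near. Qed.

Theorem cvg_continuous_waves (h : R -> R -> R) (D : R) :
  continuous (fun p : R * R => h p.1 p.2) -> (forall x y, `|h x y| <= D) ->
  \int[mu]_w h (wave (Y n) 0 w) (wave (Y n) (- (pi / 2)) w) @[n --> \oo] -->
  \int[nu]_w h (wave X 0 w) (wave X (- (pi / 2)) w).
Proof.
move=> ch hD; have C0 : 0 < `|M| + 1 by rewrite ltr_wpDl.
apply/cvgrPdist_le => e e0; have e30 : 0 < e / 3 by rewrite divr_gt0.
have [p pp ph] := weierstrass2 C0 ch hD e30.
have close d' (V : measurableType d') (m : probability V R) (Z : OB -> V -> R) :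
    measurable_fun setT (fun p : OB * V => Z p.1 p.2) ->
  `|\int[m]_w h (wave Z 0 w) (wave Z (- (pi / 2)) w) -
    \int[m]_w (waves Z [::] w * pol Z p w)| <= e / 3.
  move=> mZ; have wC q w : `|wave Z q w| <= `|M| + 1.
    by rewrite (le_trans (wave_le mZ _ _))// (le_trans (ler_norm _))// lerDl.
  have [E HE] := polynomial2_bounded (`|M| + 1) pp.
  have mh : measurable_fun setT (fun w => h (wave Z 0 w) (wave Z (- (pi / 2)) w)).
    by apply: (measurable_weierstrass C0 ch hD) => //; exact: measurable_wave.
  have mp : measurable_fun setT (pol Z p).
    by apply: measurable_polynomial2 => //; exact: measurable_wave.
  rewrite (@eq_Rintegral _ _ _ _ _ (pol Z p) (fun w => waves Z [::] w * _)); last first.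
    by move=> w _; rewrite /waves big_nil mul1r.
  rewrite -RintegralB//; last 2 first.
  - exact: integrable_bounded mh (fun w => hD _ _).
  - by apply: (integrable_bounded _ mp (C := E)) => w; apply: HE.
  apply: Rintegral_probability_bound; first exact: measurable_funB.
  by move=> w; rewrite distrC; exact: ph.
have /cvgrPdist_le/(_ _ e30) := @cvg_polynomial2_waves p [::] pp.
apply: filterS => n; have := close _ _ mu _ (mY n); have := close _ _ nu _ mX.
by rewrite !ler_distl; lra.
Qed.

End convergence.
End mixed_moments.

(** * Stein's method and Gaussian variables *)

Section stein.
Context (R : realType) d (T : measurableType d) (P : probability T R).
Variable Y : T -> R.
Hypothesis mY : measurable_fun setT Y.
Hypothesis Y2 : P.-integrable setT (EFin \o (fun w => Y w ^+ 2)).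

Lemma integrable_sqrW : P.-integrable setT (EFin \o Y).
Proof.
have I1 : P.-integrable setT (EFin \o (cst 1 : T -> R)).
  by apply: (@integrable_bounded _ _ _ _ _ 1) => // w; rewrite normr1.
apply: le_integrable (integrableD measurableT I1 Y2) => //.
  exact/measurable_EFinP.
move=> w _ /=; rewrite lee_fin; change (`|Y w| <= `|1 + Y w ^+ 2|).
rewrite [leRHS]ger0_norm ?addr_ge0 ?sqr_ge0// -(real_normK (num_real (Y w))).
have := normr_ge0 (Y w); nra.
Qed.

Definition cos_moment q l := \int[P]_w cos (l * Y w + q).

Let mcos q l : measurable_fun setT (fun w => cos (l * Y w + q)).
Proof.
apply: (measurableT_comp (continuous_measurable_fun (@continuous_cos R))).
by apply: measurable_funD => //; exact: measurable_funM.
Qed.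

Let dcos q w (l : R) : is_derive l 1 (fun l' : R => cos (l' * Y w + q))
  (- (Y w * sin (l * Y w + q))).
Proof.
have h : is_derive l 1 (fun l' : R => l' * Y w + q) (Y w).
  by apply: is_derive_eq; rewrite scaler0 !addr0 add0r /GRing.scale/= mulr1.
have h2 := @is_derive1_comp _ cos (fun l' : R => l' * Y w + q) l _ _ (is_derive_cos _) h.
by apply: (is_derive_eq h2); rewrite mulNr mulrC.
Qed.

(** Differentiation under the integral sign: the derivative of the integrand is dominated by [|Y|],
    which is integrable because its square is. *)
Lemma is_derive_cos_moment q (l : R) :
  is_derive l 1 (cos_moment q) (- (\int[P]_w (Y w * sin (l * Y w + q)))).
Proof.
pose f l w := cos (l * Y w + q).
have dE x w : partial1of2 f x w = - (Y w * sin (x * Y w + q)).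
  by rewrite /partial1of2 derive1E; have [] := dcos q w x.
have Il : `]l - 1, l + 1[%classic l by rewrite /= in_itv/= ltrBlDr ltrDl ltr01.
have intf x : `]l - 1, l + 1[%classic x -> P.-integrable setT (EFin \o f x).
  move=> _; apply: (@integrable_bounded _ _ _ _ _ 1) => [|w].
    exact: mcos.
  by rewrite ler_norml cos_geN1 cos_le1.
have df x w : `]l - 1, l + 1[%classic x -> setT w -> derivable (f ^~ w) x 1.
  by move=> _ _; have [] := dcos q w x.
have iY : P.-integrable setT (EFin \o (fun w => `|Y w|)).
  exact: integrable_norm integrable_sqrW.
have dG x w : `]l - 1, l + 1[%classic x -> setT w ->
    `|partial1of2 f x w| <= `|Y w|.
  move=> _ _; rewrite dE normrN normrM -[leRHS]mulr1 ler_pM//.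
  by rewrite ler_norml sin_geN1 sin_le1.
have d1 := @derivable_under_integral _ _ _ P f setT measurableT l _ _ Il intf df
  _ (fun=> normr_ge0 _) iY dG.
have d2 := @differentiation_under_integral _ _ _ P f setT measurableT l _ _ Il intf df
  _ (fun=> normr_ge0 _) iY dG.
apply: DeriveDef => //; rewrite -derive1E d2.
transitivity (\int[P]_w ((-1) * (Y w * sin (l * Y w + q)))).
  by apply: eq_Rintegral => w _; rewrite dE mulN1r.
rewrite RintegralZl ?mulN1r//.
apply: le_integrable integrable_sqrW => //.
  apply/measurable_EFinP; apply: measurable_funM => //.
  apply: (measurableT_comp (continuous_measurable_fun (@continuous_sin R))).
  by apply: measurable_funD => //; exact: measurable_funM.
move=> w _ /=; rewrite lee_fin normrM -[leRHS]mulr1 ler_pM//.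
by rewrite ler_norml sin_geN1 sin_le1.
Qed.

(* The characteristic function psi solves psi' = - l v psi up to an error D. *)
Lemma stein_cos_moment (v D q : R) : 0 <= v ->
  (forall l : R, 0 <= l <= 1 ->
    `|(\int[P]_w (Y w * sin (l * Y w + q))) - l * v * cos_moment q l| <= D) ->
  `|(\int[P]_w cos (Y w + q)) - expR (- (v / 2)) * cos q| <= D.
Proof.
move=> v0 HD.
(* Integrating factor: [g] would be constant if the differential equation held exactly. The mean
   value theorem on [[0, 1]] bounds [g 1 - g 0] by [D * expR (v / 2)], and the exponential is
   divided out at the end. *)
pose g (l : R) := cos_moment q l * expR (l ^+ 2 * (v / 2)).
pose dg (l : R) := (- (\int[P]_w (Y w * sin (l * Y w + q))) + l * v * cos_moment q l)
  * expR (l ^+ 2 * (v / 2)).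
have de (l : R) : is_derive l 1 (fun x : R => expR (x ^+ 2 * (v / 2)))
    (l * v * expR (l ^+ 2 * (v / 2))).
  have h : is_derive l 1 (fun x : R => x ^+ 2 * (v / 2)) (l * v).
    by apply: is_derive_eq; rewrite /GRing.scale/=; field.
  have h2 := @is_derive1_comp _ expR (fun x : R => x ^+ 2 * (v / 2)) l _ _ (is_derive_expR _) h.
  by apply: (is_derive_eq h2); rewrite mulrC.
have dgP (l : R) : is_derive l 1 g (dg l).
  have h2 := is_deriveM (is_derive_cos_moment q l) (de l).
  by apply: (is_derive_eq h2); rewrite /dg /GRing.scale/=; ring.
have cg : {within `[0, 1], continuous g}.
  apply: derivable_within_continuous => x _.
  by have [] := dgP x.
have [c] := @MVT _ g dg 0 1 ltr01 (fun x _ => dgP x) cg.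
rewrite in_itv/= => /andP[c0 c1]; rewrite subr0 mulr1 => gE.
have g1 : g 1 = (\int[P]_w cos (Y w + q)) * expR (v / 2).
  rewrite /g expr1n mul1r; congr (_ * _).
  by apply: eq_Rintegral => w _; rewrite mul1r.
have g0 : g 0 = cos q.
  rewrite /g expr0n/= mul0r expR0 mulr1 /cos_moment.
  under eq_Rintegral do rewrite mul0r add0r.
  by rewrite Rintegral_cst// (_ : fine _ = 1) ?mulr1//= probability_setT.
have dgD : `|dg c| <= D * expR (v / 2).
  rewrite /dg normrM (ger0_norm (expR_ge0 _)) ler_pM//.
    by rewrite addrC distrC HD// !ltW.
  rewrite ler_expR ler_piMl ?divr_ge0//.
  by rewrite expr_le1// ltW.
rewrite -(ler_pM2r (expR_gt0 (v / 2))) -{1}(ger0_norm (expR_ge0 (v / 2))) -normrM.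
by rewrite mulrBl -g1 mulrAC -expRD addNr expR0 mul1r -g0 gE.
Qed.

End stein.

(** * Integrals against the normal density *)

Section normal_integrals.
Context (R : realType).
Notation mu := (@lebesgue_measure R).

(** Integration by parts in disguise: the fundamental theorem on growing symmetric intervals and
    dominated convergence. Below, [H] is the normal density multiplied by [x] or by a sine. *)
Lemma Rintegral_derive0 (H h : R -> R) : (forall x : R, is_derive x 1 H (h x)) ->
  continuous h -> mu.-integrable setT (EFin \o h) ->
  H n%:R @[n --> \oo] --> 0 -> H (- (n%:R)) @[n --> \oo] --> 0 ->
  \int[mu]_x h x = 0.
Proof.
move=> dH ch ih Hp Hn.
have cH : continuous H.
  by move=> x; apply: differentiable_continuous; apply/derivable1_diffP;
     have [] := dH x.
(* The index [n.+1] keeps the interval nondegenerate; the limits are shifted accordingly below. *)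
have FTC (n : nat) : (\int[mu]_(x in `[(- n.+1%:R)%R, (n.+1%:R)%R]) (h x)%:E =
    (H n.+1%:R - H (- (n.+1%:R)))%:E)%E.
  rewrite (@continuous_FTC2 _ h H)//.
  - by apply: (@lt_trans _ _ 0); rewrite ?oppr_lt0 ltr0n.
  - exact: continuous_subspaceT.
  - split.
    + by move=> x _; have [] := dH x.
    + exact/cvg_at_right_filter/cH.
    + exact/cvg_at_left_filter/cH.
  - by move=> x _; rewrite derive1E; have [] := dH x.
have mh : measurable_fun setT (EFin \o h).
  by apply/measurable_EFinP; exact: continuous_measurable_fun.
pose D (n : nat) := [set` `[- (n.+1%:R), n.+1%:R]] : set R.
have mD n : measurable (D n) by exact: measurable_itv.
have : (\int[mu]_x (((EFin \o h) \_ (D n)) x) @[n --> \oo] --> \int[mu]_x (h x)%:E)%E.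
  apply: (@dominated_cvg _ _ _ mu setT measurableT _ _ (abse \o (EFin \o h))) => //.
  - move=> n; pose mh' := mh : @measurable_fun _ _ (measurableTypeR R) _ setT _.
    by apply/(measurable_restrictT (EFin \o h) (mD n : @measurable _ (measurableTypeR R) _));
      exact: measurable_funTS mh'.
  - move=> x _; apply: cvg_near_cst.
    exists (Num.bound `|x|) => // n /= xn; rewrite patchE ifT// inE /D/= in_itv/=.
    rewrite -ler_norml (le_trans (ltW (archi_boundP (normr_ge0 x))))// ler_nat.
    exact: leq_trans xn _.
  - exact: integrable_abse.
  - move=> n x _; rewrite patchE; case: ifPn => // _.
    by rewrite (_ : point = 0%E :> \bar R)// abse0 /= lee_fin.
rewrite (_ : (fun n => _) = (fun n => (H n.+1%:R - H (- (n.+1%:R)))%:E)); last first.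
  by apply/funext => n; rewrite -integral_mkcond FTC.
move=> c1; have c2 : ((H n.+1%:R - H (- (n.+1%:R)))%:E @[n --> \oo] --> 0%:E)%E.
  apply: cvg_EFin; first exact: nearW.
  rewrite -[X in _ --> X](subr0 0).
  by apply: cvgB; [move: Hp|move: Hn]; rewrite -cvg_shiftS.
by rewrite /Rintegral -(cvg_unique _ c2 c1).
Qed.

Variables (s : R) (s0 : 0 < s).
Notation n_s := (normal_pdf 0 s).

Let sN0 : s != 0. Proof. by rewrite gt_eqF. Qed.

Let pdfE x : n_s x = normal_peak s * expR (- (x ^+ 2 / (s ^+ 2 * 2))).
Proof. by rewrite normal_pdfE// /normal_fun subr0 mulr_natr mulNr. Qed.

Lemma is_derive_normal_pdf (x : R) : is_derive x 1 n_s (- (x / s ^+ 2 * n_s x)).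
Proof.
rewrite (_ : n_s = fun y => normal_peak s * expR (- (y ^+ 2 / (s ^+ 2 * 2)))); last first.
  by apply/funext => y; rewrite pdfE.
have h : is_derive x 1 (fun y : R => - (y ^+ 2 / (s ^+ 2 * 2))) (- (x / s ^+ 2)).
  by apply: is_derive_eq; rewrite /GRing.scale/=; field.
have h2 := @is_derive1_comp _ expR _ x _ _ (is_derive_expR _) h.
by apply: is_derive_eq; rewrite /GRing.scale/=; ring.
Qed.

Let cvgS0 (c : R) : c / n%:R @[n --> \oo] --> (0 : R).
Proof.
rewrite -[X in _ --> X](mulr0 c); apply: cvgM; first exact: cvg_cst.
rewrite -cvg_shiftS; exact: cvg_harmonic.
Qed.

(** From [expR u >= 1 + u] with [u = x ^+ 2 / (s ^+ 2 * 2)]. This crude decay is enough for the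
    boundary terms of the integrations by parts. *)
Lemma normal_pdf_tail x : x != 0 -> `|x| * n_s x <= normal_peak s * s ^+ 2 * 2 / `|x|.
Proof.
move=> x0; have x0' : 0 < `|x| by rewrite normr_gt0.
rewrite pdfE; set E := expR _; set N := normal_peak s.
have h : x ^+ 2 * E <= s ^+ 2 * 2.
  rewrite /E expRN ler_pdivrMr ?expR_gt0//.
  have := expR_ge1Dx (x ^+ 2 / (s ^+ 2 * 2)).
  rewrite -(ler_pM2l (_ : 0 < s ^+ 2 * 2)); last by rewrite mulr_gt0 ?exprn_gt0.
  apply: le_trans; rewrite mulrDr mulr1.
  have -> : s ^+ 2 * 2 * (x ^+ 2 / (s ^+ 2 * 2)) = x ^+ 2 by field.
  by rewrite lerDr mulr_ge0 ?sqr_ge0.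
rewrite ler_pdivlMr//.
have -> : `|x| * (N * E) * `|x| = N * (`|x| ^+ 2 * E) by ring.
by rewrite real_normK ?num_real// -mulrA ler_wpM2l// normal_peak_ge0.
Qed.

Lemma integrable_sqr_normal_pdf : mu.-integrable setT (EFin \o (fun x => x ^+ 2 * n_s x)).
Proof.
(* Half of the exponent absorbs the factor [x ^+ 2]; the other half is, up to a constant, the
   density of variance [2 * s ^+ 2]. *)
pose s2 := s * Num.sqrt 2.
have s20 : 0 < s2 by rewrite mulr_gt0// sqrtr_gt0.
have I := integrableZl measurableT (4 * s ^+ 2 * normal_peak s / normal_peak s2)
  (integrable_normal_pdf 0 s2).
apply: le_integrable I => //.
  apply/measurable_EFinP; apply: measurable_funM; last exact: measurable_normal_pdf.
  exact: measurable_funX.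
move=> x _ /=; rewrite lee_fin ger0_norm; last first.
  by rewrite mulr_ge0 ?sqr_ge0 ?normal_pdf_ge0 ?ltW.
have p20 := normal_peak_gt0 (lt0r_neq0 s20).
rewrite ger0_norm; last first.
  rewrite mulr_ge0 ?normal_pdf_ge0// divr_ge0 ?(ltW p20)//.
  by rewrite mulr_ge0 ?normal_peak_ge0// mulr_ge0 ?sqr_ge0.
rewrite pdfE normal_pdfE ?gt_eqF// /normal_fun subr0.
have -> : s2 ^+ 2 = 2 * s ^+ 2 by rewrite exprMn sqr_sqrtr// mulrC.
set E1 := expR _; set E2 := expR _; set N := normal_peak s.
have -> : 4 * s ^+ 2 * N / normal_peak s2 * (normal_peak s2 * E2) = N * (4 * s ^+ 2 * E2).
  by field; rewrite gt_eqF.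
have -> : x ^+ 2 * (N * E1) = N * (x ^+ 2 * E1) by ring.
rewrite ler_wpM2l ?normal_peak_ge0// /E1 /E2.
set u := x ^+ 2 / (4 * s ^+ 2).
have -> : - (x ^+ 2 / (s ^+ 2 * 2)) = - u + - u by rewrite /u; field.
have -> : - x ^+ 2 / (2 * s ^+ 2 *+ 2) = - u by rewrite /u; field.
rewrite expRD mulrA ler_wpM2r ?expR_ge0//.
have -> : x ^+ 2 = 4 * s ^+ 2 * u by rewrite /u; field.
have s4 : 0 <= 4 * s ^+ 2 by rewrite mulr_ge0 ?sqr_ge0.
rewrite -[leLHS]mulrA ler_piMr//.
rewrite expRN ler_pdivrMr ?expR_gt0// mul1r.
by rewrite (le_trans _ (expR_ge1Dx u))// lerDr.
Qed.

Lemma integrable_bounded_normal_pdf (g : R -> R) (C : R) : measurable_fun setT g ->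
  (forall x, `|g x| <= C) -> mu.-integrable setT (EFin \o (fun x => g x * n_s x)).
Proof.
move=> mg gC; have I := integrableZl measurableT C (integrable_normal_pdf 0 s).
apply: le_integrable I => //.
  apply/measurable_EFinP; apply: measurable_funM => //; exact: measurable_normal_pdf.
move=> x _ /=; rewrite lee_fin !normrM ler_pM//.
by rewrite (le_trans (gC x))// ler_norm.
Qed.

Lemma integrable_linear_normal_pdf (g : R -> R) (C : R) : measurable_fun setT g ->
  (forall x, `|g x| <= C * `|x|) -> mu.-integrable setT (EFin \o (fun x => g x * n_s x)).
Proof.
move=> mg gC.
have I1 := integrable_normal_pdf 0 s.
have I2 := integrable_sqr_normal_pdf.
have I := integrableZl measurableT C (integrableD measurableT I1 I2).
apply: le_integrable I => //.
  apply/measurable_EFinP; apply: measurable_funM => //; exact: measurable_normal_pdf.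
move=> x _; change (`|g x * n_s x|%:E <= `|C * (n_s x + x ^+ 2 * n_s x)|%:E)%E.
have -> : n_s x + x ^+ 2 * n_s x = (1 + x ^+ 2) * n_s x by ring.
rewrite lee_fin mulrA !normrM ler_wpM2r// (le_trans (gC x))//.
rewrite (le_trans (ler_wpM2r (normr_ge0 x) (ler_norm C)))// ler_wpM2l//.
rewrite ger0_norm ?addr_ge0 ?sqr_ge0// -(real_normK (num_real x)).
have := normr_ge0 x; nra.
Qed.

Let tail (g : R -> R) (C : R) : 0 <= C -> (forall x, `|g x| <= C * `|x|) ->
  (g n%:R * n_s n%:R) @[n --> \oo] --> 0 /\
  (g (- (n%:R)) * n_s (- (n%:R))) @[n --> \oo] --> 0.
Proof.
move=> C0 gC; pose c := C * (normal_peak s * s ^+ 2 * 2).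
have b x : x != 0 -> `|g x * n_s x| <= c / `|x|.
  move=> x0; rewrite normrM (ger0_norm (normal_pdf_ge0 _ _ _)).
  rewrite (le_trans (ler_wpM2r (normal_pdf_ge0 _ _ _) (gC x)))//.
  by rewrite -mulrA (le_trans (ler_wpM2l C0 (normal_pdf_tail x0)))// /c !mulrA.
split; apply: norm_cvg0; rewrite -cvg_shiftS/=.
- apply: (@squeeze_cvgr _ _ _ _ (cst 0) (fun n => c / n.+1%:R)).
  + apply: nearW => n; rewrite normr_ge0/=.
    by rewrite (le_trans (b _ _)) ?pnatr_eq0// normr_nat.
  + exact: cvg_cst.
  + by have := cvgS0 c; rewrite -cvg_shiftS.
- apply: (@squeeze_cvgr _ _ _ _ (cst 0) (fun n => c / n.+1%:R)).
  + apply: nearW => n; rewrite normr_ge0/=.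
    by rewrite (le_trans (b _ _)) ?oppr_eq0 ?pnatr_eq0// normrN normr_nat.
  + exact: cvg_cst.
  + by have := cvgS0 c; rewrite -cvg_shiftS.
Qed.

Let cn : continuous n_s. Proof. exact: continuous_normal_pdf. Qed.

(** The derivative of [x * n_s x] is [n_s x - s ^- 2 * (x ^+ 2 * n_s x)], and its integral
    vanishes. *)
Lemma Rintegral_sqr_normal_pdf : \int[mu]_x (x ^+ 2 * n_s x) = s ^+ 2.
Proof.
have I1 := integrable_normal_pdf 0 s.
have I2 := integrableZl measurableT (s ^- 2) integrable_sqr_normal_pdf.
have h0 : \int[mu]_x (n_s x - s ^- 2 * (x ^+ 2 * n_s x)) = 0.
  have ht (x : R) : `|x| <= 1 * `|x| by rewrite mul1r.
  have [t1 t2] := tail ler01 ht.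
  apply: (@Rintegral_derive0 (fun x => x * n_s x)).
  - move=> x; have h := is_deriveM (is_derive_id x 1) (is_derive_normal_pdf x).
    by apply: (is_derive_eq h); rewrite /GRing.scale/=; field.
  - move=> x; apply: cvgB; first exact: cn.
    apply: cvgM; first exact: cvg_cst.
    by apply: cvgM; [exact: sqr_continuous|exact: cn].
  - exact: (integrableB measurableT I1 I2).
  - exact: t1.
  - exact: t2.
move: h0; rewrite RintegralB// RintegralZl//; last exact: integrable_sqr_normal_pdf.
rewrite [X in X - _](_ : _ = 1); last first.
  by rewrite /Rintegral integral_normal_pdf.
move/eqP; rewrite subr_eq0 => /eqP h.
by rewrite -[LHS](mulVKf (_ : s ^+ 2 != 0)) ?sqrf_eq0// -h mulr1.
Qed.

(** Stein's identity for the normal law, tested on sines. It makes the error in [stein_cos_moment]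
    vanish, which yields the Gaussian characteristic function without contour integrals. *)
Lemma Rintegral_sin_normal_pdf (l q : R) :
  \int[mu]_x (x * sin (l * x + q) * n_s x) =
  l * s ^+ 2 * \int[mu]_x (cos (l * x + q) * n_s x).
Proof.
have cs : continuous (fun x : R => sin (l * x + q)).
  move=> x; apply: continuous_comp; last exact: continuous_sin.
  by apply: cvgD; [apply: cvgM; [exact: cvg_cst|exact: cvg_id]|exact: cvg_cst].
have cc : continuous (fun x : R => cos (l * x + q)).
  move=> x; apply: continuous_comp; last exact: continuous_cos.
  by apply: cvgD; [apply: cvgM; [exact: cvg_cst|exact: cvg_id]|exact: cvg_cst].
have I1 : mu.-integrable setT (EFin \o (fun x => cos (l * x + q) * n_s x)).
  apply: (@integrable_bounded_normal_pdf _ 1); first exact: continuous_measurable_fun.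
  by move=> x; rewrite ler_norml cos_geN1 cos_le1.
have I2 : mu.-integrable setT (EFin \o (fun x => x * sin (l * x + q) * n_s x)).
  apply: (@integrable_linear_normal_pdf _ 1).
    by apply: measurable_funM => //; exact: continuous_measurable_fun.
  move=> x; rewrite mul1r normrM -[leRHS]mulr1 ler_pM//.
  by rewrite ler_norml sin_geN1 sin_le1.
have I1' := integrableZl measurableT l I1.
have I2' := integrableZl measurableT (s ^- 2) I2.
have h0 : \int[mu]_x (l * (cos (l * x + q) * n_s x) -
    s ^- 2 * (x * sin (l * x + q) * n_s x)) = 0.
  have tl x : x != 0 -> `|sin (l * x + q) * n_s x| <= normal_peak s * s ^+ 2 * 2 / `|x| ^+ 2.
    move=> x0; rewrite normrM (ger0_norm (normal_pdf_ge0 _ _ _)).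
    rewrite (le_trans (ler_wpM2r (normal_pdf_ge0 _ _ _) (_ : _ <= 1)))//.
      by rewrite ler_norml sin_geN1 sin_le1.
    have x0' : 0 < `|x| by rewrite normr_gt0.
    rewrite mul1r expr2 invfM mulrA ler_pdivlMr// mulrC; exact: normal_pdf_tail.
  have lim (e : bool) : sin (l * ((-1) ^+ e * n%:R) + q) * n_s ((-1) ^+ e * n%:R) @[n --> \oo] --> (0:R).
    apply: norm_cvg0; rewrite -cvg_shiftS/=.
    apply: (@squeeze_cvgr _ _ _ _ (cst 0) (fun n => normal_peak s * s ^+ 2 * 2 / n.+1%:R)).
    + apply: nearW => n; rewrite normr_ge0/=.
      have n0 : 0 < n.+1%:R :> R by rewrite ltr0n.
      rewrite (le_trans (tl _ _)) ?mulf_neq0 ?signr_eq0 ?pnatr_eq0//.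
      rewrite normrM normr_sign mul1r normr_nat.
      apply: ler_wpM2l; first by rewrite mulr_ge0// mulr_ge0 ?sqr_ge0 ?normal_peak_ge0.
      by rewrite lef_pV2 ?posrE ?exprn_gt0// expr2 ler_peMr ?ler1n// ltW.
    + exact: cvg_cst.
    + by have := cvgS0 (normal_peak s * s ^+ 2 * 2); rewrite -cvg_shiftS.
  apply: (@Rintegral_derive0 (fun x => sin (l * x + q) * n_s x)).
  - move=> x.
    have h : is_derive x 1 (fun x : R => l * x + q) l.
      by apply: is_derive_eq; rewrite /GRing.scale/=; ring.
    have h2 := @is_derive1_comp _ sin (fun x : R => l * x + q) x _ _ (is_derive_sin _) h.
    have h3 := is_deriveM h2 (is_derive_normal_pdf x).
    by apply: (is_derive_eq h3); rewrite /GRing.scale/=; field.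
  - move=> x; apply: cvgB.
      apply: cvgM; first exact: cvg_cst.
      by apply: cvgM; [exact: cc|exact: cn].
    apply: cvgM; first exact: cvg_cst.
    by apply: cvgM; [apply: cvgM; [exact: cvg_id|exact: cs]|exact: cn].
  - exact: (integrableB measurableT I1' I2').
  - have := lim false; under eq_fun do rewrite expr0 mul1r; exact.
  - have := lim true; under eq_fun do rewrite expr1 mulN1r; exact.
move: h0; rewrite RintegralB// !RintegralZl//.
move/eqP; rewrite subr_eq0 => /eqP h.
rewrite -[LHS](mulVKf (_ : s ^+ 2 != 0)) ?sqrf_eq0// -h; ring.
Qed.

(** The Radon-Nikodym derivative of [normal_prob] is identified with [normal_pdf] because both have
    the same integral over every measurable set. *)
Lemma Rintegral_normal_prob (g : R -> R) : measurable_fun setT g ->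
  (normal_prob 0 s).-integrable setT (EFin \o g) ->
  \int[normal_prob 0 s]_x g x = \int[mu]_x (g x * n_s x).
Proof.
move=> mg ig; congr fine.
have dom := normal_prob_dominates 0 s.
rewrite -(Radon_Nikodym_change_of_variables dom)//=.
apply: ae_eq_integral => //.
- apply: emeasurable_funM; first exact/measurable_EFinP.
  by apply: (measurable_int mu); exact: Radon_Nikodym_integrable.
- by apply/measurable_EFinP; apply: measurable_funM => //; exact: measurable_normal_pdf.
rewrite (_ : (fun x => (g x * n_s x)%:E) = (fun x => (g x)%:E * (n_s x)%:E)%E)//.
apply: ae_eqe_mul2l => /=; rewrite Radon_NikodymE//=.
case: cid => /= h [h1 h2 h3]; apply: integral_ae_eq => //=.
- by apply/measurable_EFinP; exact: measurable_normal_pdf.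
- by move=> E E01 mE; rewrite -h3.
Qed.

End normal_integrals.

Section centered_gaussian.
Context (R : realType) d (T : measurableType d) (Q : probability T R).

(** Writing the variance as a second moment covers the degenerate case as well. In the other case
    Stein's identity is exact, so [stein_cos_moment] applies with [D = 0]. *)
Lemma centered_gaussian_cos_moment (X : T -> R) (q : R) : measurable_fun setT X ->
  Q.-integrable setT (EFin \o (fun w => X w ^+ 2)) -> centered_gaussian Q X ->
  \int[Q]_w cos (X w + q) = expR (- ((\int[Q]_w (X w ^+ 2)) / 2)) * cos q.
Proof.
move=> mX X2 [X0|[s s0 lawX]].
  have -> : \int[Q]_w (X w ^+ 2) = 0.
    rewrite (eq_Rintegral_ae (g := cst 0))//; first by rewrite Rintegral_cst// mul0r.
      exact: measurable_funX.
    by apply: filterS X0 => w ->; rewrite expr0n.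
  rewrite mul0r oppr0 expR0 mul1r (eq_Rintegral_ae (g := cst (cos q)))//.
  - by rewrite Rintegral_cst// (_ : fine _ = 1) ?mulr1//= probability_setT.
  - apply: (measurableT_comp (continuous_measurable_fun (@continuous_cos R))).
    exact: measurable_funD.
  - by apply: filterS X0 => w ->; rewrite add0r.
have mX' : measurable_fun setT (X : T -> measurableTypeR R) by [].
have lawX' A : measurable A -> normal_prob 0 s A = Q (X @^-1` A).
  by move=> mA; rewrite lawX.
have RI (g : R -> R) : measurable_fun setT g ->
    Q.-integrable setT (EFin \o (g \o X)) ->
    \int[Q]_w g (X w) = \int[lebesgue_measure]_x (g x * normal_pdf 0 s x).
  move=> mg ig; rewrite -Rintegral_normal_prob//.
    by rewrite (Rintegral_image (mu := Q) (nu := normal_prob 0 s) mX').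
  by apply/(integrable_image (mu := Q) (nu := normal_prob 0 s) mX').
have EX2 : \int[Q]_w (X w ^+ 2) = s ^+ 2.
  by rewrite (RI (fun x => x ^+ 2))//; exact: Rintegral_sqr_normal_pdf.
rewrite EX2.
have msin (l : R) : measurable_fun setT (fun x : R => x * sin (l * x + q)).
  apply: measurable_funM => //.
  apply: (measurableT_comp (continuous_measurable_fun (@continuous_sin R))).
  by apply: measurable_funD => //; exact: measurable_funM.
have mcos (l : R) : measurable_fun setT (fun x : R => cos (l * x + q)).
  apply: (measurableT_comp (continuous_measurable_fun (@continuous_cos R))).
  by apply: measurable_funD => //; exact: measurable_funM.
apply/eqP; rewrite -subr_eq0 -normr_le0.
apply: (stein_cos_moment mX X2 (D := 0)); first exact: sqr_ge0.
move=> l _; rewrite normr_le0 subr_eq0; apply/eqP.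
rewrite /cos_moment (RI (fun x => x * sin (l * x + q)))//; last first.
  apply: le_integrable (integrable_sqrW mX X2) => //.
    by apply/measurable_EFinP; exact: measurableT_comp (msin l) mX.
  move=> w _ /=; rewrite lee_fin normrM -[leRHS]mulr1 ler_pM//.
  by rewrite ler_norml sin_geN1 sin_le1.
rewrite (RI (fun x => cos (l * x + q)))//; last first.
  apply: (@integrable_bounded _ _ _ _ _ 1) => [|w].
    exact: measurableT_comp (mcos l) mX.
  by rewrite ler_norml cos_geN1 cos_le1.
exact: Rintegral_sin_normal_pdf.
Qed.

End centered_gaussian.

(** * Central limit theorem for m-dependent integrals *)

Section m_dependent_clt.
Context (R : realType) d (T : measurableType d) (P : probability T R).
Variables (G : R -> T -> R) (A m t : R).
Hypotheses (A0 : 0 <= A) (m0 : 0 <= m) (t0 : 0 <= t).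
Hypothesis mG : measurable_fun setT (fun p : R * T => G p.1 p.2).
Hypothesis GA : forall s w, `|G s w| <= A.

(** Independence enters through products over finitely many times. Such products are measurable for
    the sigma-algebra of the field at these times, which is not known for integrals over time;
    Fubini transfers the independence to the integrals. *)
Definition field_prod (l : seq R) (w : T) := \prod_(s <- l) G s w.

Hypothesis G_centered : forall s, \int[P]_w G s w = 0.
Hypothesis G_indep : forall l1 l2 : seq R,
  (forall s r, s \in l1 -> r \in l2 -> m <= `|s - r|) ->
  \int[P]_w (field_prod l1 w * field_prod l2 w) =
  (\int[P]_w field_prod l1 w) * \int[P]_w field_prod l2 w.

Notation tau := (itv_measure 0 t).

Definition path_integral (D : set R) (w : T) := \int[tau]_r (\1_D r * G r w).

Let mGs s : measurable_fun setT (G s).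
Proof. exact: (measurableT_comp mG (measurable_pair1 s)). Qed.

Let mDG (D : set R) : measurable D ->
  measurable_fun setT (fun p : R * T => \1_D p.1 * G p.1 p.2).
Proof.
move=> mD; apply: measurable_funM => //.
by apply: (measurableT_comp _ measurable_fst); exact: measurable_indic.
Qed.

Let indic_le1 (D : set R) r : `|\1_D r : R| <= 1.
Proof. by rewrite indicE; case: (_ \in _); rewrite ?normr1 ?normr0. Qed.

Let DGA (D : set R) (r : R) w : `|\1_D r * G r w| <= A.
Proof. by rewrite normrM -[leRHS]mul1r ler_pM. Qed.

Lemma measurable_path_integral D : measurable D ->
  measurable_fun setT (path_integral D).
Proof. by move=> mD; exact: (measurable_Rintegral_fst tau (mDG mD)). Qed.

Lemma path_integral_le D w : measurable D -> `|path_integral D w| <= A * t.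
Proof.
move=> mD; rewrite -[t in leRHS]subr0.
apply: Rintegral_itv_bound => //.
exact: (measurableT_comp (mDG mD) (measurable_pair2 w)).
Qed.

Lemma measurable_field_prod l : measurable_fun setT (field_prod l).
Proof. exact: measurable_prod. Qed.

Lemma field_prod_le l w : `|field_prod l w| <= A ^+ size l.
Proof.
elim: l => [|s l IH]; first by rewrite /field_prod big_nil expr0 normr1.
by rewrite /field_prod big_cons normrM exprS ler_pM.
Qed.

Lemma field_prod_cons s l w : field_prod (s :: l) w = G s w * field_prod l w.
Proof. by rewrite /field_prod big_cons. Qed.

Let Fubini_path (Z : T -> R) (C : R) D : measurable D -> measurable_fun setT Z ->
  (forall w, `|Z w| <= C) ->
  \int[P]_w (Z w * path_integral D w) =
  \int[tau]_r (\1_D r * \int[P]_w (Z w * G r w)).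
Proof.
move=> mD mZ ZC.
pose h (p : R * T) := Z p.2 * (\1_D p.1 * G p.1 p.2).
have mh : measurable_fun setT h.
  by apply: measurable_funM; [exact: (measurableT_comp mZ measurable_snd)|exact: mDG].
have hC p : `|h p| <= C * A by rewrite normrM ler_pM.
transitivity (\int[P]_w \int[tau]_r h (r, w)).
  apply: eq_Rintegral => w _; rewrite -RintegralZl//.
  apply: (@integrable_bounded _ _ _ _ _ A) => [|r]; last exact: DGA.
  exact: (measurableT_comp (mDG mD) (measurable_pair2 w)).
rewrite -(Rintegral_Fubini_bounded _ _ mh hC).
apply: eq_Rintegral => r _; rewrite /h/= -RintegralZl//.
  by apply: eq_Rintegral => w _; rewrite mulrCA.
apply: (@integrable_bounded _ _ _ _ _ (C * A)) => [|w]; first exact: measurable_funM.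
by rewrite normrM ler_pM.
Qed.

Let bpow D n w : measurable D -> `|path_integral D w ^+ n| <= (A * t) ^+ n.
Proof. by move=> mD; rewrite normrX lerXn2r ?nnegrE ?mulr_ge0// path_integral_le. Qed.

(** Fubini unfolds one power of the path integral into a value [G r], and the indicator puts [r] in
    [D], so [r] can join the list [l2]. After [n] rounds only finite products are left. *)
Let indep_pow l1 (D : set R) n l2 : measurable D ->
  (forall s r, s \in l1 -> D r -> m <= `|s - r|) -> (forall r, r \in l2 -> D r) ->
  \int[P]_w (field_prod l1 w * (field_prod l2 w * path_integral D w ^+ n)) =
  (\int[P]_w field_prod l1 w) * \int[P]_w (field_prod l2 w * path_integral D w ^+ n).
Proof.
move=> mD sep; have mU n' := measurable_funX n' (measurable_path_integral mD).
elim: n l2 => [|n IH] l2 l2D.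
  have e0 : (fun w => field_prod l2 w * path_integral D w ^+ 0) = field_prod l2.
    by apply/funext => w; rewrite expr0 mulr1.
  rewrite e0; under eq_Rintegral do rewrite expr0 mulr1.
  by apply: G_indep => s r sl rl; apply: sep => //; exact: l2D.
have m2 l' k : measurable_fun setT (fun w => field_prod l' w * path_integral D w ^+ k).
  by apply: measurable_funM => //; exact: measurable_field_prod.
have b2 l' k w : `|field_prod l' w * path_integral D w ^+ k| <= A ^+ size l' * (A * t) ^+ k.
  by rewrite normrM ler_pM ?field_prod_le ?bpow.
transitivity (\int[P]_w (field_prod l1 w * (field_prod l2 w * path_integral D w ^+ n)
    * path_integral D w)).
  by apply: eq_Rintegral => w _; rewrite exprSr !mulrA.
rewrite (Fubini_path (C := A ^+ size l1 * (A ^+ size l2 * (A * t) ^+ n)))//; last 2 first.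
- by apply: measurable_funM => //; exact: measurable_field_prod.
- by move=> w; rewrite normrM ler_pM ?field_prod_le ?b2.
have E r : D r -> \int[P]_w (field_prod l1 w * (field_prod l2 w * path_integral D w ^+ n) * G r w) =
    (\int[P]_w field_prod l1 w) * \int[P]_w (field_prod l2 w * path_integral D w ^+ n * G r w).
  move=> Dr.
  have e w : field_prod (r :: l2) w * path_integral D w ^+ n =
      field_prod l2 w * path_integral D w ^+ n * G r w.
    by rewrite field_prod_cons; ring.
  transitivity (\int[P]_w (field_prod l1 w * (field_prod (r :: l2) w * path_integral D w ^+ n))).
    by apply: eq_Rintegral => w _; rewrite e !mulrA.
  rewrite IH; last by move=> r'; rewrite inE => /predU1P[->//|]; exact: l2D.
  by congr (_ * _); apply: eq_Rintegral => w _; rewrite e.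
transitivity (\int[tau]_r ((\int[P]_w field_prod l1 w) *
    (\1_D r * \int[P]_w (field_prod l2 w * path_integral D w ^+ n * G r w)))).
  apply: eq_Rintegral => r _; rewrite indicE.
  by case: (boolP (r \in D)) => [/[!inE] /E ->|_]; [rewrite mulrCA|rewrite !mul0r mulr0].
rewrite RintegralZl//; last first.
  apply: (@integrable_bounded _ _ _ _ _ (A ^+ size l2 * (A * t) ^+ n * A)) => [|r].
    apply: measurable_funM; first exact: measurable_indic.
    apply: (measurable_Rintegral_snd P (f := fun p : R * T =>
      field_prod l2 p.2 * path_integral D p.2 ^+ n * G p.1 p.2)).
    by apply: measurable_funM => //; exact: (measurableT_comp (m2 l2 n) measurable_snd).
  rewrite normrM -[leRHS]mul1r ler_pM//.
  apply: Rintegral_probability_bound; first exact: measurable_funM.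
  by move=> w; rewrite normrM ler_pM// b2.
congr (_ * _); rewrite -(Fubini_path (C := A ^+ size l2 * (A * t) ^+ n))//.
by apply: eq_Rintegral => w _; rewrite exprSr !mulrA.
Qed.

(** From powers of a bounded variable to its cosine by polynomial approximation; the second variable
    of [weierstrass2] is set to 0. *)
Lemma path_integral_indep l (D : set R) k q : measurable D ->
  (forall s r, s \in l -> D r -> m <= `|s - r|) ->
  \int[P]_w (field_prod l w * cos (k * path_integral D w + q)) =
  (\int[P]_w field_prod l w) * \int[P]_w cos (k * path_integral D w + q).
Proof.
move=> mD sep; set U := path_integral D.
have mU : measurable_fun setT U := measurable_path_integral mD.
have ml := measurable_field_prod l.
pose C := A * t + 1; have C0 : 0 < C by rewrite ltr_wpDl// mulr_ge0.
have UC w : `|U w| <= C by rewrite (le_trans (path_integral_le w mD))// lerDl.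
have hpol p n : polynomial2 p ->
    \int[P]_w (field_prod l w * (U w ^+ n * p (U w) 0)) =
    (\int[P]_w field_prod l w) * \int[P]_w (U w ^+ n * p (U w) 0).
  have I2 r k' : polynomial2 r -> P.-integrable setT (EFin \o (fun w => U w ^+ k' * r (U w) 0)).
    move=> pr; have [E HE] := polynomial2_bounded C pr.
    apply: (@integrable_bounded _ _ _ _ _ ((A * t) ^+ k' * E)) => [|w].
      apply: measurable_funM; first exact: measurable_funX.
      exact: measurable_polynomial2.
    by rewrite normrM ler_pM ?bpow// HE// normr0 ltW.
  have I1 r k' : polynomial2 r -> P.-integrable setT
      (EFin \o (fun w => field_prod l w * (U w ^+ k' * r (U w) 0))).
    move=> pr; have [E HE] := polynomial2_bounded C pr.
    apply: (@integrable_bounded _ _ _ _ _ (A ^+ size l * ((A * t) ^+ k' * E))) => [|w].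
      apply: measurable_funM => //; apply: measurable_funM; first exact: measurable_funX.
      exact: measurable_polynomial2.
    rewrite normrM ler_pM ?field_prod_le//.
    by rewrite normrM ler_pM ?bpow// HE// normr0 ltW.
  move=> pp; elim: pp n => [c|{}p q' pp IHp pq IHq|c {}p pp IHp|{}p pp IHp|{}p pp IHp] n.
  - have h : \int[P]_w (field_prod l w * U w ^+ n) =
        (\int[P]_w field_prod l w) * \int[P]_w (U w ^+ n).
      have e w : field_prod [::] w * U w ^+ n = U w ^+ n.
        by rewrite /field_prod big_nil mul1r.
      transitivity (\int[P]_w (field_prod l w * (field_prod [::] w * U w ^+ n))).
        by apply: eq_Rintegral => w _; rewrite e.
      rewrite (@indep_pow l D n [::] mD sep)//.
      by congr (_ * _); apply: eq_Rintegral => w _; exact: e.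
    have J1 := I1 _ n (polynomial2_cst 1).
    have J2 : P.-integrable setT (EFin \o (fun w => U w ^+ n)).
      by apply: integrable_bounded (fun w => bpow n w mD); exact: measurable_funX.
    transitivity (\int[P]_w (field_prod l w * (U w ^+ n * 1) * c)).
      by apply: eq_Rintegral => w _; rewrite mulr1 mulrA.
    rewrite RintegralZr//.
    under eq_Rintegral do rewrite mulr1.
    by rewrite h -mulrA RintegralZr.
  - transitivity (\int[P]_w (field_prod l w * (U w ^+ n * p (U w) 0) +
        field_prod l w * (U w ^+ n * q' (U w) 0))).
      by apply: eq_Rintegral => w _; rewrite -!mulrDr.
    rewrite RintegralD//; [|exact: I1|exact: I1].
    rewrite IHp IHq -mulrDr -RintegralD//; [|exact: I2|exact: I2].
    by congr (_ * _); apply: eq_Rintegral => w _; rewrite -mulrDr.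
  - transitivity (\int[P]_w (c * (field_prod l w * (U w ^+ n * p (U w) 0)))).
      by apply: eq_Rintegral => w _; rewrite (mulrCA _ c) (mulrCA _ c).
    rewrite RintegralZl//; last exact: I1.
    rewrite IHp mulrCA -RintegralZl//; last exact: I2.
    by congr (_ * _); apply: eq_Rintegral => w _; rewrite (mulrCA _ c).
  - have e w : U w ^+ n * (U w * p (U w) 0) = U w ^+ n.+1 * p (U w) 0.
      by rewrite exprSr mulrA.
    transitivity (\int[P]_w (field_prod l w * (U w ^+ n.+1 * p (U w) 0))).
      by apply: eq_Rintegral => w _; rewrite e.
    by rewrite IHp; congr (_ * _); apply: eq_Rintegral => w _; rewrite e.
  - have z (g : T -> R) : (forall w, g w = 0) -> \int[P]_w g w = 0.
      move=> g0; transitivity (\int[P]_w (0 : R)).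
        by apply: eq_Rintegral => w _; rewrite g0.
      by rewrite Rintegral_cst// mul0r.
    rewrite (z (fun w => field_prod l w * (U w ^+ n * (0 * p (U w) 0)))); last first.
      by move=> w; rewrite mul0r !mulr0.
    by rewrite (z (fun w => U w ^+ n * (0 * p (U w) 0))) ?mulr0// => w; rewrite mul0r mulr0.
have cc : continuous (fun p : R * R => cos (k * p.1 + q)).
  move=> p; apply: continuous_comp; last exact: continuous_cos.
  by apply: cvgD; [apply: cvgM; [exact: cvg_cst|exact: cvg_fst]|exact: cvg_cst].
have mcos : measurable_fun setT (fun w => cos (k * U w + q)).
  apply: (measurableT_comp (@measurable_cos R)).
  by apply: measurable_funD => //; exact: measurable_funM.
apply/eqP; rewrite -subr_eq0 -normr_le0; apply/ler_addgt0Pl => e e0.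
pose al := A ^+ size l; have al0 : 0 <= al by rewrite exprn_ge0.
(* Each side of the identity moves by at most [al] times the error of approximation; the [+ 1] keeps
   the denominator positive. *)
have e'0 : 0 < e / (2 * al + 1) by rewrite divr_gt0// ltr_wpDl// mulr_ge0.
have [p pp ph] := weierstrass2 (h := fun x _ => cos (k * x + q)) C0 cc
  (fun x _ => cos_max (k * x + q)) e'0.
have Ep : \int[P]_w (field_prod l w * p (U w) 0) =
    (\int[P]_w field_prod l w) * \int[P]_w p (U w) 0.
  transitivity (\int[P]_w (field_prod l w * (U w ^+ 0 * p (U w) 0))).
    by apply: eq_Rintegral => w _; rewrite expr0 mul1r.
  by rewrite hpol//; congr (_ * _); apply: eq_Rintegral => w _; rewrite expr0 mul1r.
have mp : measurable_fun setT (fun w => p (U w) 0) by exact: measurable_polynomial2.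
have close w : `|p (U w) 0 - cos (k * U w + q)| <= e / (2 * al + 1).
  by apply: ph => //; rewrite normr0 ltW.
have [E HE] := polynomial2_bounded C pp.
have Ip : P.-integrable setT (EFin \o (fun w => p (U w) 0)).
  by apply: (integrable_bounded _ mp (C := E)) => w; rewrite HE// normr0 ltW.
have Ic : P.-integrable setT (EFin \o (fun w => cos (k * U w + q))).
  exact: integrable_bounded mcos (fun w => cos_max _).
have Ilp : P.-integrable setT (EFin \o (fun w => field_prod l w * p (U w) 0)).
  apply: (@integrable_bounded _ _ _ _ _ (al * E)); first exact: measurable_funM.
  by move=> w; rewrite normrM ler_pM ?field_prod_le// HE// normr0 ltW.
have Ilc : P.-integrable setT (EFin \o (fun w => field_prod l w * cos (k * U w + q))).
  apply: (@integrable_bounded _ _ _ _ _ (al * 1)); first exact: measurable_funM.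
  by move=> w; rewrite normrM ler_pM ?field_prod_le// cos_max.
have d1 : `|\int[P]_w (field_prod l w * p (U w) 0) -
    \int[P]_w (field_prod l w * cos (k * U w + q))| <= al * (e / (2 * al + 1)).
  rewrite -RintegralB//; apply: Rintegral_probability_bound.
    by apply: measurable_funB; exact: measurable_funM.
  by move=> w; rewrite -mulrBr normrM ler_pM ?field_prod_le.
have d2 : `|(\int[P]_w field_prod l w) * \int[P]_w p (U w) 0 -
    (\int[P]_w field_prod l w) * \int[P]_w cos (k * U w + q)| <= al * (e / (2 * al + 1)).
  rewrite -mulrBr normrM ler_pM//.
    by apply: Rintegral_probability_bound => // w; exact: field_prod_le.
  rewrite -RintegralB//; apply: Rintegral_probability_bound => //.
  exact: measurable_funB.
rewrite addr0.
have : al * (e / (2 * al + 1)) + al * (e / (2 * al + 1)) <= e.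
  have -> : al * (e / (2 * al + 1)) + al * (e / (2 * al + 1)) =
    e * (2 * al / (2 * al + 1)) by field; rewrite gt_eqF// ltr_wpDl// mulr_ge0.
  apply: ler_piMr; first exact: ltW.
  rewrite ler_pdivrMr ?mul1r ?lerDl//.
  by rewrite ltr_wpDl// mulr_ge0.
move: d1 d2; rewrite Ep !ler_norml => /andP[h1 h2] /andP[h3 h4] h5.
by apply/andP; split; lra.
Qed.

Let near (s r : R) := [set x : R | `|x - s| < r].

Let mnear s r : measurable (near s r).
Proof.
rewrite (_ : near s r = `]s - r, s + r[%classic); first exact: measurable_itv.
by apply/seteqP; split=> x; rewrite /near/= in_itv/= ltr_distl.
Qed.

Let far (s r : R) : set R := ~` near s r.

Let mfar s r : measurable (far s r). Proof. by apply: measurableC; exact: mnear. Qed.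

Let U := path_integral setT.

Let splitU s r w : U w = path_integral (near s r) w + path_integral (far s r) w.
Proof.
have I D : measurable D -> tau.-integrable setT (EFin \o (fun r => \1_D r * G r w)).
  move=> mD; apply: (@integrable_bounded _ _ _ _ _ A) => [|r']; last exact: DGA.
  exact: (measurableT_comp (mDG mD) (measurable_pair2 w)).
rewrite /U /path_integral -RintegralD//; [|by apply: I; exact: mnear|by apply: I; exact: mfar].
apply: eq_Rintegral => x _; rewrite -mulrDl; congr (_ * _).
rewrite !indicE in_setT /far in_setC.
by case: (x \in near s r); rewrite /= ?addr0 ?add0r.
Qed.

Let near_le s r w : 0 <= r -> `|path_integral (near s r) w| <= A * (2 * r).
Proof.
move=> r0; apply: Rintegral_itv_near_bound => //.
exact: (measurableT_comp mG (measurable_pair2 w)).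
Qed.

Let mU D : measurable D -> measurable_fun setT (path_integral D).
Proof. exact: measurable_path_integral. Qed.

Let mcosU D k q : measurable D -> measurable_fun setT (fun w => cos (k * path_integral D w + q)).
Proof.
move=> mD; apply: (measurableT_comp (@measurable_cos R)).
by apply: measurable_funD => //; apply: measurable_funM => //; exact: mU.
Qed.

Let msinU D k q : measurable D -> measurable_fun setT (fun w => sin (k * path_integral D w + q)).
Proof.
move=> mD; apply: (measurableT_comp (@measurable_sin R)).
by apply: measurable_funD => //; apply: measurable_funM => //; exact: mU.
Qed.

(** [G s] is centered and independent of the far part; the sine is a cosine with shifted [q]. *)
Let EG_far s r k q : m <= r ->
  \int[P]_w (G s w * sin (k * path_integral (far s r) w + q)) = 0.
Proof.
move=> mr; have := @path_integral_indep [:: s] (far s r) k (q - pi / 2) (mfar s r).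
have e : field_prod [:: s] = G s by apply/funext => w; rewrite /field_prod big_seq1.
rewrite e G_centered mul0r => h; rewrite -[RHS]h.
  by apply: eq_Rintegral => w _; rewrite sin_shift addrA.
move=> s' r'; rewrite inE => /eqP ->.
by rewrite /far /near/= => /negP; rewrite -leNgt distrC; exact: le_trans.
Qed.

Let EGG s r : m <= `|s - r| -> \int[P]_w (G s w * G r w) = 0.
Proof.
move=> sr; have := G_indep (l1 := [:: s]) (l2 := [:: r]).
have e s' : field_prod [:: s'] = G s'.
  by apply/funext => w; rewrite /field_prod big_seq1.
rewrite !e G_centered mul0r => -> // s' r'.
by rewrite !inE => /eqP -> /eqP ->.
Qed.

(** Times at distance at least [m] are uncorrelated with [s], so the near part carries the whole
    covariance of [G s] with [U]. *)
Let EGnear s : \int[P]_w (G s w * path_integral (near s m) w) =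
  \int[P]_w (G s w * U w).
Proof.
rewrite (Fubini_path (mnear s m) (mGs s) (GA s)).
rewrite (Fubini_path measurableT (mGs s) (GA s)).
apply: eq_Rintegral => r _; rewrite !indicE in_setT.
case: (boolP (r \in near s m)) => //; rewrite notin_setE /near/= => /negP.
by rewrite -leNgt distrC => /EGG ->; rewrite !mulr0.
Qed.

(** The radius is [m + m] because every [r] within [m] of [s], and not only [s] itself, must keep
    distance [m] from the remaining times. *)
Let EGnear_cos s k q :
  \int[P]_w (G s w * path_integral (near s m) w *
    cos (k * path_integral (far s (m + m)) w + q)) =
  (\int[P]_w (G s w * U w)) * \int[P]_w cos (k * path_integral (far s (m + m)) w + q).
Proof.
set F := path_integral (far s (m + m)).
have mF : measurable_fun setT (fun w => cos (k * F w + q)) by apply: mcosU; exact: mfar.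
transitivity (\int[P]_w (G s w * cos (k * F w + q) * path_integral (near s m) w)).
  by apply: eq_Rintegral => w _; rewrite mulrAC.
rewrite (Fubini_path (C := A * 1) (mnear s m)); last 2 first.
- exact: measurable_funM.
- by move=> w; rewrite normrM ler_pM// cos_max.
rewrite -EGnear (Fubini_path (mnear s m) (mGs s) (GA s)) -RintegralZr//; last first.
  apply: (@integrable_bounded _ _ _ _ _ (A * A)) => [|r].
    apply: measurable_funM; first exact: measurable_indic.
    apply: (measurable_Rintegral_snd P (f := fun p : R * T => G s p.2 * G p.1 p.2)).
    by apply: measurable_funM => //; exact: (measurableT_comp (mGs s) measurable_snd).
  rewrite normrM -[leRHS]mul1r ler_pM//.
  apply: Rintegral_probability_bound; first exact: measurable_funM.
  by move=> w; rewrite normrM ler_pM.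
apply: eq_Rintegral => r _; rewrite indicE.
case: (boolP (r \in near s m)) => [/[!inE] rs|_]; last by rewrite !mul0r.
rewrite !mul1r.
have := @path_integral_indep [:: s; r] (far s (m + m)) k q (mfar _ _).
have e : field_prod [:: s; r] = (fun w => G s w * G r w).
  by apply/funext => w; rewrite /field_prod big_cons big_seq1.
rewrite e => <-.
  by apply: eq_Rintegral => w _; rewrite mulrAC.
move=> s' r'; rewrite !inE /far/near/= => sr' /negP; rewrite -leNgt => h.
have h2 : `|r' - s| <= `|s' - r'| + `|s' - s|.
  by rewrite (distrC s' r'); exact: ler_distD.
move: rs; rewrite /near/= => rs; have := m0.
by case/orP: sr' => /eqP e'; rewrite e' ?subrr ?normr0 in h2 *; lra.
Qed.

(* The points within m of s are removed from U to make it independent of G s;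
   removing those within 2m makes the remaining part independent of the product
   of G s with the part within m. *)
Lemma local_stein s (k q : R) : 0 <= k ->
  `|\int[P]_w (G s w * sin (k * U w + q)) -
    k * (\int[P]_w (G s w * U w)) * \int[P]_w cos (k * U w + q)| <=
  24 * k ^+ 2 * m ^+ 2 * A ^+ 3.
Proof.
move=> k0.
set N := path_integral (near s m); set F := path_integral (far s m).
set F2 := path_integral (far s (m + m)); set N2 := path_integral (near s (m + m)).
have mN : measurable_fun setT N by apply: mU; exact: mnear.
have NA w : `|N w| <= A * (2 * m) by exact: near_le.
have N2A w : `|N2 w| <= A * (2 * (m + m)) by apply: near_le; rewrite addr_ge0.
have Am0 : 0 <= A * (2 * m) by rewrite !mulr_ge0.
pose g1 w := G s w * sin (k * F w + q).
pose g2 w := G s w * N w * cos (k * F2 w + q).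
have mg0 : measurable_fun setT (fun w => G s w * sin (k * U w + q)).
  by apply: measurable_funM => //; exact: msinU.
have mg1 : measurable_fun setT g1 by apply: measurable_funM => //; apply: msinU; exact: mfar.
have mg2 : measurable_fun setT g2.
  by apply: measurable_funM; [exact: measurable_funM|apply: mcosU; exact: mfar].
have Ig0 : P.-integrable setT (EFin \o (fun w => G s w * sin (k * U w + q))).
  by apply: (integrable_bounded _ mg0 (C := A * 1)) => w; rewrite normrM ler_pM// sin_max.
have Ig1 : P.-integrable setT (EFin \o g1).
  by apply: (integrable_bounded _ mg1 (C := A * 1)) => w; rewrite normrM ler_pM// sin_max.
have Ig2 : P.-integrable setT (EFin \o g2).
  apply: (integrable_bounded _ mg2 (C := A * (A * (2 * m)) * 1)) => w.
  by rewrite normrM ler_pM ?cos_max// normrM ler_pM.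
have Ikg2 : P.-integrable setT (EFin \o (fun w => k * g2 w)) := integrableZl measurableT k Ig2.
(* Here [16 = 4 + 12]: the Taylor remainder is at most [(k * (A * (2 * m))) ^+ 2], and replacing [F]
   by [F2] in the cosine costs [k * (6 * m * A)], with [6 = 2 + 4], times the factor [k * N w]. *)
have pw w : `|G s w * sin (k * U w + q) - g1 w - k * g2 w| <= 16 * k ^+ 2 * m ^+ 2 * A ^+ 3.
  have e1 : k * U w + q = (k * F w + q) + k * N w by rewrite (splitU s m w) -/N -/F; ring.
  have b1 : `|sin (k * U w + q) - sin (k * F w + q) - k * N w * cos (k * F w + q)| <=
      (k * (A * (2 * m))) ^+ 2.
    rewrite e1; apply: (le_trans (sin_taylor1 _ _)).
    rewrite -(real_normK (num_real (k * N w))) lerXn2r ?nnegrE ?mulr_ge0//.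
    by rewrite normrM (ger0_norm k0) ler_wpM2l.
  have b2 : `|cos (k * F w + q) - cos (k * F2 w + q)| <= k * (6 * m * A).
    apply: (le_trans (norm_cosB _ _)).
    have -> : k * F w + q - (k * F2 w + q) = k * (N2 w - N w).
      have := splitU s m w; have := splitU s (m + m) w; rewrite -/N -/F -/N2 -/F2.
      move=> -> h; have -> : F w = N2 w + F2 w - N w by rewrite h; ring.
      ring.
    rewrite normrM (ger0_norm k0) ler_wpM2l// (le_trans (ler_normB _ _))//.
    have := NA w; have := N2A w; lra.
  have -> : G s w * sin (k * U w + q) - g1 w - k * g2 w = G s w *
      ((sin (k * U w + q) - sin (k * F w + q) - k * N w * cos (k * F w + q)) +
       k * N w * (cos (k * F w + q) - cos (k * F2 w + q))) by rewrite /g1 /g2; ring.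
  rewrite normrM.
  have -> : 16 * k ^+ 2 * m ^+ 2 * A ^+ 3 =
    A * ((k * (A * (2 * m))) ^+ 2 + k * (A * (2 * m)) * (k * (6 * m * A))) by ring.
  rewrite ler_pM// (le_trans (ler_normD _ _))// lerD// normrM ler_pM//.
  by rewrite normrM (ger0_norm k0) ler_wpM2l.
have E1 : \int[P]_w g1 w = 0 by exact: EG_far.
have E2 : \int[P]_w g2 w = (\int[P]_w (G s w * U w)) * \int[P]_w cos (k * F2 w + q).
  exact: EGnear_cos.
have EGU : `|\int[P]_w (G s w * U w)| <= A * (A * (2 * m)).
  rewrite -EGnear; apply: Rintegral_probability_bound; first exact: measurable_funM.
  by move=> w; rewrite normrM ler_pM.
have d1 : `|\int[P]_w (G s w * sin (k * U w + q)) -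
    k * ((\int[P]_w (G s w * U w)) * \int[P]_w cos (k * F2 w + q))| <=
    16 * k ^+ 2 * m ^+ 2 * A ^+ 3.
  rewrite -E2 -[X in `|X - _|]subr0 -E1 -RintegralB// -RintegralZl// -RintegralB//; last first.
    exact: (integrableB measurableT Ig0 Ig1).
  apply: Rintegral_probability_bound => //; apply: measurable_funB => //.
    exact: measurable_funB.
  exact: measurable_funM.
have d2 : `|(\int[P]_w cos (k * F2 w + q)) - \int[P]_w cos (k * U w + q)| <=
    k * (A * (2 * (m + m))).
  rewrite -RintegralB//; last 2 first.
  - by apply: (@integrable_bounded _ _ _ _ _ 1) => [|w]; [apply: mcosU; exact: mfar|exact: cos_max].
  - by apply: (@integrable_bounded _ _ _ _ _ 1) => [|w]; [exact: mcosU|exact: cos_max].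
  apply: Rintegral_probability_bound.
    by apply: measurable_funB; [apply: mcosU; exact: mfar|exact: mcosU].
  move=> w; apply: (le_trans (norm_cosB _ _)).
  have -> : k * F2 w + q - (k * U w + q) = - (k * N2 w).
    by rewrite (splitU s (m + m) w) -/N2 -/F2; ring.
  by rewrite normrN normrM (ger0_norm k0) ler_wpM2l.
(* The other 8 of the constant 24: restoring [U] in the cosine moves it by at most
   [k * (A * (4 m))], and the covariance of [G s] with [U] is at most [A * (A * (2 * m))]. *)
have d3 : `|k * ((\int[P]_w (G s w * U w)) * \int[P]_w cos (k * F2 w + q)) -
    k * (\int[P]_w (G s w * U w)) * \int[P]_w cos (k * U w + q)| <=
    8 * k ^+ 2 * m ^+ 2 * A ^+ 3.
  rewrite mulrA -mulrBr normrM normrM (ger0_norm k0).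
  have -> : 8 * k ^+ 2 * m ^+ 2 * A ^+ 3 = k * (A * (A * (2 * m))) * (k * (A * (2 * (m + m)))).
    ring.
  by rewrite ler_pM ?mulr_ge0// ler_wpM2l.
apply: (le_trans (le_trans (ler_distD _ _ _) (lerD d1 d3))).
rewrite le_eqVlt; apply/orP; left; apply/eqP; ring.
Qed.

(* Stein's method; kappa = eps^(-1/2), m = O(eps) make the bound O(eps^(1/2)). *)
Theorem m_dependent_clt (kappa q : R) : 0 <= kappa ->
  `|(\int[P]_w cos (kappa * U w + q)) -
    expR (- (kappa ^+ 2 * (\int[P]_w (U w ^+ 2)) / 2)) * cos q| <=
  24 * t * kappa ^+ 3 * m ^+ 2 * A ^+ 3.
Proof.
move=> ka0; pose Y w := kappa * U w.
have mUT : measurable_fun setT U := mU measurableT.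
have mY : measurable_fun setT Y by exact: measurable_funM.
have UA w : `|U w| <= A * t by exact: path_integral_le.
have YA w : `|Y w| <= kappa * (A * t) by rewrite normrM (ger0_norm ka0) ler_wpM2l.
have Y2 : P.-integrable setT (EFin \o (fun w => Y w ^+ 2)).
  apply: (@integrable_bounded _ _ _ _ _ ((kappa * (A * t)) ^+ 2)).
    exact: measurable_funX.
  by move=> w; rewrite normrX lerXn2r ?nnegrE ?mulr_ge0.
have IU2 : P.-integrable setT (EFin \o (fun w => U w ^+ 2)).
  apply: (@integrable_bounded _ _ _ _ _ ((A * t) ^+ 2)).
    exact: measurable_funX.
  by move=> w; rewrite normrX lerXn2r ?nnegrE ?mulr_ge0.
have v0 : 0 <= kappa ^+ 2 * \int[P]_w (U w ^+ 2).
  by rewrite mulr_ge0 ?sqr_ge0//; apply: Rintegral_ge0 => w _; exact: sqr_ge0.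
apply: (stein_cos_moment mY Y2 v0) => l /andP[l0 l1]; rewrite /cos_moment.
set c := \int[P]_w cos (l * Y w + q).
have cE : c = \int[P]_w cos ((l * kappa) * U w + q).
  by apply: eq_Rintegral => w _; rewrite /Y mulrA.
have sC w : `|sin (l * kappa * U w + q)| <= 1 by exact: sin_max.
pose g r := \int[P]_w (sin (l * kappa * U w + q) * G r w).
pose h r := \int[P]_w (U w * G r w).
have mg : measurable_fun setT g.
  apply: (measurable_Rintegral_snd P (f := fun p : R * T =>
    sin (l * kappa * U p.2 + q) * G p.1 p.2)).
  apply: measurable_funM => //.
  exact: (measurableT_comp (msinU _ _ measurableT) measurable_snd).
have mh : measurable_fun setT h.
  apply: (measurable_Rintegral_snd P (f := fun p : R * T => U p.2 * G p.1 p.2)).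
  by apply: measurable_funM => //; exact: (measurableT_comp mUT measurable_snd).
have gA r : `|g r| <= 1 * A.
  apply: Rintegral_probability_bound => [|w]; last by rewrite normrM ler_pM.
  by apply: measurable_funM => //; exact: msinU.
have hA r : `|h r| <= A * t * A.
  by apply: Rintegral_probability_bound => [|w];
    [exact: measurable_funM|rewrite normrM ler_pM].
have Ig : tau.-integrable setT (EFin \o g) := integrable_bounded tau mg gA.
have Ih : tau.-integrable setT (EFin \o h) := integrable_bounded tau mh hA.
have Eg : \int[P]_w (Y w * sin (l * Y w + q)) = kappa * \int[tau]_r g r.
  transitivity (\int[P]_w (kappa * (sin (l * kappa * U w + q) * U w))).
    by apply: eq_Rintegral => w _; rewrite /Y mulrA -mulrA [sin _ * _]mulrC.
  rewrite RintegralZl//; last first.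
    apply: (@integrable_bounded _ _ _ _ _ (1 * (A * t))) => [|w].
      by apply: measurable_funM => //; exact: msinU.
    by rewrite normrM ler_pM.
  rewrite (Fubini_path measurableT (msinU _ _ measurableT) sC).
  by congr (_ * _); apply: eq_Rintegral => r _; rewrite indicE in_setT mul1r.
have Eh : \int[P]_w (U w ^+ 2) = \int[tau]_r h r.
  under eq_Rintegral do rewrite expr2.
  rewrite (Fubini_path measurableT mUT UA).
  by apply: eq_Rintegral => r _; rewrite indicE in_setT mul1r.
(* [Y] is itself a time integral, so its Stein defect is the integral over [r] of the local defects
   bounded in [local_stein]; [l <= 1] then removes [l] from the bound. *)
have -> : (\int[P]_w (Y w * sin (l * Y w + q))) - l * (kappa ^+ 2 * \int[P]_w (U w ^+ 2)) * c =
    kappa * \int[tau]_r (g r - l * kappa * c * h r).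
  have Ih' : tau.-integrable setT (EFin \o (fun r => l * kappa * c * h r)).
    exact: (integrableZl measurableT _ Ih).
  rewrite RintegralB// RintegralZl// Eg Eh; ring.
rewrite normrM (ger0_norm ka0).
have lk0 : 0 <= l * kappa by rewrite mulr_ge0.
have -> : 24 * t * kappa ^+ 3 * m ^+ 2 * A ^+ 3 =
    kappa * (24 * kappa ^+ 2 * m ^+ 2 * A ^+ 3 * (t - 0)) by ring.
rewrite ler_wpM2l//; apply: Rintegral_itv_bound => // [|r].
  by apply: measurable_funB => //; exact: measurable_funM.
have := local_stein r q lk0.
rewrite -cE; have -> : \int[P]_w (G r w * sin (l * kappa * U w + q)) = g r.
  by apply: eq_Rintegral => w _; rewrite mulrC.
have -> : \int[P]_w (G r w * U w) = h r by apply: eq_Rintegral => w _; rewrite mulrC.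
have -> : l * kappa * h r * c = l * kappa * c * h r by rewrite mulrAC.
move=> /le_trans; apply.
rewrite !ler_wpM2r ?exprn_ge0// ler_wpM2l// lerXn2r ?nnegrE//.
by rewrite ler_piMl.
Qed.

End m_dependent_clt.

(** * The random medium *)

Section independent_product.
Context (R : realType) d (T : measurableType d) (P : probability T R).

(** The joint law agrees with the product of the laws on rectangles, hence on all measurable sets,
    and Fubini factorizes the integral. *)
Lemma independent_expectation (X Y : T -> R) (C D : R) :
  measurable_fun setT X -> measurable_fun setT Y ->
  (forall w, `|X w| <= C) -> (forall w, `|Y w| <= D) ->
  (forall A B : set R, measurable A -> measurable B ->
    P (X @^-1` A `&` Y @^-1` B) = (P (X @^-1` A) * P (Y @^-1` B))%E) ->
  \int[P]_w (X w * Y w) = (\int[P]_w X w) * \int[P]_w Y w.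
Proof.
move=> mX mY XC YD ind.
have C0 : 0 <= C by exact: le_trans (normr_ge0 _) (XC point).
have D0 : 0 <= D by exact: le_trans (normr_ge0 _) (YD point).
pose X' : {mfun T >-> R} := HB.pack X (isMeasurableFun.Build _ _ _ _ X mX).
pose Y' : {mfun T >-> R} := HB.pack Y (isMeasurableFun.Build _ _ _ _ Y mY).
have mXY : measurable_fun setT (fun w => (X' w, Y' w)).
  exact/measurable_fun_pairP.
pose XY : {mfun T >-> (R * R)%type} :=
  HB.pack (fun w => (X' w, Y' w)) (isMeasurableFun.Build _ _ _ _ _ mXY).
pose m1 := distribution P X'; pose m2 := distribution P Y'.
have mE A : measurable A -> (m1 \x m2)%E A = P ((fun w => (X w, Y w)) @^-1` A).
  move=> mA; apply: (@product_measure_unique _ _ _ _ _ m1 m2 (distribution P XY)) => //.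
have mc E : measurable_fun setT (clamp E : R -> R) by exact: measurable_clamp.
(* The product of coordinates is unbounded on the plane; the clamps make it bounded without changing
   it on the range of [(X, Y)]. *)
pose g (z : R * R) := clamp C z.1 * clamp D z.2.
have mg : measurable_fun setT g.
  by apply: measurable_funM; [exact: (measurableT_comp (mc C) measurable_fst)|
    exact: (measurableT_comp (mc D) measurable_snd)].
have gCD z : `|g z| <= C * D by rewrite normrM ler_pM// norm_clamp_le.
have <- : \int[(m1 \x m2)%E]_z g z = \int[P]_w (X w * Y w).
  rewrite (Rintegral_image (mu := P) mXY mE mg).
  by apply: eq_Rintegral => w _; rewrite /g/= !clamp_id.
rewrite -Rintegral12_prod; last exact: integrable_prod_bounded gCD.
have E1 : \int[m1]_x clamp C x = \int[P]_w X w.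
  rewrite (Rintegral_image (mu := P) (phi := X) mX)//.
  by apply: eq_Rintegral => w _; rewrite clamp_id.
have E2 : \int[m2]_x clamp D x = \int[P]_w Y w.
  rewrite (Rintegral_image (mu := P) (phi := Y) mY)//.
  by apply: eq_Rintegral => w _; rewrite clamp_id.
have I1 : m1.-integrable setT (EFin \o clamp C).
  by apply: integrable_bounded (mc C) (fun x => norm_clamp_le x C0).
have I2 : m2.-integrable setT (EFin \o clamp D).
  by apply: integrable_bounded (mc D) (fun x => norm_clamp_le x D0).
rewrite -E1 -E2 -RintegralZr//.
by apply: eq_Rintegral => x _; rewrite -RintegralZl.
Qed.

End independent_product.

(** Integrate [|X| <= e / 2 + X ^+ 2 / (2 * e)]. *)
Lemma expectation_le_sqr (R : realType) d (T : measurableType d)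
    (P : probability T R) (X : T -> R) (e : R) : 0 < e -> measurable_fun setT X ->
  P.-integrable setT (EFin \o (fun w => X w ^+ 2)) ->
  \int[P]_w (X w ^+ 2) <= e ^+ 2 -> \int[P]_w `|X w| <= e.
Proof.
move=> e0 mX X2 hX.
have IX := integrable_sqrW mX X2.
have J1 : P.-integrable setT (EFin \o cst (e / 2)).
  by apply: (@integrable_bounded _ _ _ _ _ `|e / 2|).
have J2 := integrableZl measurableT (2 * e)^-1 X2.
have I1 : P.-integrable setT (EFin \o (fun w => e / 2 + (2 * e)^-1 * X w ^+ 2)).
  exact: (integrableD measurableT J1 J2).
apply: (@le_trans _ _ (\int[P]_w (e / 2 + (2 * e)^-1 * X w ^+ 2))).
  apply: le_Rintegral => //; first exact: integrable_norm.
  move=> w _; rewrite -(real_normK (num_real (X w))).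
  set y := `|X w|; rewrite -(ler_pM2l (_ : 0 < 2 * e)) ?mulr_gt0//.
  have -> : 2 * e * (e / 2 + (2 * e)^-1 * y ^+ 2) = e ^+ 2 + y ^+ 2.
    by field; rewrite gt_eqF.
  by rewrite -subr_ge0 (_ : _ - _ = (e - y) ^+ 2) ?sqr_ge0//; ring.
have -> : \int[P]_w (e / 2 + (2 * e)^-1 * X w ^+ 2) = e / 2 + (2 * e)^-1 * \int[P]_w (X w ^+ 2).
  transitivity (\int[P]__ (e / 2) + \int[P]_w ((2 * e)^-1 * X w ^+ 2)).
    by apply: RintegralD.
  rewrite [X in _ + X = _]RintegralZl// [X in X + _ = _](_ : _ = e / 2)//.
  transitivity (e / 2 * fine (P setT)); last by rewrite probability_setT mulr1.
  exact: Rintegral_cst.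
have : (2 * e)^-1 * \int[P]_w (X w ^+ 2) <= (2 * e)^-1 * e ^+ 2.
  by rewrite ler_wpM2l// invr_ge0 mulr_ge0// ltW.
have -> : (2 * e)^-1 * e ^+ 2 = e / 2 by field; rewrite gt_eqF.
lra.
Qed.

Lemma Lnorm2_sqr (R : realType) d (T : measurableType d)
    (P : probability T R) (X : T -> R) :
  ('N[P]_2%:E[EFin \o X] `^ 2 = \int[P]_w (X w ^+ 2)%:E)%E.
Proof.
have n2 : (2 : R) != 0 by rewrite pnatr_eq0.
rewrite (poweR_Lnorm P (EFin \o X) n2); apply: eq_integral => w _.
change ((`|X w|%:E `^ 2)%E = (X w ^+ 2)%:E).
by rewrite poweR_EFin powR_mulrn// real_normK ?num_real.
Qed.

Lemma Lnorm2_le (R : realType) d (T : measurableType d)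
    (P : probability T R) (X : T -> R) (e : R) : 0 <= e -> measurable_fun setT X ->
  ('N[P]_2%:E[EFin \o X] <= e%:E)%E ->
  P.-integrable setT (EFin \o (fun w => X w ^+ 2)) /\ \int[P]_w (X w ^+ 2) <= e ^+ 2.
Proof.
move=> e0 mX h.
have h2 : (\int[P]_w (X w ^+ 2)%:E <= (e ^+ 2)%:E)%E.
  rewrite -Lnorm2_sqr.
  apply: (@le_trans _ _ (e%:E `^ 2)%E).
    by apply: gt0_ler_poweR => //; rewrite ?in_itv/= ?lee_fin ?Lnorm_ge0 ?leey ?e0.
  by rewrite poweR_EFin powR_mulrn.
have pos : (0 <= \int[P]_w (X w ^+ 2)%:E)%E.
  by apply: integral_ge0 => w _; rewrite lee_fin sqr_ge0.
split.
  apply/integrableP; split; first by apply/measurable_EFinP; exact: measurable_funX.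
  rewrite (eq_integral (fun w => (X w ^+ 2)%:E)).
    by apply: le_lt_trans h2 _; rewrite ltry.
  by move=> w _ /=; rewrite ger0_norm ?sqr_ge0.
rewrite -lee_fin /Rintegral fineK// ge0_fin_numE//.
by apply: le_lt_trans h2 _; rewrite ltry.
Qed.

Lemma Lfun2_bounded (R : realType) d (T : measurableType d)
    (P : probability T R) (X : T -> R) (C : R) : measurable_fun setT X ->
  (forall w, `|X w| <= C) -> X \in Lfun P 2%:E.
Proof.
move=> mX XC; rewrite inE; apply/andP; split; rewrite inE//=.
rewrite /finite_norm ltey; apply/negP => /eqP h.
have := Lnorm2_sqr P X; rewrite h poweRyr ?pnatr_eq0// => E.
have : P.-integrable setT (EFin \o (fun w => X w ^+ 2)).
  apply: (@integrable_bounded _ _ _ _ _ (C ^+ 2)); first exact: measurable_funX.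
  by move=> w; rewrite normrX lerXn2r// nnegrE// (le_trans (normr_ge0 _) (XC w)).
by move=> /integrable_fin_num/fin_numPlt; rewrite -E ltxx andbF => /(_ measurableT).
Qed.

Section measurable_rV_arithmetic.
Context (R : realType) (n : nat) d (T : measurableType d) (f g : T -> 'rV[R]_n).
Hypotheses (mf : measurable_fun setT f) (mg : measurable_fun setT g).

Lemma measurable_rVD : measurable_fun setT (fun x => f x + g x).
Proof.
apply: measurable_fun_rVP => i.
rewrite (_ : (fun _ => _) = fun x => f x 0 i + g x 0 i); last first.
  by apply/funext => x; rewrite mxE.
by apply: measurable_funD; exact: (measurableT_comp (measurable_rV_coord i)).
Qed.

Lemma measurable_rVB : measurable_fun setT (fun x => f x - g x).
Proof.
apply: measurable_fun_rVP => i.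
rewrite (_ : (fun _ => _) = fun x => f x 0 i - g x 0 i); last first.
  by apply/funext => x; rewrite !mxE.
by apply: measurable_funB; exact: (measurableT_comp (measurable_rV_coord i)).
Qed.

End measurable_rV_arithmetic.

Lemma cvg_weighted_sum (R : realType) (I T : Type) (F : set_system T) {FF : Filter F}
    (L : seq (R * I)) (g : T -> I -> R) (l : I -> R) :
  (forall i, g n i @[n --> F] --> l i) ->
  \sum_(ai <- L) ai.1 * g n ai.2 @[n --> F] --> \sum_(ai <- L) ai.1 * l ai.2.
Proof.
move=> gl; elim: L => [|ai L IH].
  by rewrite big_nil; under eq_fun do rewrite big_nil; exact: cvg_cst.
rewrite big_cons; under eq_fun do rewrite big_cons.
by apply: cvgD => //; exact: cvgMr.
Qed.

Section Rintegral_lincomb.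
Context (R : realType) d (T : measurableType d) (mu : {measure set T -> \bar R}).
Variables (I : Type) (f : I -> T -> R).
Hypothesis If : forall i, mu.-integrable setT (EFin \o f i).

Lemma integrable_lincomb (L : seq (R * I)) :
  mu.-integrable setT (EFin \o (fun x => \sum_(ai <- L) ai.1 * f ai.2 x)).
Proof.
elim: L => [|ai L IH].
  rewrite (_ : _ \o _ = cst 0%E); first exact: integrable0.
  by apply/funext => x /=; rewrite big_nil.
rewrite (_ : _ \o _ = (fun x => ai.1%:E * (f ai.2 x)%:E + (\sum_(ai <- L) ai.1 * f ai.2 x)%:E)%E).
  apply: integrableD => //; exact: (integrableZl measurableT ai.1 (If ai.2)).
by apply/funext => x /=; rewrite big_cons.
Qed.

Lemma Rintegral_lincomb (L : seq (R * I)) :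
  \int[mu]_x (\sum_(ai <- L) ai.1 * f ai.2 x) = \sum_(ai <- L) ai.1 * \int[mu]_x f ai.2 x.
Proof.
elim: L => [|ai L IH].
  rewrite big_nil; transitivity (\int[mu]__ (0 : R)); last by rewrite Rintegral_cst// mul0r.
  by apply: eq_Rintegral => x _; rewrite big_nil.
rewrite big_cons -IH -RintegralZl// -RintegralD//.
- by apply: eq_Rintegral => x _; rewrite big_cons.
- exact: (integrableZl measurableT ai.1 (If ai.2)).
- exact: integrable_lincomb.
Qed.

End Rintegral_lincomb.

Lemma itv_measure_setT (R : realType) (a b : R) : a <= b ->
  itv_measure a b setT = (b - a)%:E.
Proof.
move=> ab; rewrite /= /mfrestr /mrestr setTI /leb lebesgue_measure_itv/= lte_fin.
by case: ltgtP ab => // -> _; rewrite subrr.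
Qed.

Lemma integral_itv_measure_cst (R : realType) (a b c : R) : a <= b ->
  (\int[itv_measure a b]__ c%:E = (c * (b - a))%:E)%E.
Proof.
by move=> ab; rewrite integral_cst// [X in (_ * X)%E](itv_measure_setT ab) EFinM.
Qed.

(** The covariances below converge at interior times, where a small window around [s] fits into
    [[0, t]]; the endpoints are Lebesgue-null. *)
Lemma itv_measure_ae (R : realType) (a b : R) :
  {ae itv_measure a b, forall s, a < s < b}.
Proof.
exists (~` `]a, b[%classic); split; first exact: measurableC.
  apply/eqP; rewrite eq_le measure_ge0 andbT /= /mfrestr /mrestr.
  apply: (@le_trans _ _ (leb ([set a] `|` [set b]))).
    apply: le_measure; rewrite ?inE.
    - by apply: measurableI => //; exact: measurableC.
    - by apply: measurableU; exact: measurable_set1.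
    - move=> s [] /= ns; rewrite in_itv/= => /andP[as_ sb].
      move: as_ sb; rewrite !le_eqVlt => /predU1P[->|as_]; first by left.
      move=> /predU1P[->|sb]; first by right.
      by exfalso; apply: ns; rewrite in_itv/= as_.
  rewrite /leb; apply: (@le_trans _ _ (lebesgue_measure [set a] + lebesgue_measure [set b])%E).
    by apply: measureU2; exact: measurable_set1.
  by rewrite !lebesgue_measure_set1 adde0.
by move=> s /= h; contra: h; rewrite in_itv.
Qed.

Lemma path_integral_setT (R : realType) d (T : measurableType d) (G : R -> T -> R) t w :
  path_integral G t setT w = \int[itv_measure 0 t]_s G s w.
Proof. by apply: eq_Rintegral => s _; rewrite indicE in_setT mul1r. Qed.

Lemma path_integral_sqr (R : realType) d (T : measurableType d) (P : probability T R)
    (G : R -> T -> R) (A t : R) :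
  measurable_fun setT (fun p : R * T => G p.1 p.2) -> (forall s w, `|G s w| <= A) ->
  \int[P]_w (path_integral G t setT w ^+ 2) =
  \int[itv_measure 0 t]_s \int[itv_measure 0 t]_r \int[P]_w (G s w * G r w).
Proof.
move=> mG GA; set mu := itv_measure 0 t.
have mGs s : measurable_fun setT (G s) := measurableT_comp mG (measurable_pair1 s).
have mGw w : measurable_fun setT (G^~ w) := measurableT_comp mG (measurable_pair2 w).
pose U w := \int[mu]_s G s w.
have mU : measurable_fun setT U := measurable_Rintegral_fst mu mG.
have UA w : `|U w| <= A * fine (mu setT) by exact: Rintegral_bound.
have IG w : mu.-integrable setT (EFin \o G^~ w) by exact: integrable_bounded (mGw w) (fun s => GA s w).
transitivity (\int[P]_w \int[mu]_s (G s w * U w)).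
  by apply: eq_Rintegral => w _; rewrite path_integral_setT expr2 RintegralZr.
rewrite -(@Rintegral_Fubini_bounded _ _ _ _ _ mu P (fun p => G p.1 p.2 * U p.2)
  (A * (A * fine (mu setT)))); last 2 first.
- apply: measurable_funM => //; exact: (measurableT_comp mU measurable_snd).
- by move=> z; rewrite normrM ler_pM.
apply: eq_Rintegral => s _ /=.
transitivity (\int[P]_w \int[mu]_r (G s w * G r w)).
  by apply: eq_Rintegral => w _; rewrite RintegralZl.
rewrite -(@Rintegral_Fubini_bounded _ _ _ _ _ mu P (fun p => G s p.2 * G p.1 p.2) (A * A))//.
- apply: measurable_funM => //; exact: (measurableT_comp (mGs s) measurable_snd).
- by move=> z; rewrite normrM ler_pM.
Qed.

(** * Covariance of the field and its integrals along fixed paths *)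

Section medium.
Context (R : realType) (d : nat) (dO : measure_display) (Om : measurableType dO)
  (P : probability Om R) (tau : R * 'rV[R]_d -> Om -> Om) (VV : Om -> R) (C M : R).
Hypothesis medium : stationary_medium P tau VV.
Hypotheses (C0 : 0 <= C) (VVC : {ae P, forall w, `|VV w| <= C}).
Hypothesis M0 : 0 < M.
Hypothesis finite_range_M : forall S S' : set (R * 'rV[R]_d),
  (M%:E <= set_dist S S')%E ->
  independent_families P (field_sigma_algebra tau VV S) (field_sigma_algebra tau VV S').

Let act := medium_ergodic medium.

(* clamped because VV is bounded only almost surely *)
Definition bounded_field (z : R * 'rV[R]_d) (w : Om) : R := clamp C (VV (tau z w)).

Lemma measurable_medium : measurable_fun setT VV.
Proof.
have := measurableT_comp (medium_measurable medium) (measurable_pair1 (0 : R * 'rV[R]_d)).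
by apply: eq_measurable_fun => w _; rewrite /= /random_field (action0 act).
Qed.

Lemma measurable_bounded_field :
  measurable_fun setT (fun p : (R * 'rV[R]_d) * Om => bounded_field p.1 p.2).
Proof.
have := measurableT_comp (measurable_clamp C) (medium_measurable medium).
by apply: eq_measurable_fun => -[[s x] w].
Qed.

Lemma measurable_bounded_field1 z : measurable_fun setT (bounded_field z).
Proof. exact: (measurableT_comp measurable_bounded_field (measurable_pair1 z)). Qed.

Lemma bounded_field_le z w : `|bounded_field z w| <= C.
Proof. exact: norm_clamp_le. Qed.

(** The exceptional set is the preimage of one null set under [tau z], so it depends on [z]; along a
    path these sets are later exchanged by Fubini. *)
Lemma bounded_field_ae z : {ae P, forall w, VV (tau z w) = bounded_field z w}.
Proof.
case: VVC => N [mN N0 subN].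
exists (tau z @^-1` N); split.
- by rewrite -[X in measurable X]setTI; exact: (action_measurable act).
- by rewrite (action_preserving act).
- by move=> w /= h; apply: subN => /= h'; apply: h; rewrite /bounded_field clamp_id.
Qed.

Lemma stationarity (g : Om -> R) z : measurable_fun setT g ->
  \int[P]_w g (tau z w) = \int[P]_w g w.
Proof.
have h A : measurable A -> P A = P (tau z @^-1` A).
  by move=> mA; rewrite (action_preserving act).
move=> mg; exact/esym/(Rintegral_image (action_measurable act z) h mg).
Qed.

Lemma bounded_field_shift z z' w : bounded_field (z + z') w = bounded_field z (tau z' w).
Proof. by rewrite /bounded_field (actionD act). Qed.

Lemma bounded_field_centered z : \int[P]_w bounded_field z w = 0.
Proof.
have m0 := measurable_bounded_field1 0.
have -> : \int[P]_w bounded_field z w = \int[P]_w bounded_field 0 w.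
  rewrite -(stationarity z m0); apply: eq_Rintegral => w _.
  by rewrite -bounded_field_shift add0r.
have := medium_centered medium; rewrite unlock => h.
transitivity (\int[P]_w VV w); last by rewrite /Rintegral h.
apply: eq_Rintegral_ae => //; first exact: measurable_medium.
by have := bounded_field_ae 0; apply: filterS => w <-; rewrite (action0 act).
Qed.

Definition cov (z : R * 'rV[R]_d) : R := covariance_fun P tau VV z.1 z.2.

Lemma bounded_field_cov z z' :
  \int[P]_w (bounded_field z w * bounded_field z' w) = cov (z - z').
Proof.
transitivity (\int[P]_w (bounded_field (z - z') w * bounded_field 0 w)).
  rewrite -(@stationarity (fun w => bounded_field (z - z') w * bounded_field 0 w) z').
    by apply: eq_Rintegral => w _; rewrite -!bounded_field_shift subrK add0r.
  by apply: measurable_funM; exact: measurable_bounded_field1.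
rewrite /cov /covariance_fun unlock -[RHS]/(\int[P]_w _).
apply: eq_Rintegral_ae.
- by apply: measurable_funM; exact: measurable_bounded_field1.
- apply: measurable_funM.
    exact: (measurableT_comp (medium_measurable medium) (measurable_pair1 ((z - z').1, (z - z').2))).
  exact: (measurableT_comp (medium_measurable medium) (measurable_pair1 ((0, 0) : R * 'rV[R]_d))).
have := bounded_field_ae 0; have := bounded_field_ae (z - z').
apply: filterS2 => w h1 h2.
by rewrite -h1 -h2 /random_field -surjective_pairing.
Qed.

(** Separation in time alone gives Euclidean distance at least [M], whatever points of space are
    visited. *)
Lemma bounded_field_indep (S S' : set (R * 'rV[R]_d)) (X Y : Om -> R) (C1 C2 : R) :
  (forall z z', S z -> S' z' -> M <= `|z.1 - z'.1|) ->
  @measurable_fun _ _ (g_sigma_algebraType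
    (\bigcup_(z in S) g_sigma_algebra_preimage (random_field tau VV z.1 z.2))) R setT X ->
  @measurable_fun _ _ (g_sigma_algebraType
    (\bigcup_(z in S') g_sigma_algebra_preimage (random_field tau VV z.1 z.2))) R setT Y ->
  (forall w, `|X w| <= C1) -> (forall w, `|Y w| <= C2) ->
  \int[P]_w (X w * Y w) = (\int[P]_w X w) * \int[P]_w Y w.
Proof.
move=> sep mX mY XC YC.
have sub (Z : set (R * 'rV[R]_d)) (X' : Om -> R) : @measurable_fun _ _ (g_sigma_algebraType
    (\bigcup_(z in Z) g_sigma_algebra_preimage (random_field tau VV z.1 z.2))) R setT X' ->
    measurable_fun setT X'.
  move=> mX' _ A mA; have := mX' measurableT A mA.
  apply: smallest_sub; first exact: sigma_algebra_measurable.
  move=> _ [z Zz [B mB <-]]; rewrite setTI.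
  have := measurableT_comp (medium_measurable medium) (measurable_pair1 (z.1, z.2)).
  by move=> /(_ measurableT B mB); rewrite setTI.
apply: (independent_expectation (sub _ _ mX) (sub _ _ mY) XC YC) => A B mA mB.
apply: (@finite_range_M S S'); last 2 first.
- by have := mX measurableT A mA; rewrite setTI.
- by have := mY measurableT B mB; rewrite setTI.
apply: le_ereal_inf_tmp => _ [z Sz [z' Sz' <-]]; rewrite lee_fin.
apply: (le_trans (sep _ _ Sz Sz')); rewrite /euclidean_dist.
rewrite -sqrtr_sqr ler_wsqrtr// lerDl.
by apply: sumr_ge0 => i _; exact: sqr_ge0.
Qed.

Lemma cov_range z : M <= `|z.1| -> cov z = 0.
Proof.
move=> Mz; have := bounded_field_cov z 0; rewrite subr0 => <-.
have meas z' : @measurable_fun _ _ (g_sigma_algebraType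
    (\bigcup_(z in [set z']) g_sigma_algebra_preimage (random_field tau VV z.1 z.2))) R
    setT (bounded_field z').
  move=> _ A mA; apply: sub_sigma_algebra; exists z' => //.
  exists (clamp C @^-1` A); last by case: z'.
  by have := @measurable_clamp R C measurableT A mA; rewrite setTI.
rewrite (bounded_field_indep (S := [set z]) (S' := [set 0]) _ (meas z) (meas 0)
  (bounded_field_le z) (bounded_field_le 0)).
  by rewrite bounded_field_centered mul0r.
by move=> _ _ -> ->; rewrite subr0.
Qed.

Lemma cov_le z : `|cov z| <= C * C.
Proof.
have := bounded_field_cov z 0; rewrite subr0 => <-.
apply: Rintegral_probability_bound.
  by apply: measurable_funM; exact: measurable_bounded_field1.
by move=> w; rewrite normrM ler_pM ?bounded_field_le.
Qed.

Lemma measurable_cov : measurable_fun setT cov.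
Proof.
pose g (p : (R * 'rV[R]_d) * Om) := bounded_field p.1 p.2 * bounded_field 0 p.2.
have mg : measurable_fun setT g.
  apply: measurable_funM; first exact: measurable_bounded_field.
  exact: (measurableT_comp (measurable_bounded_field1 0) measurable_snd).
have := measurable_Rintegral_snd P mg.
by apply: eq_measurable_fun => z _; rewrite bounded_field_cov subr0.
Qed.

Definition close (delta : R) (z z' : R * 'rV[R]_d) :=
  `|z.1 - z'.1| < delta /\ forall i, `|z.2 0 i - z'.2 0 i| < delta.

(** Strong continuity at [0], for the bounded variable [bounded_field 0], gives a modulus in [L^2];
    stationarity transports it to all pairs, so that [delta] depends on [e] alone. *)
Lemma bounded_field_continuous e : 0 < e -> exists2 delta, 0 < delta &
  forall z z', close delta z z' ->
  \int[P]_w `|bounded_field z w - bounded_field z' w| <= e.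
Proof.
move=> e0; pose g w := bounded_field 0 w.
have gL2 : g \in Lfun P 2%:E.
  exact: (Lfun2_bounded P (measurable_bounded_field1 0) (bounded_field_le 0)).
have := medium_continuous medium gL2 0.
move=> /fine_cvgP[hfin /cvgr_dist_le/(_ e e0) hle].
have [delta /= d0 hd] : nbhs_ball (0 : R * 'rV[R]_d)
    (fun z => 'N[P]_2%:E[(fun w => (g (tau z w) - g (tau 0 w))%:E)] <= e%:E)%E.
  apply/nbhs_ballP; near=> z.
  have zfin : 'N[P]_2%:E[(fun w => (g (tau z w) - g (tau 0 w))%:E)]%E \is a fin_num.
    by near: z.
  rewrite -(fineK zfin) lee_fin.
  have : `|0 - fine 'N[P]_2%:E[(fun w => (g (tau z w) - g (tau 0 w))%:E)]%E| <= e.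
    by near: z.
  by rewrite sub0r normrN; apply: le_trans; exact: ler_norm.
exists delta => // z z' [zz1 zz2].
have /hd : ball (0 : R * 'rV[R]_d) delta (z - z').
  split => /=; first by rewrite /ball/= sub0r normrN.
  by split=> // i j; rewrite /ball/= !mxE sub0r normrN ord1.
have E w : g (tau (z - z') w) - g (tau 0 w) = bounded_field (z - z') w - bounded_field 0 w.
  by rewrite /g -!bounded_field_shift !add0r.
have mB : measurable_fun setT (fun w => bounded_field (z - z') w - bounded_field 0 w).
  by apply: measurable_funB; exact: measurable_bounded_field1.
rewrite (_ : (fun w => _) = EFin \o (fun w => bounded_field (z - z') w - bounded_field 0 w)); last first.
  by apply/funext => w; rewrite E.
move=> /(Lnorm2_le (ltW e0) mB)[I2 h2].
apply: le_trans (expectation_le_sqr e0 mB I2 h2).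
rewrite -(@stationarity (fun w => `|bounded_field (z - z') w - bounded_field 0 w|) z').
  rewrite le_eqVlt; apply/orP; left; apply/eqP/eq_Rintegral => w _.
  by rewrite -!bounded_field_shift subrK add0r.
exact: measurableT_comp.
Unshelve. all: by end_near. Qed.

Lemma cov_continuous e : 0 < e -> exists2 delta, 0 < delta &
  forall z z', close delta z z' -> `|cov z - cov z'| <= e.
Proof.
move=> e0; have e'0 : 0 < e / (C + 1) by rewrite divr_gt0// ltr_wpDl.
have [delta d0 hd] := bounded_field_continuous e'0; exists delta => // z z' /hd h.
have E z1 : cov z1 = \int[P]_w (bounded_field z1 w * bounded_field 0 w).
  by rewrite bounded_field_cov subr0.
have I z1 : P.-integrable setT (EFin \o (fun w => bounded_field z1 w * bounded_field 0 w)).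
  apply: (@integrable_bounded _ _ _ _ _ (C * C)).
    by apply: measurable_funM; exact: measurable_bounded_field1.
  by move=> w; rewrite normrM ler_pM ?bounded_field_le.
have mB : measurable_fun setT (fun w => bounded_field z w - bounded_field z' w).
  by apply: measurable_funB; exact: measurable_bounded_field1.
have IB : P.-integrable setT (EFin \o (fun w => `|bounded_field z w - bounded_field z' w|)).
  apply: (@integrable_bounded _ _ _ _ _ (C + C)); first exact: measurableT_comp.
  by move=> w; rewrite normr_id (le_trans (ler_normB _ _))// lerD ?bounded_field_le.
rewrite !E -RintegralB//.
apply: (le_trans (le_normr_Rintegral _ (integrableB measurableT (I z) (I z')))) => //.
apply: (@le_trans _ _ (\int[P]_w (C * `|bounded_field z w - bounded_field z' w|))).
  apply: le_Rintegral => //.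
  - exact: (integrable_norm (integrableB measurableT (I z) (I z'))).
  - exact: (integrableZl measurableT C IB).
  - by move=> w _; rewrite -mulrBl normrM mulrC ler_wpM2r// bounded_field_le.
rewrite RintegralZl// (le_trans (ler_wpM2l C0 h))// mulrCA; apply: ler_piMr; first exact: ltW.
by rewrite ler_pdivrMr ?ltr_wpDl// mul1r lerDl.
Qed.

Let K := space_covariance P tau VV.

Lemma continuous_cov1 y : continuous (fun v => cov (v, y)).
Proof.
move=> v; apply/cvgrPdist_le => e e0.
have [delta d0 hd] := cov_continuous e0.
near=> v'; apply: hd; split => /=; last by move=> i; rewrite subrr normr0.
by near: v'; apply: cvgr_dist_lt.
Unshelve. all: by end_near. Qed.

Lemma space_covariance_itv a b y : a <= - M -> M <= b ->
  K y = \int[lebesgue_measure]_(v in `[a, b]) cov (v, y).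
Proof.
move=> aM Mb; rewrite Rintegral_mkcond; apply: eq_Rintegral => v _.
rewrite patchE; case: ifPn => // /negP h; rewrite -[LHS]/(cov (v, y)) cov_range//=.
rewrite leNgt; apply/negP => vM; apply: h; rewrite inE/= in_itv/=.
move: vM; rewrite ltr_norml => /andP[h1 h2].
by rewrite (le_trans aM (ltW h1)) (le_trans (ltW h2) Mb).
Qed.

Let measurable_cov_swap : measurable_fun setT (fun p : R * 'rV[R]_d => cov (p.1, p.2)).
Proof. by apply: eq_measurable_fun measurable_cov => -[]. Qed.

Let measurable_cov1 y : measurable_fun setT (fun v => cov (v, y)).
Proof. exact: (measurableT_comp measurable_cov_swap (measurable_pair2 y)). Qed.

Lemma space_covarianceE y : K y = \int[itv_measure (- M) M]_v cov (v, y).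
Proof. by rewrite Rintegral_itv_measure// -space_covariance_itv. Qed.

Let MM : - M <= M. Proof. by rewrite ge0_cp ?ltW. Qed.

Lemma measurable_space_covariance : measurable_fun setT K.
Proof.
rewrite (funext space_covarianceE).
exact: (measurable_Rintegral_fst _ measurable_cov_swap).
Qed.

Lemma space_covariance_le y : `|K y| <= C * C * (2 * M).
Proof.
rewrite space_covarianceE (_ : 2 * M = M - - M); last by ring.
by apply: Rintegral_itv_bound => // v; exact: cov_le.
Qed.

Lemma space_covariance_continuous e : 0 < e -> exists2 delta, 0 < delta &
  forall y y' : 'rV[R]_d, (forall i, `|y 0 i - y' 0 i| < delta) -> `|K y - K y'| <= e.
Proof.
move=> e0; have e'0 : 0 < e / (2 * M) by rewrite divr_gt0// mulr_gt0.
have [delta d0 hd] := cov_continuous e'0; exists delta => // y y' yy'.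
have I y1 : (itv_measure (- M) M).-integrable setT (EFin \o (fun v => cov (v, y1))).
  by apply: integrable_bounded (measurable_cov1 y1) (fun v => cov_le (v, y1)).
rewrite !space_covarianceE -RintegralB//.
have -> : e = e / (2 * M) * (M - - M) by field; rewrite gt_eqF.
apply: Rintegral_itv_bound => //; first exact: measurable_funB.
by move=> v; apply: hd; split => //=; rewrite subrr normr0.
Qed.

(** The substitution [v = (r - s) / eps] maps [[0, t]] onto an interval containing [[- M, M]],
    outside of which the covariance vanishes. The value is therefore exact and not merely
    asymptotic. *)
Lemma scaled_cov_integral eps s t y : 0 < eps -> M * eps <= s -> s + M * eps <= t ->
  eps^-1 * \int[itv_measure 0 t]_r cov ((r - s) / eps, y) = K y.
Proof.
move=> eps0 s0 st; pose F (r : R) := (r - s) / eps.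
have t0 : 0 <= t.
  by apply: le_trans st; rewrite addr_ge0 ?(le_trans _ s0)// mulr_ge0// ltW.
have F't (r : R) : is_derive r 1 F eps^-1.
  rewrite (_ : F = (fun r => - (eps^-1 * s) + eps^-1 * r)).
    have h := is_deriveD (is_derive_cst (- (eps^-1 * s)) r (1 : R))
      (is_deriveZ eps^-1 (is_derive_id r (1 : R))).
    by apply: (is_derive_eq h); rewrite add0r /GRing.scale/= mulr1.
  by apply/funext => r'; rewrite /F; ring.
have F'E : derive1 F = cst eps^-1.
  by apply/funext => r; rewrite derive1E; have [] := F't r.
have cF : continuous F.
  by move=> r; apply/differentiable_continuous/derivable1_diffP; have [] := F't r.
have mF : measurable_fun setT F by exact: continuous_measurable_fun.
rewrite (@space_covariance_itv (F 0) (F t)).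
- rewrite /Rintegral (@integration_by_substitution_increasing _ F (fun v => cov (v, y)) 0 t)//.
  + have mFc : measurable_fun setT (fun r => cov (F r, y)).
      exact: (measurableT_comp (measurable_cov1 y) mF).
    rewrite -RintegralZl//; last first.
      by apply: integrable_bounded mFc (fun r => cov_le (F r, y)).
    rewrite Rintegral_itv_measure; last exact: measurable_funM.
    congr fine; apply: eq_integral => r _ /=.
    by rewrite fctE F'E /= mulrC.
  + by move=> r r' _ _ rr'; rewrite /F ltr_pM2r ?invr_gt0// ltrD2r.
  + by rewrite F'E => ? _; exact: cst_continuous.
  + by rewrite F'E; exact: is_cvg_cst.
  + by rewrite F'E; exact: is_cvg_cst.
  + split.
    * by move=> r _; have [] := F't r.
    * by apply: cvg_at_right_filter; exact: cF.
    * by apply: cvg_at_left_filter; exact: cF.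
  + by apply: continuous_subspaceT; exact: continuous_cov1.
- rewrite /F ler_pdivrMr//; lra.
- rewrite /F ler_pdivlMr//; lra.
Qed.

Variables (I : Type) (beta : I -> R -> 'rV[R]_d).
Hypothesis beta_continuous : forall i, continuous (beta i).

Let beta_close i s e : 0 < e -> exists2 rho, 0 < rho & forall r, `|r - s| < rho ->
  forall j, `|beta i s 0 j - beta i r 0 j| < e.
Proof.
move=> e0; have /cvg_ballP/(_ e e0) := @beta_continuous i s.
move=> /nbhs_ballP[rho /= rho0 h]; exists rho => // r rs j.
have := h r; rewrite /ball/= distrC => /(_ rs)[_ /(_ 0 j)].
by rewrite /ball/=.
Qed.

Let measurable_beta i : measurable_fun setT (beta i).
Proof.
apply: measurable_fun_rVP => j; apply: continuous_measurable_fun => s.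
apply/cvgrPdist_lt => e e0; have [rho rho0 h] := beta_close i s e0.
by near=> r; apply: h; near: r; apply: cvgr_distC_lt.
Unshelve. all: by end_near. Qed.

(** Only the window [|r - s| < M * eps] contributes, and there [beta k] barely moves: freezing it at
    time [s] gives exactly [K] by [scaled_cov_integral]. *)
Lemma local_cov_cvg (e_ : nat -> R) t s i k : (forall n, 0 < e_ n) ->
  e_ n @[n --> \oo] --> 0 -> 0 < s < t ->
  (e_ n)^-1 * (\int[itv_measure 0 t]_r cov ((r - s) / e_ n, beta i s - beta k r))
    @[n --> \oo] --> K (beta i s - beta k s).
Proof.
move=> e_0 e_cvg /andP[s0 st]; apply/cvgrPdist_le => eta eta0.
(* The window has length [2 * M * eps], and the integral is multiplied by [1 / eps]. *)
have eta'0 : 0 < eta / (2 * M) by rewrite divr_gt0// mulr_gt0.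
have [delta d0 hd] := cov_continuous eta'0.
have [rho rho0 hrho] := beta_close k s d0.
near=> n.
have eps0 : 0 < e_ n by exact: e_0.
have epsrho : e_ n < rho / M by near: n; apply: (cvgr_lt 0) => //; rewrite divr_gt0.
have epss : e_ n < s / M by near: n; apply: (cvgr_lt 0) => //; rewrite divr_gt0.
have epst : e_ n < (t - s) / M by near: n; apply: (cvgr_lt 0) => //; rewrite divr_gt0// subr_gt0.
move: eps0 epsrho epss epst; set eps := e_ n => eps0; rewrite !ltr_pdivlMr// ![eps * M]mulrC => epsrho epss epst.
rewrite -(@scaled_cov_integral eps s t)//; [|exact: ltW|by rewrite -lerBrDl ltW].
have mF (y' : R -> 'rV[R]_d) : measurable_fun setT y' ->
    measurable_fun setT (fun r : R => cov ((r - s) / eps, y' r)).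
  move=> my'; apply: (measurableT_comp measurable_cov).
  apply/measurable_fun_pairP; split => //=.
  by apply: measurable_funM => //; exact: measurable_funB.
have mF1 := mF (cst (beta i s - beta k s)) (measurable_cst _).
have mF2 : measurable_fun setT (fun r : R => cov ((r - s) / eps, beta i s - beta k r)).
  by apply: mF; apply: measurable_rVB.
rewrite -mulrBr normrM gtr0_norm ?invr_gt0// ler_pdivrMl//.
rewrite -RintegralB//; last 2 first.
- exact: integrable_bounded mF1 (fun r => cov_le _).
- exact: integrable_bounded mF2 (fun r => cov_le _).
pose g r := cov ((r - s) / eps, beta i s - beta k s) -
  cov ((r - s) / eps, beta i s - beta k r).
have g0 r : ~~ (`|r - s| < M * eps) -> g r = 0.
  rewrite -leNgt => h; rewrite /g !cov_range ?subrr//=;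
  by rewrite normrM [X in _ * X]gtr0_norm ?invr_gt0// ler_pdivlMr.
have -> : \int[itv_measure 0 t]_r (cov ((r - s) / eps, beta i s - beta k s) -
    cov ((r - s) / eps, beta i s - beta k r)) =
  \int[itv_measure 0 t]_r (\1_[set r | `|r - s| < M * eps] r * g r).
  apply: eq_Rintegral => r _; rewrite indicE.
  have [h|h] := boolP (r \in _); first by rewrite mul1r.
  by rewrite mul0r -/(g r) g0//; apply: contra h => h; rewrite inE.
have -> : eps * eta = eta / (2 * M) * (2 * (M * eps)) by field; rewrite gt_eqF.
apply: Rintegral_itv_near_bound.
- exact: ltW.
- by rewrite mulr_ge0// ltW.
- exact: measurable_funB.
move=> r; have [h|/g0 ->] := boolP (`|r - s| < M * eps); last by rewrite normr0 ltW.
apply: hd; split => /=; first by rewrite subrr normr0.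
move=> j.
have -> : (beta i s - beta k s) 0 j - (beta i s - beta k r) 0 j = - (beta k s 0 j - beta k r 0 j).
  by rewrite !mxE; ring.
by rewrite normrN; exact: (hrho r (lt_trans h epsrho) j).
Unshelve. all: by end_near. Qed.

Variables (t : R) (x : 'rV[R]_d).
Hypothesis t0 : 0 <= t.

Definition field_along (eps : R) (L : seq (R * I)) (s : R) (w : Om) : R :=
  \sum_(ai <- L) ai.1 * bounded_field ((t - s) / eps, x + beta ai.2 s) w.

Definition path_variance (L : seq (R * I)) : R :=
  \int[itv_measure 0 t]_s \sum_(ai <- L) ai.1 *
    \sum_(ck <- L) ck.1 * K (beta ai.2 s - beta ck.2 s).

Let measurable_point eps i : measurable_fun setT
  (fun s : R => ((t - s) / eps, x + beta i s)).
Proof.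
apply/measurable_fun_pairP; split => /=.
  by apply: measurable_funM => //; exact: measurable_funB.
exact: measurable_rVD.
Qed.

Lemma measurable_field_point eps i : measurable_fun setT
  (fun p : R * Om => bounded_field ((t - p.1) / eps, x + beta i p.1) p.2).
Proof.
pose z (p : R * Om) := (((t - p.1) / eps, x + beta i p.1), p.2).
have mz : measurable_fun setT z; last exact: (measurableT_comp measurable_bounded_field mz).
apply/measurable_fun_pairP; split; last exact: measurable_snd.
exact: (measurableT_comp (measurable_point eps i) measurable_fst).
Qed.

Lemma measurable_field_along eps L :
  measurable_fun setT (fun p : R * Om => field_along eps L p.1 p.2).
Proof.
apply: measurable_sum => ai; apply: measurable_funM => //.
exact: measurable_field_point.
Qed.

Let weight (L : seq (R * I)) := \sum_(ai <- L) `|ai.1|.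

Let weight0 L : 0 <= weight L. Proof. exact: sumr_ge0. Qed.

Lemma lincomb_le (L : seq (R * I)) (g : I -> R) (D : R) : (forall i, `|g i| <= D) ->
  `|\sum_(ai <- L) ai.1 * g ai.2| <= weight L * D.
Proof.
move=> gD; apply: (le_trans (ler_norm_sum _ _ _)); rewrite mulr_suml.
by apply: ler_sum => ai _; rewrite normrM ler_wpM2l.
Qed.

Lemma field_along_le eps L s w : `|field_along eps L s w| <= weight L * C.
Proof. 
apply: (@lincomb_le L (fun i => bounded_field ((t - s) / eps, x + beta i s) w)) => i.
exact: bounded_field_le. Qed.

Let If z : P.-integrable setT (EFin \o bounded_field z).
Proof. exact: integrable_bounded (measurable_bounded_field1 z) (bounded_field_le z). Qed.

Lemma field_along_centered eps L s : \int[P]_w field_along eps L s w = 0.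
Proof.
rewrite (Rintegral_lincomb (f := fun i => bounded_field ((t - s) / eps, x + beta i s)))//.
by rewrite big1// => ai _; rewrite bounded_field_centered mulr0.
Qed.

Lemma field_along_cov eps L s r : \int[P]_w (field_along eps L s w * field_along eps L r w) =
  \sum_(ai <- L) ai.1 * \sum_(ck <- L) ck.1 * cov ((r - s) / eps, beta ai.2 s - beta ck.2 r).
Proof.
have Ib z z' : P.-integrable setT (EFin \o (fun w => bounded_field z w * bounded_field z' w)).
  apply: (@integrable_bounded _ _ _ _ _ (C * C)).
    by apply: measurable_funM; exact: measurable_bounded_field1.
  by move=> w; rewrite normrM ler_pM ?bounded_field_le.
pose z i u := ((t - u) / eps, x + beta i u).
transitivity (\int[P]_w (\sum_(ai <- L) ai.1 *
    (fun i w => \sum_(ck <- L) ck.1 * (bounded_field (z i s) w * bounded_field (z ck.2 r) w)) ai.2 w)).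
  apply: eq_Rintegral => w _; rewrite /field_along mulr_suml; apply: eq_bigr => ai _.
  rewrite -mulrA mulr_sumr; congr (_ * _); apply: eq_bigr => ck _.
  by rewrite mulrCA.
rewrite (Rintegral_lincomb (f := fun i w => \sum_(ck <- L) ck.1 * (bounded_field (z i s) w * bounded_field (z ck.2 r) w))); last first.
  by move=> i; exact: (integrable_lincomb (f := fun k w => bounded_field (z i s) w * bounded_field (z k r) w)).
apply: eq_bigr => ai _; congr (_ * _).
rewrite (Rintegral_lincomb (f := fun k w => bounded_field (z ai.2 s) w * bounded_field (z k r) w))//.
apply: eq_bigr => ck _; rewrite bounded_field_cov; congr (_ * cov (_, _)).
  by rewrite /z/=; ring.
by rewrite /z/= opprD addrACA subrr add0r.
Qed.

Let measurable_past (S : set (R * 'rV[R]_d)) z : S z ->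
  @measurable_fun _ _ (g_sigma_algebraType
    (\bigcup_(z in S) g_sigma_algebra_preimage (random_field tau VV z.1 z.2))) R
    setT (bounded_field z).
Proof.
move=> Sz _ A mA; apply: sub_sigma_algebra; exists z => //.
exists (clamp C @^-1` A); last by case: (z).
by have := @measurable_clamp R C measurableT A mA; rewrite setTI.
Qed.

(** Times that are [M * eps] apart along the paths are [M] apart in the medium. *)
Lemma field_along_indep eps L l1 l2 : 0 < eps ->
  (forall s r, s \in l1 -> r \in l2 -> M * eps <= `|s - r|) ->
  \int[P]_w (field_prod (field_along eps L) l1 w * field_prod (field_along eps L) l2 w) =
  (\int[P]_w field_prod (field_along eps L) l1 w) * \int[P]_w field_prod (field_along eps L) l2 w.
Proof.
move=> eps0 sep.
pose S (l : seq R) := [set z | exists2 s, s \in l & exists i, z = ((t - s) / eps, x + beta i s)].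
have mS l : @measurable_fun _ _ (g_sigma_algebraType
    (\bigcup_(z in S l) g_sigma_algebra_preimage (random_field tau VV z.1 z.2))) R
    setT (field_prod (field_along eps L) l).
  apply: measurable_prod => s sl; apply: measurable_sum => ai.
  apply: measurable_funM => //; apply: measurable_past => //.
  by exists s => //; exists ai.2.
apply: (bounded_field_indep (S := S l1) (S' := S l2)) => //.
- move=> z z' [s sl1 [i ->]] [r rl2 [k ->]] /=.
  rewrite -mulrBl opprB addrACA [- s + _]addrC addrACA subrr add0r addrC.
  by rewrite normrM [X in _ * X]gtr0_norm ?invr_gt0// ler_pdivlMr// addrC distrC sep.
- by move=> w; apply: field_prod_le; exact: field_along_le.
- by move=> w; apply: field_prod_le; exact: field_along_le.
Qed.

(** The window of length [2 * M * eps] compensates the factor [1 / eps], so each inner integral is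
    bounded by [C * C * (2 * M)] uniformly in [eps] and [s]; dominated convergence in [s] does the
    rest. *)
Lemma variance_cvg (e_ : nat -> R) L : (forall n, 0 < e_ n) ->
  e_ n @[n --> \oo] --> 0 ->
  (e_ n)^-1 * (\int[P]_w (path_integral (field_along (e_ n) L) t setT w ^+ 2)) @[n --> \oo]
  --> path_variance L.
Proof.
move=> e_0 e_cvg.
have mcov (i k : I) eps : measurable_fun setT
    (fun p : R * R => cov ((p.2 - p.1) / eps, beta i p.1 - beta k p.2)).
  pose z (p : R * R) := ((p.2 - p.1) / eps, beta i p.1 - beta k p.2).
  have mz : measurable_fun setT z; last exact: (measurableT_comp measurable_cov mz).
  apply/measurable_fun_pairP; split => /=.
    by apply: measurable_funM => //; exact: measurable_funB.
  apply: measurable_rVB.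
    exact: (measurableT_comp (measurable_beta i) measurable_fst).
  exact: (measurableT_comp (measurable_beta k) measurable_snd).
have mcov1 i k eps s : measurable_fun setT
    (fun r : R => cov ((r - s) / eps, beta i s - beta k r)).
  exact: (measurableT_comp (mcov i k eps) (measurable_pair1 s)).
pose h eps i k s := eps^-1 * \int[itv_measure 0 t]_r cov ((r - s) / eps, beta i s - beta k r).
have mh eps i k : measurable_fun setT (h eps i k).
  apply: measurable_funM => //.
  exact: (measurable_Rintegral_snd (itv_measure 0 t) (mcov i k eps)).
have hle eps i k s : 0 < eps -> `|h eps i k s| <= C * C * (2 * M).
  move=> eps0; rewrite normrM gtr0_norm ?invr_gt0// ler_pdivrMl//.
  have -> : eps * (C * C * (2 * M)) = C * C * (2 * (M * eps)) by ring.
  rewrite (@eq_Rintegral _ _ _ _ setT (fun r : R => \1_[set r | `|r - s| < M * eps] r *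
    cov ((r - s) / eps, beta i s - beta k r))); last first.
    move=> r _; rewrite indicE.
    have [hr|hr] := boolP (r \in _); first by rewrite mul1r.
    rewrite mul0r cov_range//= normrM [X in _ * X]gtr0_norm ?invr_gt0// ler_pdivlMr//.
    by rewrite leNgt; apply: contra hr => hr; rewrite inE.
  apply: Rintegral_itv_near_bound => //.
  - by rewrite mulr_ge0.
  - by rewrite mulr_ge0// ltW.
  - by move=> r; exact: cov_le.
pose H n s := \sum_(ai <- L) ai.1 * \sum_(ck <- L) ck.1 * h (e_ n) ai.2 ck.2 s.
have mH n : measurable_fun setT (H n).
  apply: measurable_sum => ai; apply: measurable_funM => //.
  by apply: measurable_sum => ck; exact: measurable_funM.
have HC n s : `|H n s| <= weight L * (weight L * (C * C * (2 * M))).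
  apply: (@lincomb_le L (fun i => \sum_(ck <- L) ck.1 * h (e_ n) i ck.2 s)) => i.
  by apply: (@lincomb_le L (fun k => h (e_ n) i k s)) => k; exact: hle.
have Icov i k eps s : (itv_measure 0 t).-integrable setT
    (EFin \o (fun r : R => cov ((r - s) / eps, beta i s - beta k r))).
  by apply: (@integrable_bounded _ _ _ _ _ (C * C)) => // r; exact: cov_le.
have HE n : (e_ n)^-1 * (\int[P]_w (path_integral (field_along (e_ n) L) t setT w ^+ 2)) =
    \int[itv_measure 0 t]_s H n s.
  rewrite (path_integral_sqr P t (measurable_field_along (e_ n) L) (field_along_le (e_ n) L)).
  have e_neq0 : e_ n != 0 by rewrite gt_eqF.
  rewrite (@eq_Rintegral _ _ _ _ setT (fun s => e_ n * H n s)); last first.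
    move=> s _; rewrite (@eq_Rintegral _ _ _ _ setT (fun r : R => \sum_(ai <- L) ai.1 *
      \sum_(ck <- L) ck.1 * cov ((r - s) / e_ n, beta ai.2 s - beta ck.2 r))); last first.
      by move=> r _; exact: field_along_cov.
    rewrite (Rintegral_lincomb (f := fun i (r : R) => \sum_(ck <- L)
      ck.1 * cov ((r - s) / e_ n, beta i s - beta ck.2 r))); last first.
      move=> i; exact: (integrable_lincomb
        (f := fun k (r : R) => cov ((r - s) / e_ n, beta i s - beta k r))).
    rewrite mulr_sumr; apply: eq_bigr => ai _; rewrite mulrCA; congr (_ * _).
    rewrite (Rintegral_lincomb (f := fun k (r : R) => cov ((r - s) / e_ n, beta ai.2 s - beta k r)))//.
    rewrite mulr_sumr; apply: eq_bigr => ck _; rewrite mulrCA; congr (_ * _).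
    by rewrite /h mulVKf.
  rewrite RintegralZl ?mulKf//; exact: integrable_bounded (mH n) (HC n).
rewrite (funext HE).
apply: (@Rintegral_dominated _ _ _ _ _ _ (weight L * (weight L * (C * C * (2 * M))))).
- exact: mH.
- apply: measurable_sum => ai; apply: measurable_funM => //.
  apply: measurable_sum => ck; apply: measurable_funM => //.
  pose y (s : R) := beta ai.2 s - beta ck.2 s.
  have my : measurable_fun setT y; last exact: (measurableT_comp measurable_space_covariance my).
  exact: measurable_rVB.
- exact: HC.
- apply: filterS (itv_measure_ae 0 t) => s st.
  apply: (cvg_weighted_sum (g := fun n i => \sum_(ck <- L) ck.1 * h (e_ n) i ck.2 s)
    (l := fun i => \sum_(ck <- L) ck.1 * K (beta i s - beta ck.2 s))) => i.
  apply: (cvg_weighted_sum (g := fun n k => h (e_ n) i k s)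
    (l := fun k => K (beta i s - beta k s))) => k.
  exact: local_cov_cvg.
Qed.

Lemma field_along_cos_cvg (e_ : nat -> R) L q : (forall n, 0 < e_ n) ->
  e_ n @[n --> \oo] --> 0 ->
  \int[P]_w cos ((Num.sqrt (e_ n))^-1 * path_integral (field_along (e_ n) L) t setT w + q)
    @[n --> \oo] --> expR (- (path_variance L / 2)) * cos q.
Proof.
move=> e_0 e_cvg; set v := path_variance L.
pose k n := (Num.sqrt (e_ n))^-1; pose A := weight L * C.
have k2 n : k n ^+ 2 = (e_ n)^-1 by rewrite exprVn sqr_sqrtr// ltW.
pose v_ n := k n ^+ 2 * \int[P]_w (path_integral (field_along (e_ n) L) t setT w ^+ 2).
have v_cvg : v_ n @[n --> \oo] --> v.
  by rewrite /v_; under eq_fun do rewrite k2; exact: variance_cvg.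
have A0 : 0 <= A by rewrite mulr_ge0.
have cltn n : `|(\int[P]_w cos (k n * path_integral (field_along (e_ n) L) t setT w + q)) -
    expR (- (v_ n / 2)) * cos q| <= 24 * t * M ^+ 2 * A ^+ 3 * Num.sqrt (e_ n).
  have -> : 24 * t * M ^+ 2 * A ^+ 3 * Num.sqrt (e_ n) =
      24 * t * k n ^+ 3 * (M * e_ n) ^+ 2 * A ^+ 3.
    have se : e_ n = Num.sqrt (e_ n) ^+ 2 by rewrite sqr_sqrtr// ltW.
    have s0 : Num.sqrt (e_ n) != 0 by rewrite gt_eqF// sqrtr_gt0.
    by rewrite /k {3}se; field.
  apply: m_dependent_clt => //.
  - by rewrite mulr_ge0// ltW.
  - exact: measurable_field_along.
  - exact: field_along_le.
  - exact: field_along_centered.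
  - by move=> l1 l2; exact: field_along_indep.
  - by rewrite invr_ge0 sqrtr_ge0.
apply/cvgrPdist_le => eta eta0.
have c1 : expR (- (v_ n / 2)) * cos q @[n --> \oo] --> expR (- (v / 2)) * cos q.
  apply: cvgMl; apply: continuous_cvg; first exact: continuous_expR.
  by apply: cvgN; exact: cvgMl.
have c2 : 24 * t * M ^+ 2 * A ^+ 3 * Num.sqrt (e_ n) @[n --> \oo] --> 24 * t * M ^+ 2 * A ^+ 3 * Num.sqrt 0.
  by apply: cvgMr; apply: continuous_cvg => //; exact: sqrt_continuous.
rewrite sqrtr0 mulr0 in c2.
near=> n.
have h1 : `|expR (- (v / 2)) * cos q - expR (- (v_ n / 2)) * cos q| <= eta / 2.
  by near: n; apply: cvgr_dist_le => //; rewrite divr_gt0.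
have h2 : 24 * t * M ^+ 2 * A ^+ 3 * Num.sqrt (e_ n) <= eta / 2.
  by near: n; apply: (cvgr_le 0) => //; rewrite divr_gt0.
rewrite (splitr eta); apply: le_trans (ler_distD _ _ _) (lerD h1 _).
by rewrite distrC; exact: le_trans (cltn n) h2.
Unshelve. all: by end_near. Qed.

Definition field_phase (eps : R) (i : I) (w : Om) : R :=
  (Num.sqrt eps)^-1 *
  \int[itv_measure 0 t]_s bounded_field ((t - s) / eps, x + beta i s) w.

Theorem medium_cos_cvg (e_ : nat -> R) (L : seq (R * I)) q : (forall n, 0 < e_ n) ->
  e_ n @[n --> \oo] --> 0 ->
  \int[P]_w cos (\sum_(ai <- L) ai.1 * field_phase (e_ n) ai.2 w + q)
    @[n --> \oo] --> expR (- (path_variance L / 2)) * cos q.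
Proof.
move=> e_0 e_cvg; have := field_along_cos_cvg (L := L) (q := q) e_0 e_cvg.
apply: cvg_trans; apply: near_eq_cvg; apply: nearW => n /=.
apply: eq_Rintegral => w _; congr (cos (_ + q)).
rewrite path_integral_setT /field_along.
rewrite (Rintegral_lincomb (f := fun i (s : R) => bounded_field ((t - s) / e_ n, x + beta i s) w)).
  by rewrite mulr_sumr; apply: eq_bigr => ai _; rewrite mulrCA.
move=> i; apply: integrable_bounded => [|s]; last exact: bounded_field_le.
exact: (measurableT_comp (measurable_field_point (e_ n) i) (measurable_pair2 w)).
Qed.
End medium.

(** * The mollified noise along a path *)

Section lebesgue_rV_integral.
Context (R : realType).
Notation leb_R := (@lebesgue_measure R).

Lemma ge0_integral_lebesgue_subr (G : R -> R) (a : R) : continuous G ->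
  (forall u, 0 <= G u) ->
  (\int[leb_R]_y (G (y - a))%:E = \int[leb_R]_u (G u)%:E)%E.
Proof.
move=> cG G0; pose F (y : R) := y - a.
have FE : derive1 F = cst 1.
  apply/funext => y; rewrite derive1E.
  have h := is_deriveB (is_derive_id y (1 : R)) (is_derive_cst a y (1 : R)).
  by have [_ ->] := h; rewrite subr0.
rewrite [RHS](@increasing_ge0_integration_by_substitutionT _ F G)//.
- by apply: eq_integral => y _; rewrite FE fctE /= mulr1.
- by move=> y z yz; rewrite /F ltrD2r.
- by rewrite FE => ?; exact: cvg_cst.
- by rewrite FE; exact: is_cvg_cst.
- by rewrite FE; exact: is_cvg_cst.
- exact: cvg_addrr_Ny.
- exact: cvg_addrr.
Qed.

(** Induction along the recursive construction of [lebesgue_rV], splitting off one coordinate by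
    Tonelli. It serves to compute the mass and the second moments of the Gaussian mollifier. *)
Lemma integral_lebesgue_rV_prod n (g : 'I_n -> R -> R) (c : 'I_n -> R) :
  (forall i, measurable_fun setT (g i)) -> (forall i u, 0 <= g i u) ->
  (forall i, \int[leb_R]_u (g i u)%:E = (c i)%:E)%E ->
  (\int[lebesgue_rV R n]_y (\prod_(i < n) g i (y 0 i))%:E = (\prod_(i < n) c i)%:E)%E.
Proof.
elim: n g c => [|n IH] g c mg g0 gc /=.
  rewrite (eq_integral (fun=> 1%:E)) => [|y _]; last by rewrite big_ord0.
  by rewrite integral_dirac// diracT mul1e big_ord0.
have mf m (h : 'I_m -> R -> R) : (forall i, measurable_fun setT (h i)) ->
    measurable_fun setT (fun y : 'rV[R]_m => \prod_(i < m) h i (y 0 i)).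
  move=> mh; apply: measurable_prod => i _.
  exact: (measurableT_comp (mh i) (measurable_rV_coord i)).
have pos m (h : 'I_m -> R -> R) (y : 'rV[R]_m) : (forall i u, 0 <= h i u) ->
    0 <= \prod_(i < m) h i (y 0 i).
  by move=> h0; exact: prodr_ge0.
rewrite (@ge0_integral_image _ _ _ _ _ (@lebesgue_measure R \x lebesgue_rV R n)%E
  (rV_lift_measure (lebesgue_rV R n)) _ (@measurable_rV_cons R n))//; last 2 first.
- by apply/measurable_EFinP; exact: mf.
- by move=> y; rewrite lee_fin pos.
rewrite fubini_tonelli1; last 2 first.
- apply/measurable_EFinP; exact: (measurableT_comp (mf _ _ mg) (@measurable_rV_cons R n)).
- by move=> p; rewrite lee_fin pos.
transitivity (\int[leb_R]_u ((\prod_(i < n) c (lift ord0 i))%:E * (g ord0 u)%:E))%E.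
  apply: eq_integral => u _; rewrite /fubini_F (eq_integral (fun y : 'rV[R]_n =>
      (g ord0 u)%:E * (\prod_(i < n) g (lift ord0 i) (y 0 i))%:E)%E); last first.
    move=> y _; rewrite big_ord_recl EFinM /rV_cons !mxE unlift_none /=.
    congr (_ * _%:E)%E; apply: eq_bigr => i _; by rewrite mxE liftK.
  rewrite ge0_integralZl//; last 3 first.
  - by apply/measurable_EFinP; exact: (mf n (fun i => g (lift ord0 i))).
  - by move=> y _; rewrite lee_fin (pos n (fun i => g (lift ord0 i))).
  - by rewrite lee_fin.
  by rewrite (IH (fun i => g (lift ord0 i)) (fun i => c (lift ord0 i)))// muleC.
rewrite ge0_integralZl//; last 3 first.
- by apply/measurable_EFinP; exact: (mg ord0).
- by move=> y _; rewrite lee_fin.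
- rewrite lee_fin; apply: prodr_ge0 => i _; rewrite -lee_fin -gc.
  by apply: integral_ge0 => u _; rewrite lee_fin.
by rewrite gc -EFinM big_ord_recl mulrC.
Qed.

Lemma normal_pdf_even (s u : R) : 0 < s -> normal_pdf 0 s (- u) = normal_pdf 0 s u.
Proof. by move=> s0; rewrite !normal_pdfE ?gt_eqF// /normal_fun !subr0 sqrrN. Qed.

Variables (d : nat) (delta : R).
Hypothesis delta0 : 0 < delta.
Let s := Num.sqrt delta.
Let s0 : 0 < s. Proof. by rewrite sqrtr_gt0. Qed.

Lemma space_mollifier_ge0 (y : 'rV[R]_d) : 0 <= space_mollifier delta y.
Proof. by apply: prodr_ge0 => i _; exact: normal_pdf_ge0. Qed.

Lemma measurable_space_mollifier : measurable_fun setT (space_mollifier delta : 'rV[R]_d -> R).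
Proof.
apply: measurable_prod => i _.
exact: (measurableT_comp (measurable_normal_pdf _ _) (measurable_rV_coord i)).
Qed.

Lemma space_mollifier_le (y : 'rV[R]_d) : space_mollifier delta y <= normal_peak s ^+ d.
Proof.
rewrite /space_mollifier -[X in _ ^+ X]card_ord -prodr_const.
by apply: ler_prod => i _; rewrite normal_pdf_ge0/= normal_pdf_ub// gt_eqF.
Qed.

Let pdf_subr a u : normal_pdf 0 s (a - u) = normal_pdf 0 s (u - a).
Proof. by rewrite -opprB normal_pdf_even. Qed.

Let measurable_pdf_subr a : measurable_fun setT (fun u : R => normal_pdf 0 s (a - u)).
Proof. by apply: (measurableT_comp (measurable_normal_pdf 0 s)); exact: measurable_funB. Qed.

Let integral_pdf_subr a : (\int[leb_R]_u (normal_pdf 0 s (a - u))%:E = 1%:E)%E.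
Proof.
under eq_integral do rewrite pdf_subr.
rewrite (ge0_integral_lebesgue_subr (G := normal_pdf 0 s)) ?integral_normal_pdf//.
  by apply: continuous_normal_pdf; rewrite gt_eqF.
by move=> u; exact: normal_pdf_ge0.
Qed.

Let integral_sqr_pdf_subr a :
  (\int[leb_R]_u ((a - u) ^+ 2 * normal_pdf 0 s (a - u))%:E = delta%:E)%E.
Proof.
under eq_integral do rewrite pdf_subr -opprB sqrrN.
rewrite (ge0_integral_lebesgue_subr (G := fun u => u ^+ 2 * normal_pdf 0 s u)).
- have I := integrable_sqr_normal_pdf s0.
  rewrite -[LHS]fineK ?integrable_fin_num//; congr EFin.
  by rewrite -[LHS]/(\int[leb_R]_u _) Rintegral_sqr_normal_pdf// sqr_sqrtr// ltW.
- move=> u; apply: cvgM; first exact: sqr_continuous.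
  by apply: continuous_normal_pdf; rewrite gt_eqF.
- by move=> u; rewrite mulr_ge0 ?sqr_ge0 ?normal_pdf_ge0.
Qed.

(** The mollifier is a product, so the translation by [a] is undone one coordinate at a time, by
    evenness and translation invariance on the line. *)
Lemma integral_space_mollifier (a : 'rV[R]_d) :
  (\int[lebesgue_rV R d]_y (space_mollifier delta (a - y))%:E = 1%:E)%E.
Proof.
rewrite (eq_integral (fun y : 'rV[R]_d => (\prod_(i < d) normal_pdf 0 s (a 0 i - y 0 i))%:E)).
  rewrite (integral_lebesgue_rV_prod (g := fun i u => normal_pdf 0 s (a 0 i - u))
    (c := fun=> 1)) ?big1//.
  by move=> i u; exact: normal_pdf_ge0.
by move=> y _; congr EFin; apply: eq_bigr => i _; rewrite !mxE.
Qed.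

Lemma integral_sqr_space_mollifier (a : 'rV[R]_d) i :
  (\int[lebesgue_rV R d]_y ((a 0 i - y 0 i) ^+ 2 * space_mollifier delta (a - y))%:E
   = delta%:E)%E.
Proof.
pose g (j : 'I_d) (u : R) := (if j == i then (a 0 j - u) ^+ 2 else 1) * normal_pdf 0 s (a 0 j - u).
rewrite (eq_integral (fun y : 'rV[R]_d => (\prod_(j < d) g j (y 0 j))%:E)).
  rewrite (integral_lebesgue_rV_prod (c := fun j => if j == i then delta else 1)).
  - by rewrite -big_mkcond big_pred1_eq.
  - move=> j; apply: measurable_funM => //.
    by case: (j == i) => //; apply: measurable_funX; exact: measurable_funB.
  - by move=> j u; rewrite mulr_ge0 ?normal_pdf_ge0//; case: ifP => _; rewrite ?sqr_ge0.
  - move=> j; rewrite /g; case: ifP => _; first exact: integral_sqr_pdf_subr.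
    by under eq_integral do rewrite mul1r; exact: integral_pdf_subr.
move=> y _; congr EFin; rewrite /g big_split/= -big_mkcond big_pred1_eq.
by congr (_ * _); apply: eq_bigr => j _; rewrite !mxE.
Qed.

End lebesgue_rV_integral.

Section product_sigma_finite.
Context (R : realType) d1 d2 (T1 : measurableType d1) (T2 : measurableType d2).
Variables (m1 : {sigma_finite_measure set T1 -> \bar R})
  (m2 : {sigma_finite_measure set T2 -> \bar R}).

Let product_sigma_finite : sigma_finite setT (m1 \x m2)%E.
Proof.
have /sigma_finiteP[F [FT ndF Foo]] := sigma_finiteT m1.
have /sigma_finiteP[G [GT ndG Goo]] := sigma_finiteT m2.
exists (fun k => F k `*` G k).
  apply/seteqP; split=> // -[x y] _.
  have [i _ Fi] : (\bigcup_k F k) x by rewrite -FT.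
  have [j _ Gj] : (\bigcup_k G k) y by rewrite -GT.
  exists (maxn i j) => //; split.
    by move: Fi; exact/subsetPset/ndF/leq_maxl.
  by move: Gj; exact/subsetPset/ndG/leq_maxr.
move=> k; have [mF Fk] := Foo k; have [mG Gk] := Goo k; split; first exact: measurableX.
by rewrite product_measure1E// lte_mul_pinfty// ge0_fin_numE.
Qed.

(** The sigma-finite structure allows Fubini to exchange a time integral with the double space
    integral of the covariance. *)
Definition product_sigma_finite_measure :
    {sigma_finite_measure set (T1 * T2)%type -> \bar R} :=
  HB.pack (m1 \x m2)%E (Measure.on (m1 \x m2)%E) (Measure_isSigmaFinite.Build _ _ _ (m1 \x m2)%E product_sigma_finite).
End product_sigma_finite.

(** * Fubini for the noise covariance *)

Section noise_covariance_Fubini.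
Context (R : realType) (d : nat).
Variables (K : 'rV[R]_d -> R) (D : R).
Hypotheses (mK : measurable_fun setT K) (KD : forall y, `|K y| <= D).
Notation lam := (lebesgue_rV R d).

Let D0 : 0 <= D. Proof. exact: le_trans (normr_ge0 _) (KD 0). Qed.

Let measurable_K_diff : measurable_fun setT (fun yz : 'rV[R]_d * 'rV[R]_d => K (yz.1 - yz.2)).
Proof. exact: (measurableT_comp mK (measurable_rVB measurable_fst measurable_snd)). Qed.

Let lam2 := product_sigma_finite_measure lam lam.

Definition space_pairing (a b : 'rV[R]_d -> R) : R :=
  \int[(lam \x lam)%E]_yz (a yz.1 * b yz.2 * K (yz.1 - yz.2)).

Section pairing.
Variables (a b : 'rV[R]_d -> R) (A B : R).
Hypotheses (ma : measurable_fun setT a) (mb : measurable_fun setT b).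
Hypotheses (a0 : forall y, 0 <= a y) (b0 : forall y, 0 <= b y).
Hypotheses (aA : (\int[lam]_y (a y)%:E <= A%:E)%E) (bB : (\int[lam]_y (b y)%:E <= B%:E)%E).

Let mab : measurable_fun setT (fun yz : 'rV[R]_d * 'rV[R]_d => a yz.1 * b yz.2).
Proof.
by apply: measurable_funM; [exact: (measurableT_comp ma measurable_fst)|
  exact: (measurableT_comp mb measurable_snd)].
Qed.

Lemma integral_tensor : (\int[(lam \x lam)%E]_yz (a yz.1 * b yz.2)%:E =
  (\int[lam]_y (a y)%:E) * \int[lam]_z (b z)%:E)%E.
Proof.
rewrite fubini_tonelli1; last 2 first.
- exact/measurable_EFinP.
- by move=> yz; rewrite lee_fin mulr_ge0.
rewrite /fubini_F -ge0_integralZr//; last 3 first.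
- exact/measurable_EFinP.
- by move=> y _; rewrite lee_fin.
- by apply: integral_ge0 => z _; rewrite lee_fin.
apply: eq_integral => y _; rewrite -ge0_integralZl//.
- exact/measurable_EFinP.
- by move=> z _; rewrite lee_fin.
- by rewrite lee_fin.
Qed.

Let tensor_le : (\int[(lam \x lam)%E]_yz (a yz.1 * b yz.2)%:E <= (A * B)%:E)%E.
Proof.
rewrite integral_tensor EFinM lee_pmul//.
- by apply: integral_ge0 => y _; rewrite lee_fin.
- by apply: integral_ge0 => y _; rewrite lee_fin.
Qed.

Lemma integrable_tensor :
  (lam \x lam)%E.-integrable setT (EFin \o (fun yz => a yz.1 * b yz.2)).
Proof.
apply/integrableP; split; first exact/measurable_EFinP.
apply: le_lt_trans (ltry (A * B)); apply: le_trans tensor_le.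
rewrite le_eqVlt; apply/orP; left; apply/eqP/eq_integral => yz _ /=.
by rewrite ger0_norm// mulr_ge0.
Qed.

Lemma integrable_pairing : (lam \x lam)%E.-integrable setT
  (EFin \o (fun yz => a yz.1 * b yz.2 * K (yz.1 - yz.2))).
Proof.
have I := integrableZl measurableT D integrable_tensor.
apply: le_integrable I => //.
  by apply/measurable_EFinP; exact: measurable_funM.
move=> yz _ /=; rewrite lee_fin normrM [leRHS]normrM (ger0_norm D0) mulrC.
by rewrite ler_wpM2r.
Qed.

Lemma integral_norm_pairing : (\int[(lam \x lam)%E]_yz
  `|a yz.1 * b yz.2 * K (yz.1 - yz.2)|%:E <= (D * (A * B))%:E)%E.
Proof.
apply: (@le_trans _ _ (\int[(lam \x lam)%E]_yz (D%:E * (a yz.1 * b yz.2)%:E))%E).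
  apply: ge0_le_integral => //.
  - by apply/measurable_EFinP/measurableT_comp => //; exact: measurable_funM.
  - by apply/measurable_EFinP; exact: measurable_funM.
  - move=> yz _; rewrite lee_fin normrM mulrC (ger0_norm (mulr_ge0 _ _))//.
    by rewrite ler_wpM2r ?mulr_ge0.
rewrite ge0_integralZl//.
- by rewrite EFinM lee_wpmul2l ?lee_fin.
- exact/measurable_EFinP.
- by move=> yz _; rewrite lee_fin mulr_ge0.
Qed.

Lemma space_pairing_le : `|space_pairing a b| <= D * (A * B).
Proof.
rewrite (le_trans (le_normr_Rintegral measurableT integrable_pairing))//.
apply: (@le_trans _ _ (\int[(lam \x lam)%E]_yz (D * (a yz.1 * b yz.2)))).
  apply: le_Rintegral => //.
  - exact: integrable_norm integrable_pairing.
  - exact: (integrableZl measurableT D integrable_tensor).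
  - move=> yz _; rewrite normrM mulrC (ger0_norm (mulr_ge0 _ _))// ler_wpM2r ?mulr_ge0//.
rewrite RintegralZl//; last exact: integrable_tensor.
rewrite ler_wpM2l// -lee_fin /Rintegral fineK//.
exact: integrable_fin_num integrable_tensor.
Qed.

End pairing.

(** A class of tests on which all covariance integrals converge absolutely: it contains the
    mollifiers, and averaging over a parameter preserves it up to the constant
    ([time_average_kernel]). *)
Record time_kernel (G T : R) (g : R * 'rV[R]_d -> R) : Prop := TimeKernel {
  kernel_measurable : measurable_fun setT g ;
  kernel_ge0 : forall z, 0 <= g z ;
  kernel_integral : forall r, (\int[lam]_y (g (r, y))%:E <= G%:E)%E ;
  kernel_support : forall r y, ~~ (0 <= r <= T) -> g (r, y) = 0 }.

Lemma kernel_section G T g r : time_kernel G T g -> measurable_fun setT (fun y => g (r, y)).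
Proof. by move=> [mg _ _ _]; exact: (measurableT_comp mg (measurable_pair1 r)). Qed.

Lemma kernel_bound_ge0 G T g : time_kernel G T g -> 0 <= G.
Proof.
move=> [_ g0 gG _]; rewrite -lee_fin; apply: le_trans (gG 0).
by apply: integral_ge0 => y _; rewrite lee_fin.
Qed.

Lemma Rintegral_supported (F : R -> R) (T : R) : measurable_fun setT F ->
  (forall r, ~~ (0 <= r <= T) -> F r = 0) ->
  \int[lebesgue_measure]_r F r = \int[itv_measure 0 T]_r F r.
Proof.
move=> mF F0; rewrite Rintegral_itv_measure// [RHS]Rintegral_mkcond.
apply: eq_Rintegral => r _; rewrite patchE; case: ifPn => // h.
by apply: F0; apply: contra h => h; rewrite inE/= in_itv.
Qed.

Lemma time_kernel_test G T g : time_kernel G T g -> noise_test g.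
Proof.
move=> kg; have G0 := kernel_bound_ge0 kg; case: kg => mg g0 gG gT; split => //.
pose f r := (\int[lam]_y `|g (r, y)|%:E)%E.
have fE r : f r = (\int[lam]_y (g (r, y))%:E)%E.
  by apply: eq_integral => y _; rewrite ger0_norm.
have f0 r : (0 <= f r)%E by apply: integral_ge0 => y _; rewrite lee_fin.
have mf : measurable_fun setT f.
  rewrite (_ : f = fubini_F lam (EFin \o g)); last by apply/funext => r; rewrite fE.
  apply: measurable_fun_fubini_tonelli_F; first exact/measurable_EFinP.
  by move=> z; rewrite lee_fin.
apply: (@le_lt_trans _ _ (\int[lebesgue_measure]_r ((G ^+ 2)%:E * (\1_`[0%R, T] r)%:E))%E).
  apply: ge0_le_integral => //.
  - by move=> r _; exact: sqre_ge0.
  - by under eq_fun do rewrite expe2; exact: emeasurable_funM.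
  - by apply/measurable_EFinP; exact: measurable_funM.
  move=> r _; rewrite indicE expe2 -/(f r); have [h|h] := boolP (r \in _).
    by rewrite mule1 expr2 EFinM lee_pmul// fE.
  rewrite mule0 (_ : f r = 0%E) ?mule0// fE (eq_integral (cst 0%E)) ?integral0// => y _.
  by rewrite gT//; apply: contra h => h; rewrite inE/= in_itv.
rewrite ge0_integralZl//.
rewrite integral_indic// setIT lte_mul_pinfty ?lee_fin ?sqr_ge0//.
rewrite [X in (X < _)%E]lebesgue_measure_itv/=; by case: ifPn => // _; rewrite ltry.
by apply/measurable_EFinP.
by rewrite lee_fin sqr_ge0.
Qed.

Let measurable_pairing_integrand dS (S : measurableType dS) (u v : S -> R)
    (y z : S -> 'rV[R]_d) :
  measurable_fun setT u -> measurable_fun setT v ->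
  measurable_fun setT y -> measurable_fun setT z ->
  measurable_fun setT (fun p => u p * v p * K (y p - z p)).
Proof.
move=> mu mv my mz; apply: measurable_funM; first exact: measurable_funM.
exact: (measurableT_comp mK (measurable_rVB my mz)).
Qed.

Lemma measurable_space_pairing dS (S : measurableType dS) (u v : S * 'rV[R]_d -> R) :
  measurable_fun setT u -> measurable_fun setT v ->
  measurable_fun setT (fun p => space_pairing (fun y => u (p, y)) (fun z => v (p, z))).
Proof.
move=> mu mv.
pose F (p : S * ('rV[R]_d * 'rV[R]_d)) :=
  u (p.1, p.2.1) * v (p.1, p.2.2) * K (p.2.1 - p.2.2).
have mF : measurable_fun setT F.
  pose S' : measurableType _ := (S * ('rV[R]_d * 'rV[R]_d))%type.
  have m1 : measurable_fun setT (fun p : S' => p.2.1).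
    exact: (measurableT_comp measurable_fst measurable_snd).
  have m2 : measurable_fun setT (fun p : S' => p.2.2).
    exact: (measurableT_comp measurable_snd measurable_snd).
  apply: measurable_pairing_integrand => //.
    exact: (measurableT_comp mu (measurable_fun_pair measurable_fst m1)).
  exact: (measurableT_comp mv (measurable_fun_pair measurable_fst m2)).
exact: (measurable_Rintegral_snd lam2 mF).
Qed.

Lemma noise_covariance_le G G' T g h : 0 <= T -> time_kernel G T g ->
  time_kernel G' T h -> `|noise_covariance K g h| <= D * (G * G') * T.
Proof.
move=> T0 kg kh.
have kle r : `|space_pairing (fun y => g (r, y)) (fun z => h (r, z))| <= D * (G * G').
  exact: (space_pairing_le (kernel_section r kg) (kernel_section r kh)
    (fun y => kernel_ge0 kg (r, y)) (fun z => kernel_ge0 kh (r, z))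
    (kernel_integral kg r) (kernel_integral kh r)).
have mF := measurable_space_pairing (kernel_measurable kg) (kernel_measurable kh).
have -> : noise_covariance K g h =
    \int[itv_measure 0 T]_r space_pairing (fun y => g (r, y)) (fun z => h (r, z)).
  apply: Rintegral_supported => // r hr.
  transitivity (\int[(lam \x lam)%E]__ (0 : R)); last by rewrite Rintegral_cst// mul0r.
  by apply: eq_Rintegral => yz _; rewrite (kernel_support kg)// !mul0r.
by rewrite -[X in _ * X]subr0; apply: Rintegral_itv_bound.
Qed.

Section time_average.
Variables (t T G B : R) (psi : R -> R * 'rV[R]_d -> R).
Hypothesis t0 : 0 <= t.
Hypothesis mpsi : measurable_fun setT (fun p : R * (R * 'rV[R]_d) => psi p.1 p.2).
Hypothesis psi_kernel : forall s, time_kernel G T (psi s).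
Hypothesis psiB : forall s z, psi s z <= B.
Notation mu := (itv_measure 0 t).

(** The single test function whose noise turns out to be the time integral of the noises of the
    [psi s]; see [noise_average_eq]. *)
Definition time_average (z : R * 'rV[R]_d) : R := \int[mu]_s psi s z.

Let psi0 s z : 0 <= psi s z. Proof. exact: kernel_ge0 (psi_kernel s) z. Qed.

Let norm_psi s z : `|psi s z| <= B. Proof. by rewrite ger0_norm. Qed.

Let mpsi_s z : measurable_fun setT (psi^~ z).
Proof. exact: (measurableT_comp mpsi (measurable_pair2 z)). Qed.

Let Ipsi z : mu.-integrable setT (EFin \o psi^~ z).
Proof. by apply: integrable_bounded (mpsi_s z) _ => s; exact: norm_psi. Qed.

Lemma time_average_kernel : time_kernel (G * t) T time_average.
Proof.
split.
- exact: (measurable_Rintegral_fst mu mpsi).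
- by move=> z; apply: Rintegral_ge0.
- move=> r.
  rewrite (eq_integral (fun y => \int[mu]_s (psi s (r, y))%:E)%E); last first.
    by move=> y _; rewrite /time_average /Rintegral fineK//; exact: integrable_fin_num (Ipsi _).
  have m3 : measurable_fun setT (fun p : R * 'rV[R]_d => psi p.1 (r, p.2)).
    have m1 : measurable_fun setT (fun p : R * 'rV[R]_d => (p.1, (r, p.2))).
      exact: (measurable_fun_pair measurable_fst
        (measurable_fun_pair (measurable_cst r) measurable_snd)).
    exact: (measurableT_comp mpsi m1).
  rewrite -(@fubini_tonelli _ _ _ _ _ mu lam (fun p => (psi p.1 (r, p.2))%:E)); last 2 first.
  + exact/measurable_EFinP.
  + by move=> p; rewrite lee_fin.
  apply: (@le_trans _ _ (\int[mu]_s G%:E)%E).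
    apply: ge0_le_integral => //.
    * by move=> s _; apply: integral_ge0 => y _; rewrite lee_fin.
    * apply: (@measurable_fun_fubini_tonelli_F _ _ _ _ _ lam (fun p => (psi p.1 (r, p.2))%:E)).
        exact/measurable_EFinP.
      by move=> p; rewrite lee_fin.
    * by move=> s _; exact: kernel_integral (psi_kernel s) r.
  by rewrite integral_itv_measure_cst// subr0.
- move=> r y h; transitivity (\int[mu]__ (0 : R)); last by rewrite Rintegral_cst// mul0r.
  by apply: eq_Rintegral => s _; rewrite (kernel_support (psi_kernel s)).
Qed.

Lemma space_pairing_time_average G' g r : time_kernel G' T g ->
  space_pairing (fun y => g (r, y)) (fun z => time_average (r, z)) =
  \int[mu]_s space_pairing (fun y => g (r, y)) (fun z => psi s (r, z)).
Proof.
move=> kg.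
pose F (p : R * ('rV[R]_d * 'rV[R]_d)) :=
  g (r, p.2.1) * psi p.1 (r, p.2.2) * K (p.2.1 - p.2.2).
have mF : measurable_fun setT F.
  pose S : measurableType _ := (R * ('rV[R]_d * 'rV[R]_d))%type.
  have m1 : measurable_fun setT (fun p : S => p.2.1).
    exact: (measurableT_comp measurable_fst measurable_snd).
  have m2 : measurable_fun setT (fun p : S => p.2.2).
    exact: (measurableT_comp measurable_snd measurable_snd).
  apply: measurable_pairing_integrand => //.
    exact: (measurableT_comp (kernel_section r kg) m1).
  exact: (measurableT_comp mpsi (measurable_fun_pair measurable_fst
    (measurable_fun_pair (measurable_cst r) m2))).
transitivity (\int[(lam \x lam)%E]_yz \int[mu]_s F (s, yz)).
  apply: eq_Rintegral => yz _; rewrite /F /=.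
  transitivity (\int[mu]_s (g (r, yz.1) * K (yz.1 - yz.2) * psi s (r, yz.2))).
    by rewrite RintegralZl// mulrAC.
  by apply: eq_Rintegral => s _; rewrite mulrAC.
suff IF : (mu \x lam2)%E.-integrable setT (EFin \o F).
  have E := @Rintegral_Fubini _ _ _ _ _ mu lam2 F IF.
  by rewrite -E.
apply/integrableP; split; first exact/measurable_EFinP.
have mF' : measurable_fun setT (fun p => `|F p|%:E).
  by apply/measurable_EFinP; exact: measurableT_comp.
rewrite (@fubini_tonelli1 _ _ _ _ _ mu lam2 _ mF')//.
apply: (@le_lt_trans _ _ (\int[mu]_s (D * (G' * G))%:E)%E).
  apply: ge0_le_integral => //.
  - by move=> s _; apply: integral_ge0.
  - exact: measurable_fun_fubini_tonelli_F.
  move=> s _.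
  exact: (integral_norm_pairing (kernel_section r kg) (kernel_section r (psi_kernel s))
    (fun y => kernel_ge0 kg (r, y)) (fun z => psi0 s (r, z))
    (kernel_integral kg r) (kernel_integral (psi_kernel s) r)).
by rewrite integral_itv_measure_cst// ltry.
Qed.

(** Fubini twice: over space at a fixed noise time, where the measure is only sigma-finite, and then
    over two bounded time intervals, where boundedness of the pairing suffices. *)
Lemma noise_covariance_time_average G' g : time_kernel G' T g ->
  noise_covariance K g time_average = \int[mu]_s noise_covariance K g (psi s).
Proof.
move=> kg; rewrite /noise_covariance.
have kle s r : `|space_pairing (fun y => g (r, y)) (fun z => psi s (r, z))| <= D * (G' * G).
  apply: space_pairing_le.
  - exact: kernel_section kg.
  - exact: kernel_section (psi_kernel s).
  - by move=> y; exact: kernel_ge0 kg _.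
  - by [].
  - exact: kernel_integral kg r.
  - exact: kernel_integral (psi_kernel s) r.
have sup h (r : R) : ~~ (0 <= r <= T) ->
    space_pairing (fun y => g (r, y)) (fun z => h (r, z)) = 0.
  move=> hr; transitivity (\int[(lam \x lam)%E]__ (0 : R)); last by rewrite Rintegral_cst// mul0r.
  by apply: eq_Rintegral => yz _; rewrite (kernel_support kg)// !mul0r.
pose F (p : R * R) := space_pairing (fun y => g (p.1, y)) (fun z => psi p.2 (p.1, z)).
have mF : measurable_fun setT F.
  pose S : measurableType _ := ((R * R) * 'rV[R]_d)%type.
  have m1 : measurable_fun setT (fun p : S => (p.1.1, p.2)).
    apply: measurable_fun_pair => //.
    exact: (measurableT_comp measurable_fst measurable_fst).
  have m2 : measurable_fun setT (fun p : S => (p.1.2, (p.1.1, p.2))).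
    apply: measurable_fun_pair => //.
    exact: (measurableT_comp measurable_snd measurable_fst).
  exact: (measurable_space_pairing (measurableT_comp (kernel_measurable kg) m1)
    (measurableT_comp mpsi m2)).
transitivity (\int[itv_measure 0 T]_r \int[mu]_s F (r, s)).
  transitivity (\int[lebesgue_measure]_r \int[mu]_s F (r, s)).
    by apply: eq_Rintegral => r _; rewrite -(space_pairing_time_average _ kg).
  apply: Rintegral_supported; first exact: (measurable_Rintegral_snd mu mF).
  move=> r hr; transitivity (\int[mu]__ (0 : R)); last by rewrite Rintegral_cst// mul0r.
  by apply: eq_Rintegral => s _; exact: sup.
have FD p : `|F p| <= D * (G' * G) by exact: kle.
rewrite (@Rintegral_Fubini_bounded _ _ _ _ _ (itv_measure 0 T) mu F _ mF FD).
apply: eq_Rintegral => s _; symmetry; apply: Rintegral_supported.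
  exact: (measurableT_comp mF (measurable_pair2 s)).
by move=> r; exact: sup.
Qed.

End time_average.
End noise_covariance_Fubini.

Lemma norm_mul_le_sqr (R : realDomainType) (x y : R) : `|x * y| <= x ^+ 2 + y ^+ 2.
Proof.
rewrite normrM -(real_normK (num_real x)) -(real_normK (num_real y)).
have := normr_ge0 x; have := normr_ge0 y; nra.
Qed.

Section square_integrable.
Context (R : realType) d (T : measurableType d) (mu : {measure set T -> \bar R}).

Lemma integrable_mul_sqr (X Y : T -> R) :
  measurable_fun setT X -> measurable_fun setT Y ->
  mu.-integrable setT (EFin \o (fun w => X w ^+ 2)) ->
  mu.-integrable setT (EFin \o (fun w => Y w ^+ 2)) ->
  mu.-integrable setT (EFin \o (fun w => X w * Y w)).
Proof.
move=> mX mY X2 Y2; apply: le_integrable (integrableD measurableT X2 Y2) => //.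
  by apply/measurable_EFinP; exact: measurable_funM.
move=> w _ /=; rewrite lee_fin; change (`|X w * Y w| <= `|X w ^+ 2 + Y w ^+ 2|).
rewrite [leRHS]ger0_norm ?addr_ge0 ?sqr_ge0//.
exact: norm_mul_le_sqr.
Qed.

End square_integrable.

(** Cauchy-Schwarz in time, stated in the extended reals because an individual realization of the
    mollified noise need not be square integrable in time. *)
Lemma sqr_Rintegral_le (R : realType) (t : R) (Z : R -> R) : 0 < t ->
  measurable_fun setT Z ->
  (((\int[itv_measure 0 t]_s Z s) ^+ 2)%:E <=
    t%:E * \int[itv_measure 0 t]_s (Z s ^+ 2)%:E)%E.
Proof.
move=> t0 mZ; set mu := itv_measure 0 t.
have [Zoo|Zoo] := leP +oo%E (\int[mu]_s (Z s ^+ 2)%:E)%E.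
  rewrite leye_eq in Zoo; by rewrite (eqP Zoo) gt0_muley ?lte_fin// leey.
have I2 : mu.-integrable setT (EFin \o (fun s => Z s ^+ 2)).
  apply/integrableP; split; first by apply/measurable_EFinP; exact: measurable_funX.
  under eq_integral do rewrite /= ger0_norm ?sqr_ge0//.
  exact: Zoo.
have Ic c : mu.-integrable setT (EFin \o cst c).
  by apply: (@integrable_bounded _ _ _ _ _ `|c|).
have I1 : mu.-integrable setT (EFin \o Z).
  rewrite (_ : _ \o _ = EFin \o (fun s => Z s * 1)).
    apply: integrable_mul_sqr => //; exact: (Ic (1 ^+ 2)).
  by apply/funext => s /=; rewrite mulr1.
(* With [m] the time average of [Z], nonnegativity of the integral of [(Z s - m) ^+ 2], multiplied
   by [t], is the claim. *)
pose m := (\int[mu]_s Z s) / t.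
have : 0 <= \int[mu]_s ((Z s - m) ^+ 2) by apply: Rintegral_ge0 => s _; exact: sqr_ge0.
have -> : \int[mu]_s ((Z s - m) ^+ 2) =
    (\int[mu]_s (Z s ^+ 2)) - 2 * m * (\int[mu]_s Z s) + m ^+ 2 * t.
  transitivity (\int[mu]_s ((Z s ^+ 2 - 2 * m * Z s) + cst (m ^+ 2) s)).
    by apply: eq_Rintegral => s _ /=; ring.
  have J1 := integrableZl measurableT (2 * m) I1.
  have J2 := integrableB measurableT I2 J1.
  transitivity ((\int[mu]_s (Z s ^+ 2 - 2 * m * Z s)) + \int[mu]_s cst (m ^+ 2) s).
    exact: (RintegralD measurableT J2 (Ic (m ^+ 2))).
  congr (_ + _); last first.
    by rewrite /Rintegral integral_itv_measure_cst ?subr0// ltW.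
  transitivity ((\int[mu]_s (Z s ^+ 2)) - \int[mu]_s (2 * m * Z s)).
    exact: (RintegralB measurableT I2 J1).
  by rewrite [X in _ - X]RintegralZl.
move=> h.
have fin : (\int[mu]_s (Z s ^+ 2)%:E)%E \is a fin_num by exact: integrable_fin_num I2.
rewrite -(fineK fin) -EFinM lee_fin -[fine _]/(\int[mu]_s (Z s ^+ 2)).
move: h; set J := \int[mu]_s (Z s ^+ 2); set I := \int[mu]_s Z s => h.
have : 0 <= t * (J - 2 * m * I + m ^+ 2 * t) by rewrite mulr_ge0// ltW.
have -> : t * (J - 2 * m * I + m ^+ 2 * t) = t * J - I ^+ 2.
  by rewrite /m -/I; field; rewrite gt_eqF.
by rewrite subr_ge0.
Qed.

(** * Time integrals of the noise as noise of a time average *)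

Section noise_average.
Context (R : realType) (d : nat) (dW : measure_display) (OW : measurableType dW)
  (Q : probability OW R) (K : 'rV[R]_d -> R) (D : R)
  (W : (R * 'rV[R]_d -> R) -> {RV Q >-> R}).
Hypotheses (mK : measurable_fun setT K) (KD : forall y, `|K y| <= D).
Hypothesis noise : gaussian_noise K W.

Lemma noise_sqr_integrable g : noise_test g ->
  Q.-integrable setT (EFin \o (fun w => W g w ^+ 2)).
Proof.
move=> tg; have := noise_cov noise tg tg; rewrite unlock => h.
apply/integrableP; split.
  by apply/measurable_EFinP; apply: measurable_funX; exact: measurable_funPT.
rewrite (eq_integral (fun w => (W g w * W g w)%:E)) ?h ?ltry// => w _.
by rewrite /= ger0_norm ?sqr_ge0// expr2.
Qed.

Lemma noise_RcovE g h : noise_test g -> noise_test h ->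
  \int[Q]_w (W g w * W h w) = noise_covariance K g h.
Proof. by move=> tg th; have := noise_cov noise tg th; rewrite unlock /Rintegral => ->. Qed.

(** Symmetry is inherited from the product of random variables instead of evenness of [K]. *)
Lemma noise_covarianceC g h : noise_test g -> noise_test h ->
  noise_covariance K g h = noise_covariance K h g.
Proof.
move=> tg th; rewrite -(noise_RcovE tg th) -(noise_RcovE th tg).
by apply: eq_Rintegral => w _; rewrite mulrC.
Qed.

Variables (t T G B : R) (psi : R -> R * 'rV[R]_d -> R) (Z : R -> OW -> R).
Hypotheses (t0 : 0 < t) (T0 : 0 <= T).
Hypothesis mpsi : measurable_fun setT (fun p : R * (R * 'rV[R]_d) => psi p.1 p.2).
Hypothesis psi_kernel : forall s, time_kernel G T (psi s).
Hypothesis psiB : forall s z, psi s z <= B.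
Hypothesis mZ : measurable_fun setT (fun p : R * OW => Z p.1 p.2).
Hypothesis Zpsi : forall s, {ae Q, forall w, Z s w = W (psi s) w}.
Notation mu := (itv_measure 0 t).
Notation h := (time_average t psi).

Let h_kernel : time_kernel (G * t) T h.
Proof. by apply: (time_average_kernel _ mpsi psi_kernel psiB); exact: ltW. Qed.

Let test_psi s : noise_test (psi s). Proof. exact: time_kernel_test (psi_kernel s). Qed.
Let test_h : noise_test h. Proof. exact: time_kernel_test h_kernel. Qed.

Let mZs s : measurable_fun setT (Z s).
Proof. exact: (measurableT_comp mZ (measurable_pair1 s)). Qed.

Let I w := \int[mu]_s Z s w.

Let mI : measurable_fun setT I. Proof. exact: (measurable_Rintegral_fst mu mZ). Qed.

Let V := D * (G * G) * T.

Let Z2 s : (\int[Q]_w (Z s w ^+ 2)%:E <= V%:E)%E.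
Proof.
rewrite (ae_eq_integral (fun w => (W (psi s) w ^+ 2)%:E))//; last 3 first.
- by apply/measurable_EFinP; exact: measurable_funX.
- by apply/measurable_EFinP; apply: measurable_funX; exact: measurable_funPT.
- by apply: filterS (Zpsi s) => w -> _.
have fin := integrable_fin_num measurableT (noise_sqr_integrable (test_psi s)).
rewrite -(fineK fin) lee_fin -[fine _]/(\int[Q]_w (W (psi s) w ^+ 2)).
under eq_Rintegral do rewrite expr2.
rewrite (noise_RcovE (test_psi s) (test_psi s)); apply: le_trans (ler_norm _) _.
exact: (noise_covariance_le mK KD T0 (psi_kernel s) (psi_kernel s)).
Qed.

Let Z2i s : Q.-integrable setT (EFin \o (fun w => Z s w ^+ 2)).
Proof.
apply/integrableP; split; first by apply/measurable_EFinP; exact: measurable_funX.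
under eq_integral do rewrite /= ger0_norm ?sqr_ge0//.
by apply: le_lt_trans (Z2 s) _; rewrite ltry.
Qed.

Let mZ2 : measurable_fun setT (fun p : R * OW => (Z p.1 p.2 ^+ 2)%:E).
Proof. by apply/measurable_EFinP; exact: measurable_funX. Qed.

Let I2 : Q.-integrable setT (EFin \o (fun w => I w ^+ 2)).
Proof.
apply/integrableP; split; first by apply/measurable_EFinP; exact: measurable_funX.
apply: (@le_lt_trans _ _ (\int[Q]_w (t%:E * \int[mu]_s (Z s w ^+ 2)%:E))%E).
  apply: ge0_le_integral => //.
  - apply/measurable_EFinP; apply: measurableT_comp => //; exact: measurable_funX.
  - apply: measurable_funeM.
    apply: (@measurable_fun_fubini_tonelli_G _ _ _ _ _ mu _ mZ2) => p.
    by rewrite lee_fin sqr_ge0.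
  - move=> w _ /=; rewrite ger0_norm ?sqr_ge0//.
    exact: (sqr_Rintegral_le t0 (measurableT_comp mZ (measurable_pair2 w))).
rewrite ge0_integralZl//; last 3 first.
- apply: (@measurable_fun_fubini_tonelli_G _ _ _ _ _ mu _ mZ2) => p.
  by rewrite lee_fin sqr_ge0.
- by move=> w _; apply: integral_ge0 => s _; rewrite lee_fin sqr_ge0.
- by rewrite lee_fin ltW.
rewrite -(@fubini_tonelli _ _ _ _ _ mu Q _ mZ2); last by move=> p; rewrite lee_fin sqr_ge0.
apply: lte_mul_pinfty; rewrite ?lee_fin ?ltW//.
apply: (@le_lt_trans _ _ (\int[mu]_s V%:E)%E); last first.
  by rewrite integral_itv_measure_cst ?ltry// ltW.
apply: ge0_le_integral => //.
- by move=> s _; apply: integral_ge0 => w _; rewrite lee_fin sqr_ge0.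
- apply: (@measurable_fun_fubini_tonelli_F _ _ _ _ _ Q _ mZ2) => p.
  by rewrite lee_fin sqr_ge0.
- by move=> s _; exact: Z2.
Qed.

Let Fubini_noise (Y : OW -> R) : measurable_fun setT Y ->
  Q.-integrable setT (EFin \o (fun w => Y w ^+ 2)) ->
  \int[Q]_w (I w * Y w) = \int[mu]_s \int[Q]_w (Z s w * Y w).
Proof.
move=> mY Y2.
have IZ (Y' : OW -> R) : measurable_fun setT Y' ->
    Q.-integrable setT (EFin \o (fun w => Y' w ^+ 2)) ->
    (mu \x Q)%E.-integrable setT (EFin \o (fun p => Z p.1 p.2 * Y' p.2)).
  move=> mY' Y'2.
  have mZY : measurable_fun setT (fun p : R * OW => Z p.1 p.2 * Y' p.2).
    by apply: measurable_funM => //; exact: (measurableT_comp mY' measurable_snd).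
  apply/integrableP; split; first exact/measurable_EFinP.
  have mn : measurable_fun setT (fun p : R * OW => `|Z p.1 p.2 * Y' p.2|%:E).
    by apply/measurable_EFinP; exact: measurableT_comp.
  rewrite (@fubini_tonelli1 _ _ _ _ _ mu Q _ mn)//.
  pose c := \int[Q]_w (Y' w ^+ 2).
  apply: (@le_lt_trans _ _ (\int[mu]_s (V + c)%:E)%E); last first.
    by rewrite integral_itv_measure_cst ?ltry// ltW.
  apply: ge0_le_integral => //.
  - by move=> s _; apply: integral_ge0.
  - exact: measurable_fun_fubini_tonelli_F.
  - move=> s _; rewrite /fubini_F /=.
    apply: (@le_trans _ _ (\int[Q]_w ((Z s w ^+ 2)%:E + (Y' w ^+ 2)%:E))%E).
      apply: ge0_le_integral => //.
      + by apply/measurable_EFinP; exact: (measurableT_comp _ (measurableT_comp mZY (measurable_pair1 s))).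
      + by apply: emeasurable_funD; apply/measurable_EFinP; exact: measurable_funX.
      + by move=> w _; rewrite lee_fin norm_mul_le_sqr.
    rewrite (integralD measurableT (Z2i s) Y'2) EFinD leeD//.
    - exact: Z2 s.
    - by rewrite /c /Rintegral fineK//; exact: integrable_fin_num Y'2.
have mZY : measurable_fun setT (fun p : R * OW => Z p.1 p.2 * Y p.2).
  by apply: measurable_funM => //; exact: (measurableT_comp mY measurable_snd).
rewrite (@Rintegral_Fubini _ _ _ _ _ mu Q _ (IZ Y mY Y2)) /=.
apply: eq_Rintegral_ae.
- exact: measurable_funM.
- exact: (measurable_Rintegral_fst mu mZY).
have I1 : Q.-integrable setT (EFin \o (fun w => cst 1 w ^+ 2 : R)).
  apply: (@integrable_bounded _ _ _ _ _ 1) => [|w]; first exact: measurable_funX.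
  by rewrite expr1n normr1.
(* With the constant 1 in place of [Y], almost every realization of [Z] is integrable in time, which
   allows [Y w] to enter the time integral. *)
have := ae_integrable2 (IZ (cst 1) (measurable_cst _) I1).
apply: filterS => w Iw; rewrite /I -RintegralZr//.
by move: Iw; apply: eq_integrable => // s _ /=; rewrite mulr1.
Qed.

Let mW g : measurable_fun setT (W g). Proof. exact: measurable_funPT. Qed.

Let noise_h (Y : OW -> R) s : measurable_fun setT Y ->
  \int[Q]_w (Z s w * Y w) = \int[Q]_w (W (psi s) w * Y w).
Proof.
move=> mY; apply: eq_Rintegral_ae; [exact: measurable_funM..|].
by apply: filterS (Zpsi s) => w ->.
Qed.

Let average_noise_cov g : time_kernel (G * t) T g \/ time_kernel G T g ->
  \int[Q]_w (I w * W g w) = \int[mu]_s noise_covariance K (psi s) g.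
Proof.
move=> kg; have tg : noise_test g by case: kg => /time_kernel_test.
rewrite (Fubini_noise (mW g) (noise_sqr_integrable tg)).
by apply: eq_Rintegral => s _; rewrite (noise_h s (mW g)) (noise_RcovE (test_psi s) tg).
Qed.

(* Expanding E (I - W h)^2 by bilinearity of the covariance gives 0. *)
Lemma noise_average_eq : Q.-integrable setT (EFin \o (fun w => I w - W h w)) /\
  \int[Q]_w `|I w - W h w| = 0.
Proof.
have W2 := noise_sqr_integrable test_h.
pose v := \int[mu]_s noise_covariance K (psi s) h.
have E1 : \int[Q]_w (I w * W h w) = v by apply: average_noise_cov; left.
have E2 : \int[Q]_w (I w * I w) = v.
  rewrite (Fubini_noise mI I2); apply: eq_Rintegral => s _.
  rewrite (noise_h s mI) (noise_covariance_time_average mK KD (ltW t0) mpsi psi_kernel psiB (psi_kernel s)).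
  transitivity (\int[mu]_r noise_covariance K (psi r) (psi s)).
    rewrite -(average_noise_cov (or_intror (psi_kernel s))).
    by apply: eq_Rintegral => w _; rewrite mulrC.
  by apply: eq_Rintegral => r _; exact: noise_covarianceC (test_psi r) (test_psi s).
have E3 : \int[Q]_w (W h w * W h w) = v.
  rewrite (noise_RcovE test_h test_h).
  rewrite (noise_covariance_time_average mK KD (ltW t0) mpsi psi_kernel psiB h_kernel).
  by apply: eq_Rintegral => s _; exact: noise_covarianceC test_h (test_psi s).
have mIW : measurable_fun setT (fun w => I w - W h w) by exact: measurable_funB.
have J1 := integrable_mul_sqr mI mI I2 I2.
have J2 := integrable_mul_sqr mI (mW h) I2 W2.
have J3 := integrable_mul_sqr (mW h) (mW h) W2 W2.
have J4 := integrableZl measurableT 2 J2.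
have J5 := integrableB measurableT J1 J4.
have J6 := integrableD measurableT J5 J3.
have E4 : \int[Q]_w ((I w - W h w) ^+ 2) = 0.
  transitivity (\int[Q]_w ((I w * I w - 2 * (I w * W h w)) + W h w * W h w)).
    by apply: eq_Rintegral => w _; ring.
  transitivity (\int[Q]_w (I w * I w - 2 * (I w * W h w)) + \int[Q]_w (W h w * W h w)).
    exact: (RintegralD measurableT J5 J3).
  transitivity (\int[Q]_w (I w * I w) - \int[Q]_w (2 * (I w * W h w)) + \int[Q]_w (W h w * W h w)).
    by congr (_ + _); exact: (RintegralB measurableT J1 J4).
  by rewrite [X in _ - X + _]RintegralZl// E1 E2 E3; ring.
have J7 : Q.-integrable setT (EFin \o (fun w => (I w - W h w) ^+ 2)).
  move: J6; apply: eq_integrable => // w _ /=.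
  by rewrite -!EFinD; congr EFin; ring.
split; first exact: (integrable_sqrW mIW J7).
apply/eqP; rewrite eq_le Rintegral_ge0//= andbT.
apply/ler_addgt0Pr => e e0; rewrite add0r.
by apply: (expectation_le_sqr e0 mIW J7); rewrite E4 sqr_ge0.
Qed.

End noise_average.

Section time_mollifier.
Context (R : realType).

Lemma Rintegral_itv_indic (T a delta : R) : 0 <= delta -> 0 <= a -> a + delta <= T ->
  \int[itv_measure 0 T]_u \1_(`[a, a + delta]%classic : set R) u = delta.
Proof.
move=> d0 a0 aT; rewrite /Rintegral integral_indic// setIT /= /mfrestr /mrestr.
rewrite setIidl; last first.
  move=> u; rewrite /= !in_itv/= => /andP[h1 h2].
  by rewrite (le_trans a0 h1) (le_trans h2 aT).
rewrite /leb lebesgue_measure_itv/= lte_fin ltrDl.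
by move: d0; rewrite le_eqVlt => /predU1P[<-|d0];
  rewrite ?ltxx// d0 -EFinD addrAC subrr add0r.
Qed.

Lemma Rintegral_itv_indic_le (T a delta : R) : 0 <= delta ->
  \int[itv_measure 0 T]_u \1_(`[a, a + delta]%classic : set R) u <= delta.
Proof.
move=> d0; rewrite /Rintegral integral_indic// setIT /= /mfrestr /mrestr.
have h : (leb (`[a, (a + delta)%R] `&` `[0%R, T]) <= delta%:E)%E.
  apply: (@le_trans _ _ (leb `[a, (a + delta)%R]%classic)).
    by apply: le_measure; rewrite ?inE//; exact: measurableI.
  rewrite /leb lebesgue_measure_itv/= lte_fin ltrDl.
  by move: d0; rewrite le_eqVlt => /predU1P[<-|d0];
  rewrite ?ltxx// d0 -EFinD addrAC subrr add0r.
by rewrite -lee_fin fineK// ge0_fin_numE// (le_lt_trans h)// ltry.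
Qed.

Lemma measurable_time_mollifier (delta : R) : measurable_fun setT (time_mollifier delta).
Proof. exact: measurable_funM. Qed.

Lemma time_mollifier_ge0 (delta u : R) : 0 < delta -> 0 <= time_mollifier delta u.
Proof. by move=> d0; rewrite mulr_ge0// invr_ge0 ltW. Qed.

Lemma time_mollifier_le (delta u : R) : 0 < delta -> time_mollifier delta u <= delta^-1.
Proof.
move=> d0; apply: ler_piMr; first by rewrite invr_ge0 ltW.
by rewrite indicE; case: (_ \in _).
Qed.

(** Seen in the noise time [u], the mollifier lives on [[s, s + delta]]; hence kernels along a path
    on [[0, t]] are supported in [[0, t + delta]]. *)
Lemma time_mollifierE (delta s u : R) :
  time_mollifier delta (s - u) = delta^-1 * \1_(`[s, s + delta]%classic : set R) u.
Proof.
rewrite /time_mollifier !indicE; congr (_ * (_ : bool)%:R).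
apply/idP/idP; rewrite !inE/= !in_itv/= => /andP[h1 h2]; apply/andP; split; lra.
Qed.

Lemma time_mollifier_support (delta s u : R) : 0 < delta ->
  ~~ (s <= u <= s + delta) -> time_mollifier delta (s - u) = 0.
Proof.
move=> d0 h; rewrite time_mollifierE indicE; case: (boolP (_ \in _)); rewrite ?mulr0//.
by rewrite inE/= in_itv/= (negbTE h).
Qed.

End time_mollifier.

(** * Covariance of the mollified noise along two paths *)

Section mollified_path.
Context (R : realType) (d : nat) (K : 'rV[R]_d -> R) (D : R).
Hypotheses (mK : measurable_fun setT K) (KD : forall y, `|K y| <= D).
Notation lam := (lebesgue_rV R d).

Let D0 : 0 <= D. Proof. exact: le_trans (normr_ge0 _) (KD 0). Qed.

Definition mollified_pairing (delta : R) (a b : 'rV[R]_d) : R :=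
  space_pairing K (fun y => space_mollifier delta (a - y))
    (fun z => space_mollifier delta (b - z)).

Section fixed_delta.
Variable delta : R.
Hypothesis delta0 : 0 < delta.
Notation p a := (fun y : 'rV[R]_d => space_mollifier delta (a - y)).

Let mp a : measurable_fun setT (p a).
Proof.
have m := measurable_rVB (measurable_cst a) (@measurable_id _ 'rV[R]_d setT).
exact: (measurableT_comp (@measurable_space_mollifier R d delta) m).
Qed.

Let p0 a y : 0 <= p a y. Proof. exact: space_mollifier_ge0. Qed.

Let p1 a : (\int[lam]_y (p a y)%:E <= 1%:E)%E.
Proof. by rewrite integral_space_mollifier. Qed.

Let Ip a b : (lam \x lam)%E.-integrable setT (EFin \o (fun yz => p a yz.1 * p b yz.2)).
Proof. exact: integrable_tensor (mp a) (mp b) (p0 a) (p0 b) (p1 a) (p1 b). Qed.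

Lemma mollified_pairing_le a b : `|mollified_pairing delta a b| <= D.
Proof.
have := space_pairing_le mK KD (mp a) (mp b) (p0 a) (p0 b) (p1 a) (p1 b).
by rewrite !mulr1.
Qed.

(** Chebyshev's inequality: [y] and [z] have together [2 d] coordinates of variance [delta], and
    where one of them deviates by [theta] the error is at most [2 * D]. *)
Lemma mollified_pairing_near (a b : 'rV[R]_d) (k eta theta : R) :
  0 <= eta -> 0 < theta -> `|k| <= D ->
  (forall y z : 'rV[R]_d, (forall i, `|y 0 i - a 0 i| < theta) ->
    (forall i, `|z 0 i - b 0 i| < theta) -> `|K (y - z) - k| <= eta) ->
  `|mollified_pairing delta a b - k| <= eta + 2 * D / theta ^+ 2 * (2 * d%:R * delta).
Proof.
move=> eta0 theta0 kD hK.
pose w (yz : 'rV[R]_d * 'rV[R]_d) := p a yz.1 * p b yz.2.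
have w0 yz : 0 <= w yz by rewrite mulr_ge0 ?p0.
have w1 : \int[(lam \x lam)%E]_yz w yz = 1.
  rewrite /Rintegral (integral_tensor (mp a) (mp b) (p0 a) (p0 b)).
  by rewrite !integral_space_mollifier// mule1.
have IK := integrable_pairing mK KD (mp a) (mp b) (p0 a) (p0 b) (p1 a) (p1 b).
have Ik := integrableZl measurableT k (Ip a b).
have -> : mollified_pairing delta a b - k =
    \int[(lam \x lam)%E]_yz (w yz * (K (yz.1 - yz.2) - k)).
  rewrite -[k in LHS]mulr1 -w1 -[X in _ - X]RintegralZl//; last exact: Ip.
  rewrite -[LHS](RintegralB measurableT IK Ik).
  by apply: eq_Rintegral => yz _; rewrite mulrBr; congr (_ - _); rewrite mulrC.
pose c := 2 * D / theta ^+ 2.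
have c0 : 0 <= c by rewrite divr_ge0 ?sqr_ge0// mulr_ge0.
pose q (a' : 'rV[R]_d) i (y : 'rV[R]_d) := (a' 0 i - y 0 i) ^+ 2 * p a' y.
have mq a' i : measurable_fun setT (q a' i).
  apply: measurable_funM => //; apply: measurable_funX; apply: measurable_funB => //.
  exact: measurable_rV_coord.
have q0 a' i y : 0 <= q a' i y by rewrite mulr_ge0 ?sqr_ge0 ?p0.
have q1 a' i : (\int[lam]_y (q a' i y)%:E <= delta%:E)%E.
  by rewrite integral_sqr_space_mollifier.
pose f i yz := q a i yz.1 * p b yz.2 + p a yz.1 * q b i yz.2.
have I1 i := integrable_tensor (mq a i) (mp b) (q0 a i) (p0 b) (q1 a i) (p1 b).
have I2 i := integrable_tensor (mp a) (mq b i) (p0 a) (q0 b i) (p1 a) (q1 b i).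
have If i : (lam \x lam)%E.-integrable setT (EFin \o f i).
  exact: (integrableD measurableT (I1 i) (I2 i)).
have f1 i : \int[(lam \x lam)%E]_yz f i yz = 2 * delta.
  transitivity (\int[(lam \x lam)%E]_yz (q a i yz.1 * p b yz.2) +
      \int[(lam \x lam)%E]_yz (p a yz.1 * q b i yz.2)).
    exact: (RintegralD measurableT (I1 i) (I2 i)).
  rewrite /Rintegral (integral_tensor (mq a i) (mp b) (q0 a i) (p0 b)).
  rewrite (integral_tensor (mp a) (mq b i) (p0 a) (q0 b i)).
  by rewrite !integral_space_mollifier// !integral_sqr_space_mollifier// mule1 mul1e /=; ring.
pose L := [seq (c, i) | i <- index_enum 'I_d].
have IwK : (lam \x lam)%E.-integrable setT (EFin \o (fun yz => w yz * (K (yz.1 - yz.2) - k))).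
  move: (integrableB measurableT IK Ik); apply: eq_integrable => // yz _ /=.
  by rewrite -EFinB; congr EFin; rewrite mulrBr; congr (_ - _); rewrite mulrC.
have J1 := integrableZl measurableT eta (Ip a b).
have J2 := integrable_lincomb If L.
rewrite (le_trans (le_normr_Rintegral measurableT IwK))//.
apply: (@le_trans _ _ (\int[(lam \x lam)%E]_yz (eta * w yz + \sum_(ci <- L) ci.1 * f ci.2 yz))).
  apply: le_Rintegral => //.
  - exact: integrable_norm IwK.
  - exact: (integrableD measurableT J1 J2).
  move=> [y z] _; rewrite normrM (ger0_norm (w0 _)) /=.
  pose sq i := (a 0 i - y 0 i) ^+ 2 + (b 0 i - z 0 i) ^+ 2.
  have sq0 i : 0 <= sq i by rewrite addr_ge0 ?sqr_ge0.
  have -> : \sum_(ci <- L) ci.1 * f ci.2 (y, z) = w (y, z) * (c * \sum_i sq i).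
    rewrite /L big_map mulrCA !mulr_sumr; apply: eq_bigr => i _ /=.
    by rewrite /f /w /q /sq /=; ring.
  rewrite [eta * _]mulrC -mulrDr ler_wpM2l//.
  have [/forallP h|] := boolP [forall i, (`|y 0 i - a 0 i| < theta) && (`|z 0 i - b 0 i| < theta)].
    have h1 i : `|y 0 i - a 0 i| < theta by case/andP: (h i).
    have h2 i : `|z 0 i - b 0 i| < theta by case/andP: (h i).
    apply: (le_trans (hK y z h1 h2)).
    by rewrite lerDl mulr_ge0// sumr_ge0.
  rewrite negb_forall => /existsP[i hi].
  apply: (@le_trans _ _ (2 * D)).
    by rewrite (le_trans (ler_normB _ _))// mulr2n mulrDl mul1r lerD.
  apply: (@le_trans _ _ (c * \sum_i sq i)); last by rewrite lerDr.
  rewrite /c -mulrA ler_peMr ?mulr_ge0// mulrC ler_pdivlMr ?exprn_gt0// mul1r.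
  rewrite (bigD1 i)//= -[leLHS]addr0 lerD ?sumr_ge0//.
  have sqge (u v : R) : theta <= `|u - v| -> theta ^+ 2 <= (v - u) ^+ 2.
    move=> h; rewrite -[leRHS]real_normK ?num_real// distrC.
    by rewrite lerXn2r// nnegrE ltW.
  move: hi; rewrite negb_and -!leNgt => /orP[|] /sqge h; rewrite (le_trans h)//.
    by rewrite lerDl sqr_ge0.
  by rewrite lerDr sqr_ge0.
rewrite le_eqVlt; apply/orP; left; apply/eqP.
transitivity (\int[(lam \x lam)%E]_yz (eta * w yz) +
    \int[(lam \x lam)%E]_yz (\sum_(ci <- L) ci.1 * f ci.2 yz)).
  exact: (RintegralD measurableT J1 J2).
rewrite [X in X + _]RintegralZl//; last exact: Ip.
rewrite w1 mulr1 (Rintegral_lincomb If) /L big_map; congr (_ + _).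
rewrite (eq_bigr (fun=> c * (2 * delta))); last by move=> i _ /=; rewrite f1.
by rewrite sumr_const card_ord -[LHS]mulr_natr /c; ring.
Qed.

End fixed_delta.

Lemma measurable_mollified_pairing (delta : R) dS (S : measurableType dS) (a b : S -> 'rV[R]_d) :
  measurable_fun setT a -> measurable_fun setT b ->
  measurable_fun setT (fun s => mollified_pairing delta (a s) (b s)).
Proof.
move=> ma mb.
have mk (c : S -> 'rV[R]_d) : measurable_fun setT c ->
    measurable_fun setT (fun p : S * 'rV[R]_d => space_mollifier delta (c p.1 - p.2)).
  move=> mc; apply: (measurableT_comp (@measurable_space_mollifier R d delta)
    (measurable_rVB (measurableT_comp mc measurable_fst) measurable_snd)).
exact: (measurable_space_pairing mK (mk a ma) (mk b mb)).
Qed.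

Section path_kernel.
Variables (t : R) (x : 'rV[R]_d) (I : Type) (beta : I -> R -> 'rV[R]_d).
Hypothesis t0 : 0 < t.
Hypothesis beta_continuous : forall i, continuous (beta i).

(** Clipping makes the kernels along a path measurable and uniformly supported for every real [s],
    while nothing changes on [[0, t]]. *)
Definition clip (s : R) : R := Num.max 0 (Num.min s t).

Lemma clip_ge0 s : 0 <= clip s. Proof. by rewrite /clip le_max lexx. Qed.

Lemma clip_le s : clip s <= t.
Proof. by rewrite /clip ge_max ge_min lexx orbT ltW. Qed.

Lemma clip_id s : 0 <= s <= t -> clip s = s.
Proof. by case/andP => h1 h2; rewrite /clip (min_idPl h2) (max_idPr h1). Qed.

Lemma measurable_clip : measurable_fun setT clip.
Proof. by apply: measurable_maxr => //; exact: measurable_minr. Qed.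

Let measurable_beta i : measurable_fun setT (beta i).
Proof.
apply: measurable_fun_rVP => j; apply: continuous_measurable_fun => s.
apply: (@continuous_comp _ _ _ (beta i) (fun y : 'rV[R]_d => y 0 j)).
  exact: beta_continuous.
exact: coord_continuous.
Qed.

Let measurable_base i : measurable_fun setT (fun s => x + beta i (clip s)).
Proof.
exact: (measurable_rVD (measurable_cst x) (measurableT_comp (measurable_beta i) measurable_clip)).
Qed.

Definition path_kernel (delta : R) (i : I) (s : R) (z : R * 'rV[R]_d) : R :=
  time_mollifier delta (t - clip s - z.1) *
  space_mollifier delta (x + beta i (clip s) - z.2).

(** The autocorrelation of the time mollifier, that is, the triangular kernel of half-width [delta]
    and height [1 / delta] in [clip s - clip r]: an approximate identity, of which the support and
    the mass are what matters. *)
Definition tent (delta s r : R) : R := \int[itv_measure 0 (t + delta)]_u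
  (time_mollifier delta (t - clip s - u) * time_mollifier delta (t - clip r - u)).

Section fixed_delta.
Variable delta : R.
Hypothesis delta0 : 0 < delta.
Let T := t + delta.
Let tau s u := time_mollifier delta (t - clip s - u).

Let tau0 s u : 0 <= tau s u. Proof. exact: time_mollifier_ge0. Qed.
Let tau_le s u : tau s u <= delta^-1. Proof. exact: time_mollifier_le. Qed.
Let norm_tau s u : `|tau s u| <= delta^-1. Proof. by rewrite ger0_norm. Qed.

Let measurable_tau : measurable_fun setT (fun p : R * R => tau p.1 p.2).
Proof.
have m : measurable_fun setT (fun p : R * R => t - clip p.1 - p.2).
  apply: measurable_funB => //; apply: measurable_funB => //.
  exact: (measurableT_comp measurable_clip measurable_fst).
exact: (measurableT_comp (measurable_time_mollifier delta) m).
Qed.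

Let measurable_tau1 s : measurable_fun setT (tau s).
Proof. exact: (measurableT_comp measurable_tau (measurable_pair1 s)). Qed.

Let tau_support s u : ~~ (t - clip s <= u <= t - clip s + delta) -> tau s u = 0.
Proof. exact: time_mollifier_support. Qed.

Lemma measurable_path_kernel i :
  measurable_fun setT (fun p : R * (R * 'rV[R]_d) => path_kernel delta i p.1 p.2).
Proof.
apply: measurable_funM.
  have m : measurable_fun setT (fun p : R * (R * 'rV[R]_d) => (p.1, p.2.1)).
    apply: measurable_fun_pair => //; exact: (measurableT_comp measurable_fst measurable_snd).
  exact: (measurableT_comp measurable_tau m).
apply: (measurableT_comp (@measurable_space_mollifier R d delta)).
apply: measurable_rVB; first exact: (measurableT_comp (measurable_base i) measurable_fst).
exact: (measurableT_comp measurable_snd measurable_snd).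
Qed.

Lemma path_kernel_le i s z : path_kernel delta i s z <=
  delta^-1 * normal_peak (Num.sqrt delta) ^+ d.
Proof.
by apply: ler_pM;
  [exact: tau0|exact: space_mollifier_ge0|exact: tau_le|exact: space_mollifier_le].
Qed.

Lemma path_kernel_kernel i s : time_kernel delta^-1 T (path_kernel delta i s).
Proof.
split.
- exact: (measurableT_comp (measurable_path_kernel i) (measurable_pair1 s)).
- by move=> z; rewrite mulr_ge0 ?space_mollifier_ge0 ?tau0.
- move=> r; rewrite (eq_integral (fun y : 'rV[R]_d => (tau s r)%:E *
    (space_mollifier delta (x + beta i (clip s) - y))%:E)%E); last by move=> y _; rewrite EFinM.
  have m := measurable_rVB (measurable_cst (x + beta i (clip s))) (@measurable_id _ 'rV[R]_d setT).
  rewrite ge0_integralZl//; last 3 first.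
  + by apply/measurable_EFinP; exact: (measurableT_comp (@measurable_space_mollifier R d delta) m).
  + by move=> y _; rewrite lee_fin space_mollifier_ge0.
  + exact: tau0.
  by rewrite integral_space_mollifier// mule1 lee_fin tau_le.
- move=> r y h; rewrite /path_kernel -/(tau s r) tau_support ?mul0r//.
  apply: contra h => /andP[h1 h2]; have := clip_ge0 s; have := clip_le s.
  by move=> c1 c2; rewrite /T; apply/andP; split; lra.
Qed.

Lemma tent_ge0 s r : 0 <= tent delta s r.
Proof. by apply: Rintegral_ge0 => u _; rewrite mulr_ge0 ?tau0. Qed.

Lemma tent_support s r : delta < `|clip s - clip r| -> tent delta s r = 0.
Proof.
move=> h; transitivity (\int[itv_measure 0 T]__ (0 : R)); last by rewrite Rintegral_cst// mul0r.
apply: eq_Rintegral => u _; rewrite -/(tau s u) -/(tau r u).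
have [h1|h1] := boolP (t - clip s <= u <= t - clip s + delta); last by rewrite tau_support ?mul0r.
have [h2|h2] := boolP (t - clip r <= u <= t - clip r + delta); last by rewrite [tau r u]tau_support ?mulr0.
exfalso; move: h; apply/negP; rewrite -leNgt ler_norml.
by move: h1 h2 => /andP[? ?] /andP[? ?]; apply/andP; split; lra.
Qed.

Let measurable_tautau : measurable_fun setT (fun p : (R * R) * R => tau p.1.1 p.2 * tau p.1.2 p.2).
Proof.
have m1 : measurable_fun setT (fun p : (R * R) * R => (p.1.1, p.2)).
  by apply: measurable_fun_pair => //; exact: (measurableT_comp measurable_fst measurable_fst).
have m2 : measurable_fun setT (fun p : (R * R) * R => (p.1.2, p.2)).
  by apply: measurable_fun_pair => //; exact: (measurableT_comp measurable_snd measurable_fst).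
by apply: measurable_funM; [exact: (measurableT_comp measurable_tau m1)|
  exact: (measurableT_comp measurable_tau m2)].
Qed.

Lemma measurable_tent : measurable_fun setT (fun p : R * R => tent delta p.1 p.2).
Proof. exact: (measurable_Rintegral_snd (itv_measure 0 T) measurable_tautau). Qed.

Let Iindic (T' a : R) : (itv_measure 0 T').-integrable setT
  (EFin \o (\1_(`[a, a + delta]%classic : set R) : R -> R)).
Proof.
apply: (@integrable_bounded _ _ _ _ _ 1) => // u.
by rewrite indicE; case: (_ \in _); rewrite ?normr1 ?normr0.
Qed.

Let tau_mass s : \int[itv_measure 0 T]_u tau s u = 1.
Proof.
have h1 := clip_ge0 s; have h2 := clip_le s.
transitivity (\int[itv_measure 0 T]_u
    (delta^-1 * \1_(`[t - clip s, t - clip s + delta]%classic : set R) u)).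
  by apply: eq_Rintegral => u _; exact: time_mollifierE.
rewrite RintegralZl//; last exact: Iindic.
rewrite Rintegral_itv_indic ?mulVf ?gt_eqF//; first exact: ltW.
  by rewrite subr_ge0.
by rewrite /T lerD2r gerBl.
Qed.

Let tau_sndE u : \int[itv_measure 0 t]_r tau r u =
  delta^-1 * \int[itv_measure 0 t]_r \1_(`[t - u, t - u + delta]%classic : set R) r.
Proof.
rewrite -RintegralZl//; last exact: Iindic.
apply: eq_Rintegral_ae.
- exact: (measurableT_comp measurable_tau (measurable_pair2 u)).
- exact: measurable_funM.
apply: filterS (itv_measure_ae 0 t) => r /andP[r0 rt].
by rewrite /tau clip_id ?ltW// addrAC; exact: time_mollifierE.
Qed.

Let tau_mass_snd u : \int[itv_measure 0 t]_r tau r u <= 1.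
Proof. by rewrite tau_sndE ler_pdivrMl// mulr1 Rintegral_itv_indic_le// ltW. Qed.

Let tau_mass_snd1 u : delta <= u <= t -> \int[itv_measure 0 t]_r tau r u = 1.
Proof.
move=> /andP[h1 h2]; rewrite tau_sndE Rintegral_itv_indic ?mulVf ?gt_eqF//.
- exact: ltW.
- by rewrite subr_ge0.
- by rewrite -addrA gerDl addrC subr_le0.
Qed.

Let Fubini_tent s : \int[itv_measure 0 t]_r tent delta s r =
  \int[itv_measure 0 T]_u (tau s u * \int[itv_measure 0 t]_r tau r u).
Proof.
have mf : measurable_fun setT (fun p : R * R => tau s p.2 * tau p.1 p.2).
  by apply: measurable_funM => //; exact: (measurableT_comp (measurable_tau1 s) measurable_snd).
have fC (p : R * R) : `|tau s p.2 * tau p.1 p.2| <= delta^-1 * delta^-1.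
  by rewrite normrM ler_pM.
have E := @Rintegral_Fubini_bounded _ _ _ _ _ (itv_measure 0 t) (itv_measure 0 T) _ _ mf fC.
rewrite [LHS]E; apply: eq_Rintegral => u _.
transitivity (\int[itv_measure 0 t]_r (tau s u * tau r u)) => //.
rewrite [LHS](@RintegralZl _ _ _ _ _ (fun r => tau r u))//.
apply: (@integrable_bounded _ _ _ _ _ delta^-1) => [|r]; last exact: norm_tau.
exact: (measurableT_comp measurable_tau (measurable_pair2 u)).
Qed.

Lemma tent_mass_le s : \int[itv_measure 0 t]_r tent delta s r <= 1.
Proof.
have mA : measurable_fun setT (fun u => \int[itv_measure 0 t]_r tau r u).
  exact: (measurable_Rintegral_fst (itv_measure 0 t) measurable_tau).
have A0 u : 0 <= \int[itv_measure 0 t]_r tau r u by exact: Rintegral_ge0.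
rewrite Fubini_tent -(tau_mass s); apply: le_Rintegral => //.
- apply: (@integrable_bounded _ _ _ _ _ (delta^-1 * 1)); first exact: measurable_funM.
  by move=> u; rewrite normrM ler_pM// ger0_norm// tau_mass_snd.
- exact: integrable_bounded (measurable_tau1 s) (norm_tau s).
- by move=> u _; rewrite ler_piMr// tau_mass_snd.
Qed.

(** The margin [delta] at both ends keeps [u] in [[delta, t]], where the mollifier in [r] is not cut
    off by the endpoints. *)
Lemma tent_mass s : delta <= s -> s + delta <= t -> \int[itv_measure 0 t]_r tent delta s r = 1.
Proof.
move=> ds st; rewrite Fubini_tent -(tau_mass s); apply: eq_Rintegral => u _.
have [/andP[h1 h2]|h] := boolP (t - clip s <= u <= t - clip s + delta); last first.
  by rewrite tau_support// mul0r.
have s0 : 0 <= s by exact: le_trans (ltW delta0) ds.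
have st' : s <= t by apply: le_trans st; rewrite lerDl ltW.
rewrite clip_id ?s0// in h1 h2.
by rewrite tau_mass_snd1 ?mulr1//; apply/andP; split; lra.
Qed.

(** Each kernel is a time factor times a space factor, and the noise is white in time, so the
    covariance factorizes. *)
Lemma noise_covariance_path_kernel i k s r :
  noise_covariance K (path_kernel delta i s) (path_kernel delta k r) =
  tent delta s r * mollified_pairing delta (x + beta i (clip s)) (x + beta k (clip r)).
Proof.
set J := mollified_pairing _ _ _.
have mk c : measurable_fun setT (fun y : 'rV[R]_d => space_mollifier delta (c - y)).
  have m := measurable_rVB (measurable_cst c) (@measurable_id _ 'rV[R]_d setT).
  exact: (measurableT_comp (@measurable_space_mollifier R d delta) m).
have E u : space_pairing K (fun y => path_kernel delta i s (u, y))
    (fun z => path_kernel delta k r (u, z)) = tau s u * tau r u * J.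
  rewrite -RintegralZl//; last first.
    apply: (integrable_pairing mK KD (mk _) (mk _) _ _ (A := 1) (B := 1)) => [y|z||];
      rewrite ?space_mollifier_ge0// integral_space_mollifier//.
  by apply: eq_Rintegral => yz _; rewrite /path_kernel /tau /=; ring.
transitivity (\int[itv_measure 0 T]_u (tau s u * tau r u * J)).
  transitivity (\int[lebesgue_measure]_u (tau s u * tau r u * J)).
    by apply: eq_Rintegral => u _; exact: E.
  apply: Rintegral_supported.
    by do 2! apply: measurable_funM => //.
  move=> u hu; rewrite tau_support ?mul0r//; apply: contra hu => /andP[h1 h2].
  have h3 := clip_ge0 s; have h4 := clip_le s.
  by rewrite /T; apply/andP; split; lra.
rewrite RintegralZr//; apply: (@integrable_bounded _ _ _ _ _ (delta^-1 * delta^-1)).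
  exact: measurable_funM.
by move=> u; rewrite normrM ler_pM.
Qed.

Definition kernel_cov (i k : I) (s : R) : R := \int[itv_measure 0 t]_r
  noise_covariance K (path_kernel delta i s) (path_kernel delta k r).

Let measurable_tentJ i k : measurable_fun setT (fun p : R * R => tent delta p.1 p.2 *
  mollified_pairing delta (x + beta i (clip p.1)) (x + beta k (clip p.2))).
Proof.
apply: measurable_funM; first exact: measurable_tent.
apply: measurable_mollified_pairing; first exact: (measurableT_comp (measurable_base i) measurable_fst).
exact: (measurableT_comp (measurable_base k) measurable_snd).
Qed.

Let tent_bound s r : `|tent delta s r| <= delta^-1 * delta^-1 * (T - 0).
Proof.
apply: Rintegral_itv_bound.
- by rewrite addr_ge0// ltW.
- exact: (measurable_funM (measurable_tau1 s) (measurable_tau1 r)).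
- by move=> u; rewrite normrM ler_pM// norm_tau.
Qed.

Let tentJ_bound i k s r : `|tent delta s r *
  mollified_pairing delta (x + beta i (clip s)) (x + beta k (clip r))| <=
  delta^-1 * delta^-1 * (T - 0) * D.
Proof. by rewrite normrM; apply: ler_pM => //; exact: mollified_pairing_le. Qed.

Lemma kernel_covE i k s : kernel_cov i k s = \int[itv_measure 0 t]_r
  (tent delta s r * mollified_pairing delta (x + beta i (clip s)) (x + beta k (clip r))).
Proof. by apply: eq_Rintegral => r _; exact: noise_covariance_path_kernel. Qed.

Lemma measurable_kernel_cov i k : measurable_fun setT (kernel_cov i k).
Proof.
rewrite (funext (kernel_covE i k)).
exact: (measurable_Rintegral_snd _ (measurable_tentJ i k)).
Qed.

Let tent_avg (s e : R) (g : R -> R) : 0 <= e -> measurable_fun setT g ->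
  (forall r, `|tent delta s r * g r| <= e * tent delta s r) ->
  `|\int[itv_measure 0 t]_r (tent delta s r * g r)| <= e.
Proof.
move=> e0 mg ge.
have mt : measurable_fun setT (tent delta s).
  exact: (measurableT_comp measurable_tent (measurable_pair1 s)).
have It : (itv_measure 0 t).-integrable setT (EFin \o tent delta s).
  exact: integrable_bounded mt (tent_bound s).
have Ie := integrableZl measurableT e It.
have Ig : (itv_measure 0 t).-integrable setT (EFin \o (fun r => tent delta s r * g r)).
  apply: le_integrable Ie => //; first by apply/measurable_EFinP; exact: measurable_funM.
  by move=> r _ /=; rewrite lee_fin (le_trans (ge r))// ler_norm.
rewrite (le_trans (le_normr_Rintegral measurableT Ig))//.
apply: (@le_trans _ _ (\int[itv_measure 0 t]_r (e * tent delta s r))).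
  by apply: le_Rintegral => //; exact: integrable_norm Ig.
by rewrite RintegralZl// ler_piMr// tent_mass_le.
Qed.

Lemma kernel_cov_le i k s : `|kernel_cov i k s| <= D.
Proof.
rewrite kernel_covE; apply: tent_avg => //.
  apply: measurable_mollified_pairing; first exact: measurable_cst.
  exact: measurable_base.
by move=> r; rewrite normrM (ger0_norm (tent_ge0 _ _)) mulrC ler_wpM2r ?tent_ge0// mollified_pairing_le.
Qed.

Lemma kernel_cov_near i k s (c eta : R) : delta <= s -> s + delta <= t -> 0 <= eta ->
  (forall r, `|s - clip r| <= delta ->
    `|mollified_pairing delta (x + beta i s) (x + beta k (clip r)) - c| <= eta) ->
  `|kernel_cov i k s - c| <= eta.
Proof.
move=> ds st eta0 h.
have cs : clip s = s.
  rewrite clip_id// (le_trans (ltW delta0) ds)/= (le_trans _ st)// lerDl.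
  exact: ltW.
have mt : measurable_fun setT (tent delta s).
  exact: (measurableT_comp measurable_tent (measurable_pair1 s)).
have mJ : measurable_fun setT (fun r => mollified_pairing delta (x + beta i s) (x + beta k (clip r))).
  apply: measurable_mollified_pairing; first exact: measurable_cst.
  exact: measurable_base.
have It : (itv_measure 0 t).-integrable setT (EFin \o tent delta s).
  exact: integrable_bounded mt (tent_bound s).
have ItJ : (itv_measure 0 t).-integrable setT (EFin \o (fun r => tent delta s r *
    mollified_pairing delta (x + beta i s) (x + beta k (clip r)))).
  rewrite -{2}cs; apply: integrable_bounded (fun r => tentJ_bound i k s r).
  by rewrite cs; exact: measurable_funM.
have Itc := integrableZr measurableT c It.
have -> : kernel_cov i k s - c = \int[itv_measure 0 t]_r (tent delta s r *
    (mollified_pairing delta (x + beta i s) (x + beta k (clip r)) - c)).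
  rewrite kernel_covE cs -[c in LHS]mul1r -(tent_mass ds st) -RintegralZr//.
  rewrite -[LHS](RintegralB measurableT ItJ Itc).
  by apply: eq_Rintegral => r _; rewrite mulrBr.
apply: tent_avg => //; first exact: measurable_funB.
move=> r; rewrite normrM (ger0_norm (tent_ge0 _ _)) mulrC.
have [sr|sr] := leP `|s - clip r| delta; last by rewrite tent_support ?cs// !mulr0.
by rewrite ler_wpM2r ?tent_ge0// h.
Qed.

End fixed_delta.

Hypothesis K_continuous : forall e, 0 < e -> exists2 rho, 0 < rho &
  forall y y' : 'rV[R]_d, (forall i, `|y 0 i - y' 0 i| < rho) -> `|K y - K y'| <= e.

Lemma kernel_cov_cvg (delta_ : nat -> R) i k s : (forall n, 0 < delta_ n) ->
  delta_ n @[n --> \oo] --> 0 -> 0 < s < t ->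
  kernel_cov (delta_ n) i k s @[n --> \oo] --> K (beta i s - beta k s).
Proof.
move=> delta_0 delta_cvg /andP[s0 st]; apply/cvgrPdist_le => eta eta0.
have eta2 : 0 < eta / 2 by rewrite divr_gt0.
have [rho rho0 hrho] := K_continuous eta2.
(* One third each for the Gaussian displacements of [y] and of [z] and for the motion of [beta k]
   between [s] and [clip r]. *)
pose theta := rho / 3; have theta0 : 0 < theta by rewrite divr_gt0.
have /cvg_ballP/(_ theta theta0)/nbhs_ballP[sigma /= sigma0 hsigma] := @beta_continuous k s.
pose c := 2 * D / theta ^+ 2 * (2 * d%:R).
have c0 : 0 <= c.
  by rewrite /c mulr_ge0// mulr_ge0// ?invr_ge0 ?sqr_ge0// mulr_ge0.
near=> n.
have d0 : 0 < delta_ n by exact: delta_0.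
have d1 : delta_ n < sigma by near: n; apply: (cvgr_lt 0).
have d2 : delta_ n <= s by near: n; apply: (cvgr_le 0).
have d3 : delta_ n <= t - s by near: n; apply: (cvgr_le 0) => //; rewrite subr_gt0.
have d4 : delta_ n <= eta / 2 / (c + 1).
  by near: n; apply: (cvgr_le 0) => //; rewrite divr_gt0// ltr_wpDl.
rewrite distrC; apply: kernel_cov_near => //; [by rewrite addrC -lerBrDr|exact: ltW|].
move=> r sr.
apply: (@le_trans _ _ (eta / 2 + 2 * D / theta ^+ 2 * (2 * d%:R * delta_ n))).
  apply: mollified_pairing_near => //; first exact: ltW.
  move=> y z hy hz; apply: hrho => j.
  have hb : `|beta k s 0 j - beta k (clip r) 0 j| < theta.
    have : ball s sigma (clip r) by rewrite /ball/=; exact: le_lt_trans sr d1.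
    by move=> /hsigma[_ /(_ 0 j)].
  have -> : (y - z) 0 j - (beta i s - beta k s) 0 j =
      (y 0 j - (x + beta i s) 0 j) - (z 0 j - (x + beta k (clip r)) 0 j) +
      (beta k s 0 j - beta k (clip r) 0 j).
    by rewrite !mxE; ring.
  have -> : rho = theta + theta + theta by rewrite /theta; field.
  rewrite (le_lt_trans (ler_normD _ _))// ltrD//.
  by rewrite (le_lt_trans (ler_normB _ _))// ltrD.
rewrite [leRHS]splitr lerD2l mulrA -/c.
rewrite (le_trans (ler_wpM2l c0 d4))// mulrA ler_pdivrMr ?ltr_wpDl//.
by rewrite mulrDr mulr1 mulrC lerDl ltW.
Unshelve. all: by end_near. Qed.

End path_kernel.
End mollified_path.

Lemma norm_weighted_sum_le (R : realType) (I : Type) (L : seq (R * I)) (g : I -> R) :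
  `|\sum_(ai <- L) ai.1 * g ai.2| <= \sum_(ai <- L) `|ai.1| * `|g ai.2|.
Proof.
apply: (le_trans (ler_norm_sum _ _ _)).
by apply: ler_sum => ai _; rewrite normrM.
Qed.

(** * Noise integrals along fixed paths *)

Section noise_limit.
Context (R : realType) (d : nat) (dW : measure_display) (OW : measurableType dW)
  (Q : probability OW R) (K : 'rV[R]_d -> R) (D : R)
  (W : (R * 'rV[R]_d -> R) -> {RV Q >-> R}) (Weps : R -> R -> 'rV[R]_d -> OW -> R).
Hypotheses (mK : measurable_fun setT K) (KD : forall y, `|K y| <= D).
Hypothesis K_continuous : forall e, 0 < e -> exists2 rho, 0 < rho &
  forall y y' : 'rV[R]_d, (forall i, `|y 0 i - y' 0 i| < rho) -> `|K y - K y'| <= e.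
Hypothesis noise : gaussian_noise K W.
Hypothesis mollified : mollified_noise W Weps.
Variables (t : R) (x : 'rV[R]_d) (I : Type) (beta : I -> R -> 'rV[R]_d).
Hypothesis t0 : 0 < t.
Hypothesis beta_continuous : forall i, continuous (beta i).
Notation mu := (itv_measure 0 t).

Definition noise_path (delta : R) (i : I) (w : OW) : R :=
  \int[lebesgue_measure]_(s in `[0, t]) Weps delta (t - s) (x + beta i s) w.

Variable X : I -> OW -> R.
Hypothesis mX : forall i, measurable_fun setT (X i).
Hypothesis X_limit : forall i,
  'N[Q]_2%:E[(fun w => (noise_path eps i w - X i w)%:E)]%E @[eps --> 0^'+] --> 0%E.

Let psi delta i := path_kernel t x beta delta i.
Let h delta i := time_average t (psi delta i).
Let Z delta i s w := Weps delta (t - clip t s) (x + beta i (clip t s)) w.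

Let measurable_beta i : measurable_fun setT (beta i).
Proof.
apply: measurable_fun_rVP => j; apply: continuous_measurable_fun => s.
apply: (@continuous_comp _ _ _ (beta i) (fun y : 'rV[R]_d => y 0 j)).
  exact: beta_continuous.
exact: coord_continuous.
Qed.

Section fixed_delta.
Variable delta : R.
Hypothesis delta0 : 0 < delta.

Let mZ i : measurable_fun setT (fun p : R * OW => Z delta i p.1 p.2).
Proof.
have [mWeps _] := mollified delta0.
have m1 : measurable_fun setT (fun p : R * OW => t - clip t p.1).
  apply: measurable_funB => //; exact: (measurableT_comp (measurable_clip t) measurable_fst).
have m2 : measurable_fun setT (fun p : R * OW => x + beta i (clip t p.1)).
  apply: measurable_rVD => //.
  exact: (measurableT_comp (measurable_beta i) (measurableT_comp (measurable_clip t) measurable_fst)).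
exact: (measurableT_comp mWeps (measurable_fun_pair (measurable_fun_pair m1 m2) measurable_snd)).
Qed.

Let noise_pathE i w : noise_path delta i w = \int[mu]_s Z delta i s w.
Proof.
rewrite Rintegral_itv_measure; last exact: (measurableT_comp (mZ i) (measurable_pair2 w)).
apply: eq_Rintegral => s; rewrite inE/= in_itv/= => st.
by rewrite /Z clip_id.
Qed.

Lemma measurable_noise_path i : measurable_fun setT (noise_path delta i).
Proof. by rewrite (funext (noise_pathE i)); exact: (measurable_Rintegral_fst mu (mZ i)). Qed.

Let h_kernel i : time_kernel (delta^-1 * t) (t + delta) (h delta i).
Proof.
exact: (time_average_kernel (ltW t0) (measurable_path_kernel t x beta_continuous delta i)
  (path_kernel_kernel x t0 beta_continuous delta0 i) (path_kernel_le t x beta delta0 i)).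
Qed.

Lemma noise_test_average i : noise_test (h delta i).
Proof. exact: time_kernel_test (h_kernel i). Qed.

Lemma noise_path_average i : Q.-integrable setT (EFin \o (fun w => noise_path delta i w - W (h delta i) w)) /\
  \int[Q]_w `|noise_path delta i w - W (h delta i) w| = 0.
Proof.
have [_ Wae] := mollified delta0.
have T0 : 0 <= t + delta by rewrite addr_ge0// ltW.
rewrite (funext (noise_pathE i)).
apply: (noise_average_eq mK KD noise t0 T0 (measurable_path_kernel t x beta_continuous delta i)
  (path_kernel_kernel x t0 beta_continuous delta0 i) (path_kernel_le t x beta delta0 i) (mZ i)).
by move=> s; exact: Wae.
Qed.

Lemma noise_covariance_average i k :
  noise_covariance K (h delta i) (h delta k) =
  \int[mu]_s kernel_cov K t x beta delta i k s.
Proof.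
have kk j := path_kernel_kernel x t0 beta_continuous delta0 j.
have N j g G' := @noise_covariance_time_average R d K D mK KD t _ _ _ _ (ltW t0)
  (measurable_path_kernel t x beta_continuous delta j) (kk j) (path_kernel_le t x beta delta0 j) G' g.
rewrite (noise_covarianceC noise (noise_test_average i) (noise_test_average k)).
rewrite (N i _ _ (h_kernel k)); apply: eq_Rintegral => s _.
rewrite (noise_covarianceC noise (noise_test_average k) (time_kernel_test (kk i s))).
exact: (N k _ _ (kk i s)).
Qed.

Definition mollified_variance (L : seq (R * I)) : R :=
  \int[mu]_s \sum_(ai <- L) ai.1 * \sum_(ck <- L) ck.1 * kernel_cov K t x beta delta ai.2 ck.2 s.

Let mW g : measurable_fun setT (W g). Proof. exact: measurable_funPT. Qed.

Let W2 i k : Q.-integrable setT (EFin \o (fun w => W (h delta i) w * W (h delta k) w)).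
Proof.
exact: (integrable_mul_sqr (mW _) (mW _) (noise_sqr_integrable noise (noise_test_average i))
  (noise_sqr_integrable noise (noise_test_average k))).
Qed.

Let Icov i k : mu.-integrable setT (EFin \o kernel_cov K t x beta delta i k).
Proof.
exact: integrable_bounded (measurable_kernel_cov mK KD x t0 beta_continuous delta0 i k)
  (kernel_cov_le mK KD x t0 beta_continuous delta0 i k).
Qed.

(** The combination involves the noises of finitely many tests, so [noise_gaussian] makes it
    Gaussian, and only its variance remains to be expanded. *)
Lemma noise_average_cos_moment (L : seq (R * I)) q :
  \int[Q]_w cos (\sum_(ai <- L) ai.1 * W (h delta ai.2) w + q) =
  expR (- (mollified_variance L / 2)) * cos q.
Proof.
pose S w := \sum_(ai <- L) ai.1 * W (h delta ai.2) w.
have mS : measurable_fun setT S by apply: measurable_sum => ai; exact: measurable_funM.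
have S2E w : S w ^+ 2 = \sum_(ai <- L) ai.1 *
    (fun i w => \sum_(ck <- L) ck.1 * (W (h delta i) w * W (h delta ck.2) w)) ai.2 w.
  rewrite expr2 /S mulr_suml; apply: eq_bigr => ai _.
  rewrite -mulrA mulr_sumr; congr (_ * _); apply: eq_bigr => ck _.
  by rewrite mulrCA.
have IS i : Q.-integrable setT (EFin \o
    (fun w => \sum_(ck <- L) ck.1 * (W (h delta i) w * W (h delta ck.2) w))).
  exact: (integrable_lincomb (f := fun k w => W (h delta i) w * W (h delta k) w)).
have S2 : Q.-integrable setT (EFin \o (fun w => S w ^+ 2)).
  by rewrite (funext S2E); exact: (integrable_lincomb IS L).
have gS : centered_gaussian Q S.
  have := noise_gaussian noise (fun k => (tnth (in_tuple L) k).1)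
    (fun k => noise_test_average (tnth (in_tuple L) k).2).
  by rewrite (_ : (fun w => _) = S)//; apply/funext => w; rewrite /S [RHS]big_tnth.
rewrite (centered_gaussian_cos_moment q mS S2 gS); congr (expR (- (_ / 2)) * _).
under eq_Rintegral do rewrite S2E.
rewrite (Rintegral_lincomb IS).
rewrite /mollified_variance (Rintegral_lincomb (f := fun i s => \sum_(ck <- L)
  ck.1 * kernel_cov K t x beta delta i ck.2 s)); last first.
  by move=> i; exact: (integrable_lincomb (Icov i)).
apply: eq_bigr => ai _; congr (_ * _).
rewrite (Rintegral_lincomb (Icov ai.2)).
rewrite (Rintegral_lincomb (f := fun k w => W (h delta ai.2) w * W (h delta k) w))//.
apply: eq_bigr => ck _; congr (_ * _); rewrite -noise_covariance_average.
exact: (noise_RcovE noise (noise_test_average ai.2) (noise_test_average ck.2)).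
Qed.

End fixed_delta.

Let delta_ (n : nat) : R := n.+1%:R^-1.

Let delta_0 n : 0 < delta_ n. Proof. by rewrite invr_gt0. Qed.

Let delta_cvg : delta_ n @[n --> \oo] --> 0.
Proof. exact: cvg_harmonic. Qed.

Let sigma2 (L : seq (R * I)) : R := \int[mu]_s \sum_(ai <- L) ai.1 *
    \sum_(ck <- L) ck.1 * K (beta ai.2 s - beta ck.2 s).

Let weight (L : seq (R * I)) := \sum_(ai <- L) `|ai.1|.

Let weighted_le (L : seq (R * I)) (g : I -> R) (C : R) : (forall i, `|g i| <= C) ->
  `|\sum_(ai <- L) ai.1 * g ai.2| <= weight L * C.
Proof.
move=> gC; apply: (le_trans (norm_weighted_sum_le _ _)); rewrite mulr_suml.
by apply: ler_sum => ai _; rewrite ler_wpM2l.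
Qed.

Lemma mollified_variance_cvg (L : seq (R * I)) :
  mollified_variance (delta_ n) L @[n --> \oo] --> sigma2 L.
Proof.
apply: (@Rintegral_dominated _ _ _ _ _ _ (weight L * (weight L * D))).
- move=> n; apply: measurable_sum => ai; apply: measurable_funM => //.
  apply: measurable_sum => ck; apply: measurable_funM => //.
  exact: (measurable_kernel_cov mK KD x t0 beta_continuous (delta_0 n)).
- apply: measurable_sum => ai; apply: measurable_funM => //.
  apply: measurable_sum => ck; apply: measurable_funM => //.
  exact: (measurableT_comp mK (measurable_rVB (measurable_beta ai.2) (measurable_beta ck.2))).
- move=> n s.
  apply: (@weighted_le L (fun i => \sum_(ck <- L) ck.1 * kernel_cov K t x beta (delta_ n) i ck.2 s)) => i.
  apply: (@weighted_le L (fun k => kernel_cov K t x beta (delta_ n) i k s)) => k.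
  exact: (kernel_cov_le mK KD x t0 beta_continuous (delta_0 n)).
- apply: filterS (itv_measure_ae 0 t) => s st.
  apply: (cvg_weighted_sum (g := fun n i => \sum_(ck <- L) ck.1 * kernel_cov K t x beta (delta_ n) i ck.2 s)
    (l := fun i => \sum_(ck <- L) ck.1 * K (beta i s - beta ck.2 s))) => i.
  apply: (cvg_weighted_sum (g := fun n k => kernel_cov K t x beta (delta_ n) i k s)
    (l := fun k => K (beta i s - beta k s))) => k.
  exact: (kernel_cov_cvg mK KD x t0 beta_continuous K_continuous).
Qed.

(** The limit in [L^2] is weakened to [L^1], where the mollified integral is replaced by
    [W (h delta i)] at no cost. Integrability of [X i] follows from that of a single difference. *)
Lemma noise_average_cvg i :
  Q.-integrable setT (EFin \o X i) /\
  (\int[Q]_w `|W (h (delta_ n) i) w - X i w| @[n --> \oo] --> 0).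
Proof.
have near_le e : 0 < e -> \forall n \near \oo,
    Q.-integrable setT (EFin \o (fun w => W (h (delta_ n) i) w - X i w)) /\
    \int[Q]_w `|W (h (delta_ n) i) w - X i w| <= e.
  move=> e0; have dp : delta_ n @[n --> \oo] --> 0^'+.
    move=> A hA; have h' : \forall n \near \oo, 0 < delta_ n -> A (delta_ n) := delta_cvg hA.
    by apply: filterS h' => n /(_ (delta_0 n)).
  have /fine_cvgP[hfin /cvgr_dist_le/(_ e e0) hle] := @X_limit i.
  pose N n := 'N[Q]_2%:E[(fun w => (noise_path (delta_ n) i w - X i w)%:E)]%E.
  have hfin' : \forall n \near \oo, N n \is a fin_num := dp _ hfin.
  have hle' : \forall n \near \oo, `|0 - fine (N n)| <= e := dp _ hle.
  near=> n.
  have Nfin : N n \is a fin_num by near: n; exact: hfin'.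
  have Nle : `|0 - fine (N n)| <= e by near: n; exact: hle'.
  have NE : (N n <= e%:E)%E.
    by rewrite -(fineK Nfin) lee_fin; rewrite sub0r normrN in Nle; exact: le_trans (ler_norm _) Nle.
  have mIX : measurable_fun setT (fun w => noise_path (delta_ n) i w - X i w).
    by apply: measurable_funB => //; exact: measurable_noise_path.
  have [I2 h2] := Lnorm2_le (ltW e0) mIX NE.
  have I1 := integrable_sqrW mIX I2.
  have h1 := expectation_le_sqr e0 mIX I2 h2.
  have [J1 J0] := noise_path_average (delta_0 n) i.
  have J2 := integrableB measurableT I1 J1.
  have E w : W (h (delta_ n) i) w - X i w = (noise_path (delta_ n) i w - X i w) -
      (noise_path (delta_ n) i w - W (h (delta_ n) i) w) by ring.
  have I3 : Q.-integrable setT (EFin \o (fun w => W (h (delta_ n) i) w - X i w)).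
    by move: J2; apply: eq_integrable => // w _ /=; rewrite E.
  split=> //.
  apply: (@le_trans _ _ (\int[Q]_w (`|noise_path (delta_ n) i w - X i w| +
      `|noise_path (delta_ n) i w - W (h (delta_ n) i) w|))).
    apply: le_Rintegral => //; first exact: integrable_norm I3.
      exact: (integrableD measurableT (integrable_norm I1) (integrable_norm J1)).
    by move=> w _; rewrite E ler_normB.
  rewrite (_ : \int[Q]_w _ = (\int[Q]_w `|noise_path (delta_ n) i w - X i w|) +
    \int[Q]_w `|noise_path (delta_ n) i w - W (h (delta_ n) i) w|); last first.
    exact: (RintegralD measurableT (integrable_norm I1) (integrable_norm J1)).
  by rewrite J0 addr0.
have IW n : Q.-integrable setT (EFin \o W (h (delta_ n) i)).
  exact: (integrable_sqrW (measurable_funPT (W _)) (noise_sqr_integrable noise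
    (noise_test_average (delta_0 n) i))).
split.
  have [n [In _]] := filter_ex (near_le 1 ltr01).
  move: (integrableB measurableT (IW n) In); apply: eq_integrable => // w _ /=.
  by rewrite -EFinB opprB addrC subrK.
apply/cvgrPdist_le => e e0; have := near_le e e0; apply: filterS => n [_ hn].
by rewrite sub0r normrN ger0_norm// Rintegral_ge0.
Unshelve. all: by end_near. Qed.

(** Cosine is 1-Lipschitz, so convergence in [L^1] carries the Gaussian formula over to [X], with
    the limit of the mollified variances. *)
Theorem noise_cos_moment (L : seq (R * I)) q :
  \int[Q]_w cos (\sum_(ai <- L) ai.1 * X ai.2 w + q) =
  expR (- ((\int[mu]_s \sum_(ai <- L) ai.1 *
    \sum_(ck <- L) ck.1 * K (beta ai.2 s - beta ck.2 s)) / 2)) * cos q.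
Proof.
pose S n w := \sum_(ai <- L) ai.1 * W (h (delta_ n) ai.2) w.
pose S0 w := \sum_(ai <- L) ai.1 * X ai.2 w.
have c1 : \int[Q]_w cos (S n w + q) @[n --> \oo] --> expR (- (sigma2 L / 2)) * cos q.
  under eq_fun do rewrite (noise_average_cos_moment (delta_0 _)).
  apply: cvgMl; apply: continuous_cvg; first exact: continuous_expR.
  by apply: cvgN; apply: cvgMl; exact: mollified_variance_cvg.
suff c2 : \int[Q]_w cos (S n w + q) @[n --> \oo] --> \int[Q]_w cos (S0 w + q).
  exact: cvg_unique c2 c1.
have mS n : measurable_fun setT (S n).
  by apply: measurable_sum => ai; apply: measurable_funM => //; exact: measurable_funPT.
have mS0 : measurable_fun setT S0 by apply: measurable_sum => ai; exact: measurable_funM.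
have mc (Y : OW -> R) : measurable_fun setT Y -> measurable_fun setT (fun w => cos (Y w + q)).
  by move=> mY; apply: (measurableT_comp (@measurable_cos R)); exact: measurable_funD.
have Ic (Y : OW -> R) : measurable_fun setT Y -> Q.-integrable setT (EFin \o (fun w => cos (Y w + q))).
  by move=> mY; apply: (@integrable_bounded _ _ _ _ _ 1) => [|w]; [exact: mc|exact: cos_max].
have IWX n i : Q.-integrable setT (EFin \o (fun w => W (h (delta_ n) i) w - X i w)).
  have [IX _] := noise_average_cvg i.
  exact: (integrableB measurableT (integrable_sqrW (measurable_funPT (W _))
    (noise_sqr_integrable noise (noise_test_average (delta_0 n) i))) IX).
pose N n i := \int[Q]_w `|W (h (delta_ n) i) w - X i w|.
pose L' := [seq (`|ai.1|, ai.2) | ai <- L].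
have le n : `|(\int[Q]_w cos (S n w + q)) - \int[Q]_w cos (S0 w + q)| <=
    \sum_(ai <- L') ai.1 * N n ai.2.
  rewrite -(Rintegral_lincomb (f := fun i w => `|W (h (delta_ n) i) w - X i w|)); last first.
    by move=> i; exact: integrable_norm (IWX n i).
  rewrite -RintegralB ?Ic//.
  have IB := integrableB measurableT (Ic (S n) (mS n)) (Ic S0 mS0).
  rewrite (le_trans (le_normr_Rintegral measurableT IB))//.
  apply: le_Rintegral => //; first exact: integrable_norm IB.
    exact: (integrable_lincomb (f := fun i w => `|W (h (delta_ n) i) w - X i w|)
      (fun i => integrable_norm (IWX n i))).
  move=> w _; rewrite (le_trans (norm_cosB _ _))// opprD addrACA subrr addr0.
  rewrite /L' big_map /S /S0 -sumrB.
  have -> : \sum_(ai <- L) (ai.1 * W (h (delta_ n) ai.2) w - ai.1 * X ai.2 w) =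
      \sum_(ai <- L) ai.1 * (fun i => W (h (delta_ n) i) w - X i w) ai.2.
    by apply: eq_bigr => ai _; rewrite mulrBr.
  exact: (norm_weighted_sum_le L (fun i => W (h (delta_ n) i) w - X i w)).
have N0 : \sum_(ai <- L') ai.1 * N n ai.2 @[n --> \oo] --> 0.
  rewrite [X in _ --> X](_ : 0 = \sum_(ai <- L') ai.1 * (fun=> 0) ai.2); last first.
    by rewrite big1// => ai _; rewrite mulr0.
  by apply: (cvg_weighted_sum (g := N) (l := fun=> 0)) => i; have [] := noise_average_cvg i.
apply/cvgrPdist_le => e e0.
move/cvgrPdist_le: N0 => /(_ e e0); apply: filterS => n hn.
rewrite distrC (le_trans (le n))//.
by move: hn; rewrite sub0r normrN; apply: le_trans; exact: ler_norm.
Qed.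

End noise_limit.

(** * Measurability of paths *)

(** A measurable label in the first variable selects one of countably many measurable maps. With
    grid cells as labels this discretizes a function that is continuous in the first variable. *)
Lemma measurable_countable_family d1 (T1 : measurableType d1) d2 (T2 : measurableType d2)
    d3 (T3 : measurableType d3) (C : countType) (k : T1 -> C) (g : C -> T2 -> T3) :
  (forall c, measurable (k @^-1` [set c])) -> (forall c, measurable_fun setT (g c)) ->
  measurable_fun setT (fun p : T1 * T2 => g (k p.1) p.2).
Proof.
move=> mk mg _ A mA; rewrite setTI.
pose F n := if unpickle n is Some c then (k @^-1` [set c]) `*` (g c @^-1` A) else set0.
rewrite (_ : _ @^-1` A = \bigcup_n F n).
  apply: bigcup_measurable => n _; rewrite /F; case: unpickle => // c.
  by apply: measurableX => //; rewrite -[X in measurable X]setTI; exact: mg.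
apply/seteqP; split => [[x y] /= h|[x y] [n _]].
  by exists (pickle (k x)) => //; rewrite /F pickleK.
by rewrite /F; case: unpickle => // c [/= ->].
Qed.

Section grid.
Context (R : realType).

Definition grid (n : nat) (x : R) : int := Num.floor (x * n.+1%:R).

Lemma measurable_grid n m : measurable (grid n @^-1` [set m]).
Proof.
have -> : grid n @^-1` [set m] = (fun x => x * n.+1%:R) @^-1` `[m%:~R, (m + 1)%:~R[%classic.
  apply/seteqP; split => x /=; rewrite in_itv/= /grid.
    by move=> <-; exact: floor_itv.
  by move=> h; apply: floor_def.
have mf : measurable_fun setT (fun x : R => x * n.+1%:R) by exact: measurable_funM.
by rewrite -[X in measurable X]setTI; exact: mf.
Qed.

Definition grid_point (n : nat) (m : int) : R := m%:~R / n.+1%:R.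

Lemma grid_near n x : `|grid_point n (grid n x) - x| <= n.+1%:R^-1.
Proof.
have n0 : 0 < n.+1%:R :> R by [].
have /andP[h1 h2] := floor_itv (x * n.+1%:R).
rewrite -(ler_pM2r n0) mulVf ?gt_eqF//.
rewrite -[X in _ * X](gtr0_norm n0) -normrM mulrBl.
rewrite /grid_point divfK ?gt_eqF// ler_norml; apply/andP; split.
  by move: h2; rewrite /grid intrD => h2; lra.
by rewrite /grid; lra.
Qed.

Lemma near_grid e : 0 < e -> \forall n \near \oo, forall x : R, `|grid_point n (grid n x) - x| < e.
Proof.
move=> e0; near=> n => x; apply: (le_lt_trans (grid_near n x)).
by near: n; exact: (near_infty_natSinv_lt (PosNum e0)).
Unshelve. all: by end_near. Qed.

End grid.

(** The sigma-algebra of row vectors is generated by coordinates, so a continuous function is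
    reached as a limit of functions constant on the cells of a grid. *)
Lemma continuous_measurable_rV (R : realType) (d : nat) (f : 'rV[R]_d -> R) :
  continuous f -> measurable_fun setT f.
Proof.
move=> cf; pose k n (v : 'rV[R]_d) : 'rV[int]_d := \row_j grid n (v 0 j).
pose p n (c : 'rV[int]_d) : 'rV[R]_d := \row_j grid_point R n (c 0 j).
have mk n c : measurable (k n @^-1` [set c]).
  have -> : k n @^-1` [set c] = \bigcap_(j in [set: 'I_d]) (fun v : 'rV[R]_d => grid n (v 0 j)) @^-1` [set c 0 j].
    apply/seteqP; split => [v /= <- j _ /=|v h]; first by rewrite mxE.
    by apply/rowP => j; rewrite mxE; exact: h.
  apply: fin_bigcap_measurable => [|j _]; first exact: finite_finset.
  rewrite (_ : _ @^-1` _ = (fun v : 'rV[R]_d => v 0 j) @^-1` (grid n @^-1` [set c 0 j]))//.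
  by rewrite -[X in measurable X]setTI; apply: measurable_rV_coord => //; exact: measurable_grid.
apply: (@measurable_fun_cvg _ _ _ _ (fun n v => f (p n (k n v)))) => [n|v _].
  have := @measurable_countable_family _ 'rV[R]_d _ 'rV[R]_d _ R _ (k n) (fun c _ => f (p n c)) (mk n)
    (fun c => measurable_cst _).
  have diag : measurable_fun setT (fun v : 'rV[R]_d => (v, v)) by exact: measurable_fun_pair.
  by move=> h; exact: (measurableT_comp h diag).
apply/cvg_ballP => e e0; have /cvg_ballP/(_ e e0)/nbhs_ballP[delta /= delta0 hd] := cf v.
have := @near_grid R _ delta0; apply: filterS => n hn; apply: hd; split => // i j.
by rewrite /ball/= !mxE ord1 distrC; exact: hn.
Qed.

Lemma clip_lipschitz (R : realType) (t s u : R) : 0 < t ->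
  `|clip t s - clip t u| <= `|s - u|.
Proof.
move=> t0; rewrite /clip /Num.max /Num.min.
have h1 := ler_norm (s - u); have h2 := ler_norm (- (s - u)); rewrite normrN in h2.
case: (ltP s t) => ?; case: (ltP u t) => ?; rewrite ?t0;
  case: (ltP 0 s) => ?; case: (ltP 0 u) => ?;
  rewrite ler_norml; apply/andP; split; lra.
Qed.

(** * Brownian paths frozen outside a bounded time interval *)

Section stopped_path.
Context (R : realType) (d : nat) (dB : measure_display) (OB : measurableType dB)
  (PB : probability OB R) (B : R -> OB -> 'rV[R]_d) (t : R).
Hypotheses (brownian : standard_brownian PB B) (t0 : 0 < t).

(** Brownian paths are continuous on the half-line, whereas the limits along fixed paths ask for
    continuity on the whole line; freezing the path outside [[0, t]] provides it. *)
Definition stopped_path (b : OB) (s : R) : 'rV[R]_d := B (clip t s) b.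

Lemma stopped_path_continuous b : continuous (stopped_path b).
Proof.
move=> s; have cb := @brownian_continuous _ _ _ _ _ _ brownian b.
have cs0 u : `[0, +oo[%classic (clip t u) by rewrite /= in_itv/= andbT clip_ge0.
have h := (subspace_continuousP _ _).1 cb (clip t s) (cs0 s).
have lip (u : R) : `|clip t s - clip t u| <= `|s - u| by exact: clip_lipschitz.
have cc : clip t u @[u --> s] --> clip t s.
  apply/cvgrPdist_lt => e e0; near=> u; apply: (le_lt_trans (lip u)).
  by near: u; exact: cvgr_dist_lt.
move=> A /h hA; have : \forall u \near s, `[0, +oo[%classic (clip t u) -> A (B (clip t u) b).
  exact: cc hA.
by apply: filterS => u; apply; exact: cs0.
Unshelve. all: by end_near. Qed.

(** A process continuous in time and measurable at each time is jointly measurable: time is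
    discretized on a grid. *)
Lemma measurable_stopped_path : measurable_fun setT (fun p : R * OB => stopped_path p.2 p.1).
Proof.
apply: measurable_fun_rVP => j.
apply: (@measurable_fun_cvg _ _ _ _ (fun n p => stopped_path p.2 (grid_point R n (grid n p.1)) 0 j)).
  move=> n; apply: (@measurable_countable_family _ R _ OB _ R _ (grid n)
    (fun c b => stopped_path b (grid_point R n c) 0 j)); first exact: measurable_grid.
  move=> c; apply: (measurableT_comp (measurable_rV_coord j)).
  exact: (brownian_measurable brownian (clip_ge0 _ _)).
move=> [s b] _ /=.
have cs : continuous (fun u => stopped_path b u 0 j).
  move=> u; apply: (@continuous_comp _ _ _ (stopped_path b) (fun y : 'rV[R]_d => y 0 j)).
    exact: stopped_path_continuous.
  exact: coord_continuous.
apply/cvg_ballP => e e0; have /cvg_ballP/(_ e e0)/nbhs_ballP[delta /= delta0 hd] := cs s.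
have := @near_grid R _ delta0; apply: filterS => n hn; apply: hd.
by rewrite /ball/= distrC; exact: hn.
Qed.

Lemma stopped_path_id b s : 0 <= s <= t -> stopped_path b s = B s b.
Proof. by move=> st; rewrite /stopped_path clip_id. Qed.

End stopped_path.

(** By Tonelli the integral of [|F - G|] vanishes in either order of integration, so the null sets
    in [y] attached to each [x] become null sets in [x] for almost every [y]. *)
Lemma ae_swap_eq (R : realType) d1 (T1 : measurableType d1) d2 (T2 : measurableType d2)
    (m1 : {sigma_finite_measure set T1 -> \bar R}) (m2 : {sigma_finite_measure set T2 -> \bar R})
    (F G : T1 * T2 -> R) : measurable_fun setT F -> measurable_fun setT G ->
  (forall x, {ae m2, forall y, F (x, y) = G (x, y)}) ->
  {ae m2, forall y, {ae m1, forall x, F (x, y) = G (x, y)}}.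
Proof.
move=> mF mG FG; pose D p := `|F p - G p|%:E.
have mD : measurable_fun setT D.
  by apply/measurable_EFinP; apply: measurableT_comp => //; exact: measurable_funB.
have D0 p : (0 <= D p)%E by rewrite lee_fin.
have mG2 := @measurable_fun_fubini_tonelli_G _ _ _ _ _ m1 _ mD D0.
have E : (\int[m2]_y `|fubini_G m1 D y| = 0)%E.
  transitivity (\int[m2]_y \int[m1]_x D (x, y))%E.
    by apply: eq_integral => y _; rewrite gee0_abs//; exact: integral_ge0.
  rewrite -(@fubini_tonelli _ _ _ _ _ m1 m2 _ mD D0) integral0_eq// => x _.
  rewrite (ae_eq_integral (cst 0%E)) ?integral0//.
    exact: (measurableT_comp mD (measurable_pair1 x)).
  by apply: filterS (FG x) => y h _; rewrite /D h subrr normr0.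
have := (ae_eq_integral_abs m2 measurableT mG2).1 E.
apply: filterS => y /(_ I) Ey.
have mDy : measurable_fun setT (fun x => D (x, y)) := measurableT_comp mD (measurable_pair2 y).
have E' : (\int[m1]_x `|D (x, y)| = 0)%E.
  by rewrite -[RHS]Ey; apply: eq_integral => x _; rewrite gee0_abs.
have := (ae_eq_integral_abs m1 measurableT mDy).1 E'.
apply: filterS => x /(_ I) [] /eqP; rewrite normr_eq0 subr_eq0 => /eqP.
exact.
Qed.

(** * Convergence in distribution *)

Lemma continuous_complex_pair (R : realType) (g : complex_plane R -> R) :
  continuous g -> continuous (fun p : R * R => g (Complex p.1 p.2)).
Proof.
move=> cg p; apply: (@continuous_comp _ _ _ (fun p : R * R => Complex p.1 p.2 : complex_plane R) g).
  (* Radii in the complex plane are complex numbers, and positivity forces the imaginary part [e']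
     to be 0. The norm is then bounded by the sum of the two coordinate distances. *)
  apply/cvgrPdist_lt => -[e e'] /=; rewrite ltcE/= => /andP[/eqP e'0 e0].
  have e20 : 0 < e / 2 by rewrite divr_gt0.
  exists (ball p.1 (e / 2), ball p.2 (e / 2)); first by split; exact: nbhsx_ballx.
  move=> q [h1 h2]; move: h1 h2; rewrite /ball/= => h1 h2.
  set u := p.1 - q.1; set v := p.2 - q.2.
  change (Complex (Num.sqrt (u ^+ 2 + v ^+ 2)) 0 < Complex e e').
  rewrite ltcE/= e'0 eqxx/= (le_lt_trans _ (_ : `|u| + `|v| < e))//; last first.
    by rewrite (splitr e) ltrD.
  rewrite -[leRHS]ger0_norm ?addr_ge0// -sqrtr_sqr ler_wsqrtr//.
  rewrite [leRHS]sqrrD !real_normK ?num_real// addrAC lerDl.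
  by rewrite mulrn_wge0// mulr_ge0.
exact: cg.
Qed.

Section expectation_wave.
Context (R : realType) (dB : measure_display) (OB : measurableType dB)
  (PB : probability OB R).

Lemma expectationC_wave (phi : OB -> R) dT (T : measurableType dT) (Y : OB -> T -> R) w :
  expectationC PB (fun b => (phi b)%:C%C * expi (Y b w)) =
  Complex (wave PB phi Y 0 w) (wave PB phi Y (- (pi / 2)) w).
Proof.
rewrite /expectationC /wave; congr Complex; apply: eq_Rintegral => b _ /=.
  by rewrite mul0r subr0 addr0.
by rewrite mul0r addr0 cosB cos_pihalf sin_pihalf mulr0 add0r mulr1.
Qed.

End expectation_wave.

(** The section on noise integrals asks for the limit along every index; taking the good paths as
    index type meets this. *)
Lemma lift_list (T : eqType) (R' : eqType) (good : T -> Prop) (L : seq (R' * T)) :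
  (forall ab, ab \in L -> good ab.2) ->
  exists L' : seq (R' * {b | good b}), L = [seq (ai.1, sval ai.2) | ai <- L'].
Proof.
elim: L => [|[a b] L IH] h; first by exists [::].
have [L' ->] : exists L' : seq (R' * {b | good b}), L = [seq (ai.1, sval ai.2) | ai <- L'].
  by apply: IH => ab abL; apply: h; rewrite in_cons abL orbT.
have gb : good b by apply: (h (a, b)); rewrite mem_head.
by exists ((a, exist _ b gb) :: L').
Qed.

(** * Phases of the Feynman-Kac formula *)

Section phases.
Context (R : realType) (d : nat) (dO : measure_display) (Om : measurableType dO)
  (P : probability Om R) (tau : R * 'rV[R]_d -> Om -> Om) (VV : Om -> R) (C : R)
  (dB : measure_display) (OB : measurableType dB) (PB : probability OB R)
  (B : R -> OB -> 'rV[R]_d) (t : R) (x : 'rV[R]_d).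
Hypothesis medium : stationary_medium P tau VV.
Hypothesis VVC : {ae P, forall w, `|VV w| <= C}.
Hypotheses (brownian : standard_brownian PB B) (t0 : 0 < t).
Notation beta := (stopped_path B t).

(** The phase of the Feynman-Kac formula with the field itself; [field_phase] is its version with
    the clamped field. *)
Definition raw_phase (eps : R) (b : OB) (w : Om) : R := (Num.sqrt eps)^-1 *
  \int[lebesgue_measure]_(s in `[0, t]) random_field tau VV ((t - s) / eps) (x + B s b) w.

Let measurable_point eps : measurable_fun setT
  (fun p : R * (OB * Om) => (((t - p.1) / eps, x + beta p.2.1 p.1), p.2.2)).
Proof.
apply: measurable_fun_pair; last exact: (measurableT_comp measurable_snd measurable_snd).
apply: measurable_fun_pair.
  by apply: measurable_funM => //; apply: measurable_funB.
apply: measurable_rVD => //.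
have m : measurable_fun setT (fun p : R * (OB * Om) => (p.1, p.2.1)).
  by apply: measurable_fun_pair => //; exact: (measurableT_comp measurable_fst measurable_snd).
exact: (measurableT_comp (measurable_stopped_path brownian t0) m).
Qed.

Let measurable_raw eps : measurable_fun setT (fun p : R * (OB * Om) =>
  random_field tau VV ((t - p.1) / eps) (x + beta p.2.1 p.1) p.2.2).
Proof. exact: (measurableT_comp (medium_measurable medium) (measurable_point eps)). Qed.

Let measurable_bounded eps : measurable_fun setT (fun p : R * (OB * Om) =>
  bounded_field tau VV C ((t - p.1) / eps, x + beta p.2.1 p.1) p.2.2).
Proof. exact: (measurableT_comp (measurable_bounded_field C medium) (measurable_point eps)). Qed.

Lemma raw_phaseE eps b w : raw_phase eps b w = (Num.sqrt eps)^-1 *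
  \int[itv_measure 0 t]_s random_field tau VV ((t - s) / eps) (x + beta b s) w.
Proof.
congr (_ * _); rewrite Rintegral_itv_measure; last first.
  exact: (measurableT_comp (measurable_raw eps) (measurable_pair2 (b, w))).
apply: eq_Rintegral => s; rewrite inE/= in_itv/= => st.
by rewrite stopped_path_id.
Qed.

Lemma measurable_raw_phase eps : measurable_fun setT (fun p : OB * Om => raw_phase eps p.1 p.2).
Proof.
apply: (eq_measurable_fun (fun p : OB * Om => (Num.sqrt eps)^-1 * \int[itv_measure 0 t]_s
  random_field tau VV ((t - s) / eps) (x + beta p.1 s) p.2)).
  by move=> p _; rewrite raw_phaseE.
apply: measurable_funM => //.
exact: (measurable_Rintegral_fst (itv_measure 0 t) (measurable_raw eps)).
Qed.

Lemma measurable_field_phase eps : measurable_fun setT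
  (fun p : OB * Om => field_phase tau VV C beta t x eps p.1 p.2).
Proof.
apply: measurable_funM => //.
exact: (measurable_Rintegral_fst (itv_measure 0 t) (measurable_bounded eps)).
Qed.

(** Null sets are exchanged twice: the time [s] against [w] along a fixed path, and the path [b]
    against [w]. *)
Lemma raw_phase_ae eps : {ae P, forall w, {ae PB, forall b,
  raw_phase eps b w = field_phase tau VV C beta t x eps b w}}.
Proof.
have swap := @ae_swap_eq _ _ _ _ _ PB P _ _ (measurable_raw_phase eps) (measurable_field_phase eps).
apply: swap => b.
have m : measurable_fun setT (fun p : R * Om => (p.1, (b, p.2))).
  by apply: measurable_fun_pair => //; exact: measurable_fun_pair.
have h := @ae_swap_eq _ _ _ _ _ (itv_measure 0 t) P _ _
  (measurableT_comp (measurable_raw eps) m) (measurableT_comp (measurable_bounded eps) m).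
have := h (fun s => bounded_field_ae medium VVC ((t - s) / eps, x + beta b s)).
apply: filterS => w hw; rewrite /= raw_phaseE; congr (_ * _).
apply: eq_Rintegral_ae => //.
- exact: (measurableT_comp (measurable_raw eps) (measurable_pair2 (b, w))).
- exact: (measurableT_comp (measurable_bounded eps) (measurable_pair2 (b, w))).
Qed.

End phases.

Lemma bounded_funE (R : realType) (T : Type) (g : T -> R) : bounded_fun g ->
  exists D, forall z, `|g z| <= D.
Proof.
move=> [D [_ hD]]; exists (D + 1) => z.
by apply: (hD (D + 1)) => //; rewrite ltrDl.
Qed.

Lemma expectation_bounded (R : realType) dT (T : measurableType dT) (mu : probability T R)
  (Z : T -> R) (D : R) : measurable_fun setT Z -> (forall w, `|Z w| <= D) ->
  'E_mu[Z]%E = (\int[mu]_w Z w)%:E.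
Proof.
move=> mZ ZD; rewrite unlock fineK//.
exact: (integrable_fin_num measurableT (integrable_bounded mu mZ ZD)).
Qed.

Lemma wave_ae (R : realType) dB (OB : measurableType dB) (PB : probability OB R)
  (phi : OB -> R) dT (T : measurableType dT) (Y Y' : OB -> T -> R) q w :
  measurable_fun setT phi ->
  measurable_fun setT (fun p : OB * T => Y p.1 p.2) ->
  measurable_fun setT (fun p : OB * T => Y' p.1 p.2) ->
  {ae PB, forall b, Y b w = Y' b w} ->
  wave PB phi Y q w = wave PB phi Y' q w.
Proof.
move=> mphi mY mY' YY'.
have m (Z : OB -> T -> R) : measurable_fun setT (fun p : OB * T => Z p.1 p.2) ->
    measurable_fun setT (fun b => phi b * cos (Z b w + q)).
  move=> mZ; apply: measurable_funM => //; apply: measurable_cosD.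
  exact: (measurableT_comp mZ (measurable_pair2 w)).
apply: eq_Rintegral_ae; [exact: m|exact: m|].
by apply: filterS YY' => b ->.
Qed.

(** * Passage to the limit in test functions of the two waves *)

Section limit.
Context (R : realType) (d : nat)
  (dO : measure_display) (Om : measurableType dO) (P : probability Om R)
  (tau : R * 'rV[R]_d -> Om -> Om) (VV : Om -> R) (C M : R)
  (dB : measure_display) (OB : measurableType dB) (PB : probability OB R)
  (B : R -> OB -> 'rV[R]_d)
  (dW : measure_display) (OW : measurableType dW) (Q : probability OW R)
  (W : (R * 'rV[R]_d -> R) -> {RV Q >-> R}) (Weps : R -> R -> 'rV[R]_d -> OW -> R)
  (t : R) (x : 'rV[R]_d) (X : OB -> OW -> R) (phi : OB -> R) (Mphi : R).
Hypotheses (medium : stationary_medium P tau VV) (C0 : 0 <= C)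
  (VVC : {ae P, forall w, `|VV w| <= C}) (M0 : 0 < M).
Hypothesis finite_range_M : forall S S' : set (R * 'rV[R]_d),
    (M%:E <= set_dist S S')%E ->
    independent_families P (field_sigma_algebra tau VV S) (field_sigma_algebra tau VV S').
Hypotheses (brownian : standard_brownian PB B)
  (noise : gaussian_noise (space_covariance P tau VV) W)
  (mollified : mollified_noise W Weps) (X_integral : noise_integral Q PB B Weps t x X).
Hypotheses (t0 : 0 < t) (mphi : measurable_fun setT phi) (phiM : forall b, `|phi b| <= Mphi).
Notation beta := (stopped_path B t).

Let good (b : OB) : Prop :=
  'N[Q]_2%:E[(fun w => (noise_path Weps t x beta eps b w - X b w)%:E)]%E
    @[eps --> 0^'+] --> 0%E.

Let good_ae : {ae PB, forall b, good b}.
Proof.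
apply: filterS X_integral.2 => b; rewrite /good.
have E eps w : noise_path Weps t x beta eps b w =
    \int[lebesgue_measure]_(s in `[0, t]) Weps eps (t - s) (x + B s b) w.
  by apply: eq_Rintegral => s; rewrite inE/= in_itv/= => st; rewrite stopped_path_id.
by under [in X in _ -> X]eq_fun do under eq_fun do rewrite E.
Qed.

Let mX b : measurable_fun setT (X b).
Proof. exact: (measurableT_comp X_integral.1 (measurable_pair1 b)). Qed.

Lemma noise_integral_cos_moment (L : seq (R * OB)) q : (forall ab, ab \in L -> good ab.2) ->
  \int[Q]_w cos (\sum_(ab <- L) ab.1 * X ab.2 w + q) =
  expR (- (path_variance P tau VV beta t L / 2)) * cos q.
Proof.
move=> L_good; have [L' ->] := lift_list L_good.
have := @noise_cos_moment _ _ _ _ _ _ _ _ _ (measurable_space_covariance medium C0 VVC finite_range_M)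
  (space_covariance_le medium C0 VVC M0 finite_range_M)
  (fun e e0 => space_covariance_continuous medium C0 VVC M0 finite_range_M e0)
  noise mollified t x {b | good b} (fun b => beta (sval b)) t0
  (fun b => @stopped_path_continuous _ _ _ _ _ _ _ brownian t0 (sval b))
  (fun b => X (sval b)) (fun b => mX (sval b)) (fun b => svalP b) L' q.
under [in X in X = _ -> _]eq_Rintegral do rewrite -(big_map (fun ai : R * {b | good b} => (ai.1, sval ai.2)) xpredT (fun ab : R * OB => ab.1 * X ab.2 _)).
move=> ->; rewrite /path_variance; congr (expR (- (_ / 2)) * _).
apply: eq_Rintegral => s _; rewrite big_map; apply: eq_bigr => ai _.
by rewrite big_map.
Qed.

Section test_function.
Variables (h : R -> R -> R) (D : R).
Hypotheses (ch : continuous (fun p : R * R => h p.1 p.2)) (hD : forall a b, `|h a b| <= D).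

Let Mphi1 : 0 < Mphi + 1.
Proof.
by rewrite ltr_wpDl// (le_trans (normr_ge0 _) (phiM point)).
Qed.

Lemma measurable_test_waves dT (T : measurableType dT) (Y : OB -> T -> R) :
  measurable_fun setT (fun p : OB * T => Y p.1 p.2) ->
  measurable_fun setT (fun w => h (wave PB phi Y 0 w) (wave PB phi Y (- (pi / 2)) w)).
Proof.
move=> mY; have wM q w : `|wave PB phi Y q w| <= Mphi + 1.
  by apply: (@le_trans _ _ Mphi); [exact: wave_le|rewrite lerDl].
apply: (measurable_weierstrass Mphi1 ch hD) => //; exact: measurable_wave.
Qed.

Lemma raw_waves_cvg (e_ : nat -> R) : (forall n, 0 < e_ n) -> e_ n @[n --> \oo] --> 0 ->
  \int[P]_w h (wave PB phi (raw_phase tau VV B t x (e_ n)) 0 w)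
              (wave PB phi (raw_phase tau VV B t x (e_ n)) (- (pi / 2)) w) @[n --> \oo] -->
  \int[Q]_w h (wave PB phi X 0 w) (wave PB phi X (- (pi / 2)) w).
Proof.
move=> e_0 e_cvg.
have mraw n := measurable_raw_phase x medium brownian t0 (e_ n).
have mfield n := measurable_field_phase C x medium brownian t0 (e_ n).
have E n : \int[P]_w h (wave PB phi (raw_phase tau VV B t x (e_ n)) 0 w)
              (wave PB phi (raw_phase tau VV B t x (e_ n)) (- (pi / 2)) w) =
    \int[P]_w h (wave PB phi (field_phase tau VV C beta t x (e_ n)) 0 w)
              (wave PB phi (field_phase tau VV C beta t x (e_ n)) (- (pi / 2)) w).
  apply: eq_Rintegral_ae; [exact: measurable_test_waves|exact: measurable_test_waves|].
  apply: filterS (raw_phase_ae x medium VVC brownian t0 (e_ n)) => w hw.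
  by congr h; apply: wave_ae.
under eq_fun do rewrite E.
apply: (cvg_continuous_waves mphi phiM mfield X_integral.1 good_ae) ch hD.
move=> L q L_good; rewrite (noise_integral_cos_moment q L_good).
exact: (medium_cos_cvg medium C0 VVC M0 finite_range_M
  (fun b => @stopped_path_continuous _ _ _ _ _ _ _ brownian t0 b) x (ltW t0) e_0 e_cvg).
Qed.

End test_function.
End limit.

Theorem theorem2p4 (R : realType) (d : nat) (hd : (3 <= d)%N)
  (dO : measure_display) (Om : measurableType dO) (P : probability Om R)
  (tau : R * 'rV[R]_d -> Om -> Om) (VV : Om -> R)
  (dB : measure_display) (OB : measurableType dB) (PB : probability OB R)
  (B : R -> OB -> 'rV[R]_d)
  (dW : measure_display) (OW : measurableType dW) (Q : probability OW R)
  (W : (R * 'rV[R]_d -> R) -> {RV Q >-> R})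
  (f : 'rV[R]_d -> R) (u0 : R -> 'rV[R]_d -> OW -> R[i]) :
  stationary_medium P tau VV ->
  uniformly_bounded P VV ->
  finite_range P tau VV ->
  continuous f -> bounded_fun f ->
  standard_brownian PB B ->
  gaussian_noise (space_covariance P tau VV) W ->
  stratonovich_solution PB B W f u0 ->
  forall (t : R) (x : 'rV[R]_d), 0 < t ->
  cvg_in_distribution P Q
    (fun eps => feynman_kac PB B (random_field tau VV) f eps t x) (u0 t x).
Proof.
move=> medium [C0 VVC0] [M M0 range] cf /bounded_funE[Mf fM] brownian noise
  [Weps mollified sol] t x t0.
have [X X_integral u0E] := sol t x t0.
(* The essential bound serves as radius of clamping, so it is made nonnegative. *)
pose C := Num.max 0 C0; have C_ge0 : 0 <= C by rewrite le_max lexx.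
have VVC : {ae P, forall w, `|VV w| <= C}.
  by apply: filterS VVC0 => w; rewrite le_max orbC => ->.
pose phi b := f (x + B t b).
have mphi : measurable_fun setT phi.
  apply: (measurableT_comp (continuous_measurable_rV cf)).
  by apply: measurable_rVD => //; exact: (brownian_measurable brownian (ltW t0)).
have phiM b : `|phi b| <= Mf by exact: fM.
have uE eps w : feynman_kac PB B (random_field tau VV) f eps t x w =
    Complex (wave PB phi (raw_phase tau VV B t x eps) 0 w)
            (wave PB phi (raw_phase tau VV B t x eps) (- (pi / 2)) w).
  by rewrite -expectationC_wave.
have {}u0E w : u0 t x w = Complex (wave PB phi X 0 w) (wave PB phi X (- (pi / 2)) w).
  by rewrite u0E -expectationC_wave.
rewrite (funext u0E).
have mraw eps : measurable_fun setT (fun p : OB * Om => raw_phase tau VV B t x eps p.1 p.2).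
  exact: (measurable_raw_phase x medium brownian t0 eps).
split.
- move=> eps _; rewrite (funext (uE eps)); split => /=; exact: (measurable_wave PB mphi (mraw eps)).
- split => /=; exact: (measurable_wave PB mphi X_integral.1).
move=> g cg /bounded_funE[D gD].
pose h a b := g (Complex a b).
have ch : continuous (fun p : R * R => h p.1 p.2) by exact: continuous_complex_pair.
have hD a b : `|h a b| <= D by exact: gD.
have mh := measurable_test_waves PB mphi phiM ch hD.
rewrite (expectation_bounded Q (mh _ _ _ X_integral.1) (fun w => hD _ _)).
have E eps : 'E_P[(fun w => g (feynman_kac PB B (random_field tau VV) f eps t x w))]%E =
    (\int[P]_w h (wave PB phi (raw_phase tau VV B t x eps) 0 w)
                 (wave PB phi (raw_phase tau VV B t x eps) (- (pi / 2)) w))%:E.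
  rewrite -(expectation_bounded P (mh _ _ _ (mraw eps)) (fun w => hD _ _)).
  by congr ('E_P[_]%E); apply/funext => w; rewrite uE.
under eq_fun do rewrite E.
apply: cvg_EFin; first exact: nearW.
(* Sequences suffice for a one-sided limit, and dominated convergence, on which the preceding limits
   rest, is available along sequences. *)
apply/cvg_at_rightP => e_ [e_0 e_cvg].
exact: (raw_waves_cvg medium C_ge0 VVC M0 range brownian noise mollified X_integral t0
  mphi phiM ch hD e_0 e_cvg).
Qed.
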